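(* Let $\Lambda_0=1$ and $a\neq0$. Using the functions $C_1,C_2,C_3$, the polynomial $q(r,a,C)$, the map $\rho$ and the quantity $\Delta\tilde\theta$ defined in the context, set $$\Omega_1=\{(a,C,\omega): C>C_1(a),\ a<0,\ \omega>0\},\quad \Omega_2=\{(a,C,\omega): C_2(a)<C<C_3(a),\ 0<a<\tfrac{8}{27},\ \omega>0\},$$ $$\Omega_3=\{(a,C,\omega): C<C_1(a),\ a>0,\ \omega>0\},\quad \Omega=(\Omega_1\cup\Omega_3)\setminus\Omega_2,$$ $$\beta_1=\{(a,C,\omega): C=C_1(a),\ a\ne0,\ \omega>0\},$$ $$\beta_2=\{(a,C,\omega): C=C_2(a),\ 0<a<\tfrac8{27},\ \omega>0\},\quad \beta_3=\{(a,C,\omega): C=C_3(a),\ 0<a<\tfrac8{27},\ \omega>0\}.$$ Under the convention that a point $(a,C,\omega)$ represents a helicoidal rotating drop if the TreadmillSled of its profile curve is contained in the level set $G=C$, the following hold. (i) Every point $(a,C,\omega)$ in the interior of $\Omega$ represents a helicoidal rotating drop whose fundamental piece has finite length. The TreadmillSled of the profile curve of this surface is parametrized by $\rho$ defined for values of $r$ between the only two roots of $q(r,a,C)$. (ii) Every point of $\Omega_2$ represents two helicoidal rotating drops, both having fundamental pieces of finite length. The TreadmillSleds of their profile curves are parametrized by $\rho$ defined for those $r$ lying between the first and second roots of $q(r,a,C)$, and between the third and fourth roots of $q(r,a,C)$, respectively. (iii) Every point $(a,C,\omega)\in\beta_1$ represents a circular helicoidal rotating drop (a round cylinder). This cylinder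 is the same for all values of $\omega$. (iv) Every point $(a,C,\omega)\in\beta_2$ represents two helicoidal rotating drops: a circular cylinder, and a non-circular helicoidal rotating drop whose fundamental piece has bounded length. The circular cylinder is the same for all values of $\omega$. (v) Every point of $\beta_3$ represents three helicoidal rotating drops. The first is a circular cylinder, which is the same for all values of $\omega$. The second has TreadmillSled parametrized by $\rho$ defined for those $r$ between the first and second roots of $q(r,a,C)$, where the second root has multiplicity $2$. The third has TreadmillSled parametrized by $\rho$ defined for those $r$ between the second and third roots of $q(r,a,C)$. The second and third surfaces are not properly immersed; their profile curves have a circle as a limit cycle and have infinite winding number with respect to a point interior to this circle. Solutions similar to these second or third types are called helicoidal drops of exceptional type. (vi) Points of the form $(a,C,\omega)=(\frac8{27},-\frac98,\omega)$ represent two helicoidal rotating drops: a circular cylinder, which is the same for all values of $\omega$, and one helicoidal drop of exceptional type. (vii) Up to a rigid motion, every helicoidal rotating drop (with $\Lambda_0=1$, $a\ne0$) falls into one of the cases (i)–(vi). (viii) Every helicoidal rotating drop that is not exceptional is either properly immersed (when $\Delta\tilde\theta/\pi$ is a rational number) or it is dense in the region bounded by two round cylinders (when $\Delta\tilde\theta/\pi$ is an irrational number).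
   Context: Helicoidal surfaces. For $\omega>0$ and a plane curve $\alpha(s)=(x(s),y(s))$ parametrized by arc length (the profile curve), consider the immersion $$\phi(s,t)=(x(s)\cos\omega t+y(s)\sin\omega t,\,-x(s)\sin\omega t+y(s)\cos\omega t,\,t).$$ Let $R$ be the distance to the $z$-axis and $H$ the mean curvature (sign convention: a round cylinder of radius $R$ with inward normal has $2H=1/R$). Writing $x'=\cos\theta$, $y'=\sin\theta$, the orientation used is $\nu=\frac{1}{\sqrt{1+\omega^2\xi_1^2}}(\sin(\theta-\omega t),-\cos(\theta-\omega t),-\omega\xi_1)$. The surface is a helicoidal rotating drop (with parameters $\Lambda_0,a$) if $2H=\Lambda_0-\frac a2R^2$. Here $\Lambda_0=1$. TreadmillSled. The TreadmillSled of $\alpha$ is the curve $(\xi_1(s),\xi_2(s))$ with $$\xi_1=x\cos\theta+y\sin\theta,\qquad \xi_2=x\sin\theta-y\cos\theta.$$ Note $\xi_1^2+\xi_2^2=x^2+y^2=R^2$. Let $$G(\xi_1,\xi_2)=\frac{2\xi_2}{\sqrt{1+\omega^2\xi_1^2}}+(\xi_1^2+\xi_2^2)-\frac a4(\xi_1^2+\xi_2^2)^2 .$$ The TreadmillSled of the profile curve of a helicoidal rotating drop lies in a level set $G=C$. For a round cylinder the TreadmillSled is a single point. Polynomial and map $\rho$. With $r=\xi_1^2+\xi_2^2$, set $$q(r,a,C)=-16C^2+64r+32Cr-16r^2-8aCr^2+8ar^3-a^2r^4 .$$ If $0\le r_-<r_+$ satisfy $q(r_\pm,a,C)=0$ and $q>0$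 on $(r_-,r_+)$, define on $[r_-,r_+]$ $$\rho(r)=\left(\frac{\sqrt{q(r,a,C)}}{\sqrt{64+(4C-4r+ar^2)^2\omega^2}},\ \frac{(4C-4r+ar^2)\sqrt{1+r\omega^2}}{\sqrt{64+(4C-4r+ar^2)^2\omega^2}}\right).$$ Level sets of $G$ are symmetric under $\xi_1\mapsto-\xi_1$; $\rho$ covers only the half with $\xi_1\ge0$, and ''TreadmillSled parametrized by $\rho$'' means that this half of it is parametrized by $\rho$ (the rest being the mirror image). ''Between two roots'' means on such an interval $[r_-,r_+]$. Roots are ordered increasingly and counted as distinct roots. Fundamental piece. When the relevant connected component of $G=C$ is a regular closed curve, a fundamental piece of the profile curve is a connected part of it whose TreadmillSled corresponds to exactly one traversal of that closed curve. Angle variation. For such an interval, $$\Delta\tilde\theta=\int_{r_-}^{r_+}\frac{(4C+ar^2-4r)\sqrt{1+r\omega^2}}{r\sqrt{q(r,a,C)}}\,dr ,$$ the variation of the polar angle of the profile curve along a fundamental piece. Functions $C_i$. Let $h(R)=\frac{2(R-1)}{R^3}$. Define $R_1(a)$ for $a\neq0$ as the solution $R<1$ of $h(R)=a$; for $0<a<\frac8{27}$ define $R_2(a)$ as the solution of $h(R)=a$ with $1<R<\frac32$, and $R_3(a)$ as the solution with $R>\frac32$. Let $r_i(a)=R_i(a)^2$ and $$C_i(a)=\frac{16-8r_i+6ar_i^2-a^2r_i^3}{4(-2+ar_i)},\quad i=1,2,3.$$ *)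

(* Defs.v *)
From HB Require Import structures.
From mathcomp Require Import all_boot all_order all_algebra.
From mathcomp Require Import all_classical all_reals all_analysis.
From Stdlib Require List.

Set Implicit Arguments.
Unset Strict Implicit.
Unset Printing Implicit Defensive.

Import Order.TTheory GRing.Theory Num.Theory numFieldNormedType.Exports.

Local Open Scope classical_set_scope.
Local Open Scope ring_scope.

(** * Helicoidal surfaces and rotating drops *)

(* Complete plane curves [s |-> (px s, py s)] parametrized by arc length, with a
   determination [pth] of the angle of the tangent. With [Lambda_0 = 1] the drop
   equation determines [pth'] as a smooth function of [px], [py], [pth] and
   solutions move at unit speed, so the maximal solutions are exactly those
   defined on the whole line. *)
Record profile (R : realType) := Profile {
  px : R -> R;
  py : R -> R;
  pth : R -> R;
  px_arc : forall s : R, is_derive s 1 px (cos (pth s));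
  py_arc : forall s : R, is_derive s 1 py (sin (pth s));
  pth_derivable : forall s : R, derivable pth s 1 }.

Section surfaces.
Variable R : realType.
Implicit Types (a C w s t r x : R) (al be : profile R) (p : R * R).

Definition alpha al s : R * R := (px al s, py al s).

Definition xi1 al s := px al s * cos (pth al s) + py al s * sin (pth al s).
Definition xi2 al s := px al s * sin (pth al s) - py al s * cos (pth al s).

Definition treadmill al s : R * R := (xi1 al s, xi2 al s).

Definition vec3 (x y z : R) : 'rV[R]_3 := \row_(i < 3) [:: x; y; z]`_i.

Definition dot3 (u v : 'rV[R]_3) : R := \sum_(i < 3) u 0 i * v 0 i.

Definition phi w al s t : 'rV[R]_3 :=
  vec3 (px al s * cos (w * t) + py al s * sin (w * t))
       (- px al s * sin (w * t) + py al s * cos (w * t))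
       t.

Definition nu w al s t : 'rV[R]_3 :=
  (Num.sqrt (1 + w ^+ 2 * xi1 al s ^+ 2))^-1 *:
  vec3 (sin (pth al s - w * t)) (- cos (pth al s - w * t)) (- w * xi1 al s).

Definition dpar1 (F : R -> R -> 'rV[R]_3) s t : 'rV[R]_3 :=
  \row_(i < 3) derive1 (fun u => F u t 0 i) s.
Definition dpar2 (F : R -> R -> 'rV[R]_3) s t : 'rV[R]_3 :=
  \row_(i < 3) derive1 (fun u => F s u 0 i) t.

(* Half the trace of the shape operator, from the coefficients E, F, G and
   e, f, g of the two fundamental forms, with e = <F_ss, N>, etc.; a round
   cylinder of radius R has H = 1 / (2 R) for the inward normal. *)
Definition mean_curvature (F N : R -> R -> 'rV[R]_3) s t : R :=
  let Fs := dpar1 F in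
  let Ft := dpar2 F in
  let E1 := dot3 (Fs s t) (Fs s t) in
  let F1 := dot3 (Fs s t) (Ft s t) in
  let G1 := dot3 (Ft s t) (Ft s t) in
  let e2 := dot3 (dpar1 Fs s t) (N s t) in
  let f2 := dot3 (dpar2 Fs s t) (N s t) in
  let g2 := dot3 (dpar2 Ft s t) (N s t) in
  (e2 * G1 - f2 * F1 *+ 2 + g2 * E1) / (2 * (E1 * G1 - F1 ^+ 2)).

Definition axis_dist (v : 'rV[R]_3) : R :=
  Num.sqrt (v 0 (inord 0) ^+ 2 + v 0 (inord 1) ^+ 2).

(* Here [Lambda_0 = 1]. *)
Definition rotating_drop a w al : Prop :=
  forall s t, 2 * mean_curvature (phi w al) (nu w al) s t
              = 1 - a / 2 * axis_dist (phi w al s t) ^+ 2.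

Definition surface w al : set 'rV[R]_3 := [set v | exists s t, v = phi w al s t].

Definition congruent w al be : Prop :=
  exists (M : 'M[R]_3) (v : 'rV[R]_3),
    [/\ M *m M^T = 1%:M, \det M = 1
      & [set u *m M + v | u in surface w al] = surface w be].

Definition cylinder (R0 : R) : set 'rV[R]_3 := [set v | axis_dist v = R0].

Definition circular w al : Prop :=
  exists2 R0 : R, 0 < R0 & surface w al = cylinder R0.

(* [phi] factors through the quotient of the parameter plane by the periods of
   the profile curve (a cylinder when the profile curve closes up); this says
   that the induced immersion of that quotient is a proper map. *)
Definition properly_immersed w al : Prop :=
  forall K : set 'rV[R]_3, compact K ->
    exists2 D : set (R * R), compact D &
      forall s t, K (phi w al s t) ->
        exists2 tau : R, forall u, alpha al (u + tau) = alpha al u & D (s + tau, t).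

(* For [R1 = 0] the inner cylinder degenerates to the axis. *)
Definition dense_between w al (R1 R2 : R) : Prop :=
  let region := [set v : 'rV[R]_3 | R1 <= axis_dist v <= R2] in
  surface w al `<=` region /\ region `<=` closure (surface w al).

(** * Level sets *)

Definition Gfun a w p : R :=
  2 * p.2 / Num.sqrt (1 + w ^+ 2 * p.1 ^+ 2) + (p.1 ^+ 2 + p.2 ^+ 2)
  - a / 4 * (p.1 ^+ 2 + p.2 ^+ 2) ^+ 2.

Definition Glevel a C w : set (R * R) := [set p | Gfun a w p = C].

Definition represents a C w al : Prop :=
  rotating_drop a w al /\ range (treadmill al) `<=` Glevel a C w.

(* The point (a, C, w) represents exactly the drops in [l], counted up to rigid
   motion. *)
Definition represents_exactly a C w (l : seq (profile R)) : Prop :=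
  [/\ forall al, List.In al l -> represents a C w al,
      List.ForallOrdPairs (fun al be => ~ congruent w al be) l
    & forall be, represents a C w be ->
        exists2 al, List.In al l & congruent w al be].

Definition qdrop a C : {poly R} :=
  (- 16 * C ^+ 2)%:P + 64 *: 'X + (32 * C) *: 'X - 16 *: 'X^2
  - (8 * a * C) *: 'X^2 + (8 * a) *: 'X^3 - (a ^+ 2) *: 'X^4.

Definition distinct_roots a C (rs : seq R) : Prop :=
  sorted <%R rs /\ forall r, root (qdrop a C) r = (r \in rs).

Definition rho a C w r : R * R :=
  let P := 4 * C - 4 * r + a * r ^+ 2 in
  let D := Num.sqrt (64 + P ^+ 2 * w ^+ 2) in
  (Num.sqrt (qdrop a C).[r] / D, P * Num.sqrt (1 + r * w ^+ 2) / D).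

Definition root_interval a C (r1 r2 : R) : Prop :=
  [/\ 0 <= r1 < r2, root (qdrop a C) r1, root (qdrop a C) r2
    & forall r, r1 < r < r2 -> 0 < (qdrop a C).[r]].

(* The half of the TreadmillSled in [0 <= xi1] is the image of [i] under [rho]
   (which is injective, as rho(r) has squared norm r); the rest is its mirror
   image. *)
Definition sled_param a C w (i : interval R) al : Prop :=
  let half := rho a C w @` [set` i] in
  range (treadmill al) = half `|` [set (- p.1, p.2) | p in half].

(* A compact connected component of a level set consisting of regular points of
   the function is a regular closed curve. *)
Definition regular_closed_curve a C w (K : set (R * R)) : Prop :=
  [/\ exists2 p, Glevel a C w p & K = connected_component (Glevel a C w) p,
      compact K
    & forall p, K p -> derive1 (fun u => Gfun a w (u, p.2)) p.1 != 0
                       \/ derive1 (fun u => Gfun a w (p.1, u)) p.2 != 0].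

(* [I] is the parameter interval of a fundamental piece: on it the TreadmillSled
   runs exactly once through the closed curve. *)
Definition fundamental_piece a C w al (I : set R) : Prop :=
  let K := connected_component (Glevel a C w) (treadmill al 0) in
  [/\ regular_closed_curve a C w K, is_interval I, set_inj I (treadmill al)
    & treadmill al @` I = K].

(* The parameter being arc length, the length of a piece is the measure of its
   parameter interval. *)
Definition finite_fundamental_piece a C w al : Prop :=
  (exists I, fundamental_piece a C w al I) /\
  (forall I, fundamental_piece a C w al I -> (lebesgue_measure I < +oo)%E).

Definition angle_variation a C w (r1 r2 : R) : R :=
  \int[lebesgue_measure]_(r in `[r1, r2])
    ((4 * C + a * r ^+ 2 - 4 * r) * Num.sqrt (1 + r * w ^+ 2)
     / (r * Num.sqrt (qdrop a C).[r])).

(** * Exceptional drops *)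

Definition circle (R0 : R) : set (R * R) := [set p | p.1 ^+ 2 + p.2 ^+ 2 = R0 ^+ 2].
Definition disk (R0 : R) : set (R * R) := [set p | p.1 ^+ 2 + p.2 ^+ 2 < R0 ^+ 2].

Definition limit_cycle al (R0 : R) : Prop :=
  [/\ range (alpha al) `&` circle R0 = set0,
      cluster (alpha al s @[s --> +oo]) = circle R0
    & cluster (alpha al s @[s --> -oo]) = circle R0].

(* A continuous determination of the polar angle about [p] increases, or
   decreases, by an infinite amount along the whole curve. *)
Definition infinite_winding al p : Prop :=
  exists psi : R -> R,
    [/\ continuous psi,
        forall s, exists2 d : R, 0 < d &
          alpha al s = (p.1 + d * cos (psi s), p.2 + d * sin (psi s))
      & (psi s @[s --> -oo] --> -oo /\ psi s @[s --> +oo] --> +oo)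
        \/ (psi s @[s --> -oo] --> +oo /\ psi s @[s --> +oo] --> -oo)].

(* The winding number makes sense only for points off the curve. *)
Definition exceptional w al : Prop :=
  ~ properly_immersed w al /\
  exists R0 : R, [/\ 0 < R0, limit_cycle al R0,
                 disk R0 `\` range (alpha al) !=set0
               & forall p, (disk R0 `\` range (alpha al)) p ->
                   infinite_winding al p].

(** * The parameter space *)

Definition hfun (x : R) : R := 2 * (x - 1) / x ^+ 3.

Definition R1 a : R := xget 0 [set x | [/\ x != 0, x < 1 & hfun x = a]].
Definition R2 a : R := xget 0 [set x | 1 < x < 3 / 2 /\ hfun x = a].
Definition R3 a : R := xget 0 [set x | 3 / 2 < x /\ hfun x = a].

Definition Cval a r : R :=
  (16 - 8 * r + 6 * a * r ^+ 2 - a ^+ 2 * r ^+ 3) / (4 * (- 2 + a * r)).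

Definition C1 a := Cval a (R1 a ^+ 2).
Definition C2 a := Cval a (R2 a ^+ 2).
Definition C3 a := Cval a (R3 a ^+ 2).

(* Points are the triples (a, C, w). *)
Definition Omega1 : set (R * R * R) :=
  [set x | let: (a, C, w) := x in [/\ C1 a < C, a < 0 & 0 < w]].
Definition Omega2 : set (R * R * R) :=
  [set x | let: (a, C, w) := x in [/\ C2 a < C < C3 a, 0 < a < 8 / 27 & 0 < w]].
Definition Omega3 : set (R * R * R) :=
  [set x | let: (a, C, w) := x in [/\ C < C1 a, 0 < a & 0 < w]].
Definition Omega : set (R * R * R) := (Omega1 `|` Omega3) `\` Omega2.
Definition beta1 : set (R * R * R) :=
  [set x | let: (a, C, w) := x in [/\ C = C1 a, a != 0 & 0 < w]].
Definition beta2 : set (R * R * R) :=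
  [set x | let: (a, C, w) := x in [/\ C = C2 a, 0 < a < 8 / 27 & 0 < w]].
Definition beta3 : set (R * R * R) :=
  [set x | let: (a, C, w) := x in [/\ C = C3 a, 0 < a < 8 / 27 & 0 < w]].
Definition cusp : set (R * R * R) :=
  [set x | let: (a, C, w) := x in [/\ a = 8 / 27, C = - (9 / 8) & 0 < w]].

End surfaces.

Arguments Omega1 {R}.
Arguments Omega2 {R}.
Arguments Omega3 {R}.
Arguments Omega {R}.
Arguments beta1 {R}.
Arguments beta2 {R}.
Arguments beta3 {R}.
Arguments cusp {R}.

(* Main.v *)
Require Import Defs.
From mathcomp Require Import all_boot all_order all_algebra.
From mathcomp Require Import all_classical all_reals all_analysis.
From mathcomp Require Import ring lra.
Import Order.TTheory GRing.Theory Num.Theory numFieldNormedType.Exports.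
Local Open Scope classical_set_scope.
Local Open Scope ring_scope.
Set Implicit Arguments.
Unset Strict Implicit.
Unset Printing Implicit Defensive.

(** Why the theorem holds.

    Let [r = px ^ 2 + py ^ 2] be the squared distance of a profile curve to the
    axis.  On a level set [G = C] the equation [Gfun = C] can be solved for
    [xi2] as a function [rho2] of [r], and the drop equation then gives the
    curvature [pth'] as a function [turn] of [r] ([represents_iff]).  So a drop
    is governed by a planar autonomous system, [r' = 2 xi1] and
    [xi1' = xi1_speed r], whose first integral is [(2 xi1) ^ 2 = rad_speed2 r];
    up to a positive factor [rad_speed2] is the quartic [qdrop].  Everything is
    read off from this one-dimensional motion: [r] is confined to the intervals
    where [qdrop >= 0], simple roots are turning points, double roots are rest
    points reached in infinite time.

    - Between two simple roots the motion is periodic.  It is solved by the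
      substitution [r = m - A cos u], in which the speed [u'] is a smooth
      positive function ([oval_rolling]); the TreadmillSled is then a compact
      oval, a whole component of the level set ([oval_component]), run through
      in finite time.
    - Between a simple root [e] and a multiple root [d] the substitution
      [r = e + (d - e) (tanh u) ^ 2] desingularizes the motion
      ([spiral_rolling]); it tends to [d] at both ends, so that the profile
      curve spirals towards a circle ([asymptotic_exceptional]).
    - A multiple root is a rest point: [r] is constant, the profile curve is a
      circle and the surface a cylinder ([circling_drops]).

    Uniqueness is Gronwall's lemma for the system ([represents_unique]): two
    drops whose TreadmillSleds meet have profile curves that differ by a shift
    of the parameter and a rotation, and rotating the profile curve of a
    helicoidal surface amounts to translating the surface along its axis
    ([moved_congruent]).  Conversely congruent drops come equally far from the
    axis ([congruent_rad]), which separates the drops of one level set.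

    The roots of [qdrop] are squares of the solutions of [Gaxis a x = C], where
    [Gaxis a x = 2 x + x ^ 2 - a / 4 * x ^ 4] is the value of [G] at [(0, x)],
    and the critical points of [Gaxis a] are [- R1 a], [- R2 a], [- R3 a], with
    the values [C1 a], [C2 a], [C3 a].  Hence the position of [C] among the
    three critical values decides the configuration of the roots, that is, the
    case of the theorem.

    For the last assertion, over one period of [r] the profile curve is rotated
    about the origin by the angle [angle_variation] up to a multiple of [pi]
    ([oval_rotation]); so the curve closes up when
    [angle_variation / pi] is rational, and Kronecker's theorem gives density
    when it is irrational. *)

(** * Real calculus *)
Section calculus.
Context {R : realType}.
Implicit Types (f g F : R -> R) (x y a b : R).

(** The lemmas [der_*] are the rules of differentiation on explicit
    lambda-abstractions with values in [R], so that the tactic [derive] below can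
    compute a derivative by following the syntax of the function; what remains is
    an identity for [ring] or [field]. *)
Lemma der_eq f x a b : is_derive x 1 f a -> a = b -> is_derive x 1 f b.
Proof. exact: is_derive_eq. Qed.

Lemma der_cst (c : R) x : is_derive x 1 (fun _ : R => c) 0.
Proof. exact: is_derive_cst. Qed.

Lemma der_id x : is_derive x 1 (fun y : R => y) 1.
Proof. exact: is_derive_id. Qed.

Lemma der_add f g x a b : is_derive x 1 f a -> is_derive x 1 g b ->
  is_derive x 1 (fun y => f y + g y) (a + b).
Proof. by move=> df dg; exact: is_deriveD. Qed.

Lemma der_opp f x a : is_derive x 1 f a -> is_derive x 1 (fun y => - f y) (- a).
Proof. by move=> df; exact: is_deriveN. Qed.

Lemma der_mul f g x a b : is_derive x 1 f a -> is_derive x 1 g b ->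
  is_derive x 1 (fun y => f y * g y) (a * g x + f x * b).
Proof.
move=> df dg; rewrite (_ : _ + _ = f x *: b + g x *: a).
  exact: (@is_deriveM R _ f g x 1 a b df dg).
by rewrite /GRing.scale /=; ring.
Qed.

Lemma der_pow f x a n : is_derive x 1 f a ->
  is_derive x 1 (fun y => f y ^+ n) (n%:R * f x ^+ n.-1 * a).
Proof.
move=> df; have -> : (fun y => f y ^+ n) = f ^+ n.
  apply/funext => y; elim: n => [|n IH]; first by rewrite !expr0.
  by rewrite !exprS IH.
exact: (@is_deriveX R _ f n x 1 a df).
Qed.

Lemma der_inv f x a : f x != 0 -> is_derive x 1 f a ->
  is_derive x 1 (fun y => (f y)^-1) (- a / f x ^+ 2).
Proof.
move=> fx df; rewrite (_ : _ / _ = - (f x ^- 2) *: a).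
  exact: (@is_deriveV R f x a 1 fx df).
by rewrite /GRing.scale /= mulNr mulrC mulNr.
Qed.

Lemma der_comp F f x a b : is_derive (f x) 1 F a -> is_derive x 1 f b ->
  is_derive x 1 (fun y => F (f y)) (a * b).
Proof. by move=> dF df; exact: (is_derive1_comp dF df). Qed.

Lemma der_sqrt f x a : 0 < f x -> is_derive x 1 f a ->
  is_derive x 1 (fun y => Num.sqrt (f y)) (a / (2 * Num.sqrt (f x))).
Proof.
move=> fx df; rewrite [a / _]mulrC.
exact: (@der_comp Num.sqrt f x _ a (@is_derive1_sqrt R (f x) fx) df).
Qed.

Lemma der_cos f x a : is_derive x 1 f a ->
  is_derive x 1 (fun y => cos (f y)) (- sin (f x) * a).
Proof. by move=> df; exact: (@der_comp cos f x _ a (@is_derive_cos R (f x)) df). Qed.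

Lemma der_sin f x a : is_derive x 1 f a ->
  is_derive x 1 (fun y => sin (f y)) (cos (f x) * a).
Proof. by move=> df; exact: (@der_comp sin f x _ a (@is_derive_sin R (f x)) df). Qed.

Lemma der_val f x a : is_derive x 1 f a -> derive1 f x = a.
Proof. by move=> df; rewrite derive1E; exact: derive_val. Qed.

Lemma der_uniq f x a b : is_derive x 1 f a -> is_derive x 1 f b -> a = b.
Proof. by move=> /der_val <- /der_val <-. Qed.

Lemma der_near f g x a : (\forall y \near x, f y = g y) ->
  is_derive x 1 f a -> is_derive x 1 g a.
Proof.
move=> fg df; exact: (near_eq_is_derive fg df).
Qed.

Lemma der_continuous f x a : is_derive x 1 f a -> {for x, continuous f}.
Proof.
by move=> df; apply: differentiable_continuous; apply/derivable1_diffP; case: df.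
Qed.

End calculus.

Create HintDb ders.

Ltac der := first
  [ eassumption
  | solve [eauto 2 with ders]
  | notypeclasses refine (der_cst _ _) | notypeclasses refine (der_id _)
  | notypeclasses refine (der_add _ _); [der | der]
  | notypeclasses refine (der_opp _); der
  | notypeclasses refine (der_mul _ _); [der | der]
  | notypeclasses refine (der_pow _ _); der
  | notypeclasses refine (der_inv _ _); [ | der]
  | notypeclasses refine (der_sqrt _ _); [ | der]
  | notypeclasses refine (der_cos _); der
  | notypeclasses refine (der_sin _); der ].

Ltac derive := notypeclasses refine (der_eq _ _); [der | cbv beta].

Section primitives.
Context {R : realType}.
Implicit Types (f g F : R -> R) (x y a b : R).

Lemma mean_value f df x y : x < y -> (forall z, x <= z <= y -> is_derive z 1 f (df z)) ->
  exists2 z, x < z < y & f y - f x = df z * (y - x).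
Proof.
move=> xy Df; have [|z|z zxy ->] := @MVT R f df x y xy.
- by move=> z /itvP zi; apply: Df; rewrite !zi.
- apply: derivable_within_continuous => u /itvP ui.
  by have [] := Df u; rewrite ?ui.
- by exists z => //; rewrite !(itvP zxy).
Qed.

Lemma der_homo f df x y : x <= y ->
  (forall z, x <= z <= y -> is_derive z 1 f (df z)) ->
  (forall z, x < z < y -> 0 <= df z) -> f x <= f y.
Proof.
rewrite le_eqVlt => /orP[/eqP -> //|xy] Df df0.
have [z /df0 z0 e] := mean_value xy Df.
by rewrite -subr_ge0 e mulr_ge0 // subr_ge0 ltW.
Qed.

Lemma der_homo_lt f df x y : x < y ->
  (forall z, x <= z <= y -> is_derive z 1 f (df z)) ->
  (forall z, x < z < y -> 0 < df z) -> f x < f y.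
Proof.
move=> xy Df df0; have [z /df0 z0 e] := mean_value xy Df.
by rewrite -subr_gt0 e mulr_gt0 // subr_gt0.
Qed.

Lemma der_cst_itv f x y : (forall z, x <= z <= y -> is_derive z 1 f 0) ->
  x <= y -> f x = f y.
Proof.
move=> Df; rewrite le_eqVlt => /orP[/eqP -> //|xy].
have [z _ e] := @mean_value f (fun=> 0) x y xy Df.
by apply/esym/eqP; rewrite -subr_eq0 e mul0r.
Qed.

Lemma der_cts f df : (forall x : R, is_derive x 1 f (df x)) -> continuous f.
Proof. by move=> Df x; exact: der_continuous (Df x). Qed.

Lemma cts_within f (A : set R) : continuous f -> {within A, continuous f}.
Proof. exact: continuous_subspaceT. Qed.

Lemma cts_integrable f a b : continuous f ->
  lebesgue_measure.-integrable `[a, b] (EFin \o f).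
Proof.
move=> cf; apply: continuous_compact_integrable; first exact: segment_compact.
exact: cts_within.
Qed.

(** The primitive is glued from the integrals based at [- n], which agree near
    each point once normalized to vanish at [0]. *)
Lemma primitive f : continuous f -> exists F, forall x : R, is_derive x 1 F (f x).
Proof.
move=> cf.
pose I (n : nat) x := (\int[lebesgue_measure]_(t in `[- n%:R, x]) f t)%R.
have dI n x : - n%:R < x -> is_derive x 1 (I n) (f x).
  move=> nx; have [] := @continuous_FTC1_closed R f (- n%:R) x (x + 1) _ _ nx (cf x).
  - by rewrite ltrDl.
  - exact: cts_integrable.
  - by move=> dx e; split => //; rewrite -derive1E.
pose F n x := I n x - I n 0.
have dF n x : - n%:R < x -> is_derive x 1 (F n) (f x).
  by move=> nx; have d := dI n x nx; rewrite /F; derive; rewrite ?oppr0 ?addr0.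
have F0 n : F n 0 = 0 by rewrite /F subrr.
have eF n m x : - n%:R < x -> - m%:R < x -> (0 < n)%N -> (0 < m)%N -> F n x = F m x.
  move=> nx mx n0 m0.
  have n0R : - n%:R < 0 :> R by rewrite oppr_lt0 ltr0n.
  have m0R : - m%:R < 0 :> R by rewrite oppr_lt0 ltr0n.
  have D (z : R) : - n%:R < z -> - m%:R < z -> is_derive z 1 (fun u => F n u - F m u) 0.
    by move=> nz mz; have d1 := dF _ _ nz; have d2 := dF _ _ mz; derive; rewrite subrr.
  apply/eqP; rewrite -subr_eq0; apply/eqP.
  have [x0|x0] := leP 0 x.
    have Dz (z : R) : 0 <= z <= x -> is_derive z 1 (fun u => F n u - F m u) 0.
      by move=> /andP[z0 zx]; apply: D; apply: lt_le_trans z0.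
    by rewrite -(der_cst_itv Dz x0) !F0 subrr.
  have Dz (z : R) : x <= z <= 0 -> is_derive z 1 (fun u => F n u - F m u) 0.
    by move=> /andP[z0 zx]; apply: D; apply: lt_le_trans z0.
  by rewrite (der_cst_itv Dz (ltW x0)) !F0 subrr.
pose N x := (Num.truncn `|x|).+1.
have NP x : `|x| < (N x)%:R by rewrite /N; apply: truncnS_gt.
exists (fun x => F (N x) x) => x.
apply: (@der_near _ (F (N x))); last first.
  by apply: dF; have := NP x; rewrite ltr_norml => /andP[].
have := NP x; rewrite ltr_norml => /andP[xN _].
near=> y; apply: eF => //.
  near: y; exact: lt_nbhsr.
by have := NP y; rewrite ltr_norml => /andP[].
Unshelve. all: by end_near.
Qed.

End primitives.

Section flows.
Context {R : realType}.
Implicit Types (f g F : R -> R) (x y a b : R).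

(** Solves [U' = V U] by quadrature: [S] is a primitive of [1 / V], and the bound
    on [V] makes it onto, so that the solution lives on the whole line. *)
Lemma flow_inverse (V : R -> R) (M : R) : continuous V -> (forall u, 0 < V u <= M) ->
  exists S U : R -> R,
  [/\ forall u : R, is_derive u 1 S (V u)^-1, cancel S U, cancel U S
    & forall s : R, is_derive s 1 U (V (U s))].
Proof.
move=> cV V0.
have [S dS] : exists S, forall u : R, is_derive u 1 S (V u)^-1.
  apply: primitive => u; apply: cvgV; last exact: cV.
  by have /andP[/gt_eqF ->] := V0 u.
have M0 : 0 < M by have /andP[a0] := V0 0; apply: lt_le_trans.
have cS := der_cts dS.
have SM u v : u <= v -> (v - u) / M <= S v - S u.
  move=> uv; rewrite -subr_ge0.
  have /= h := @der_homo _ (fun x => S x - x / M) (fun x => (V x)^-1 - M^-1) u v uv _ _.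
  rewrite [leRHS](_ : _ = (S v - v / M) - (S u - u / M)); last by ring.
  rewrite subr_ge0; apply: h.
    by move=> z _; have dz := dS z; derive; rewrite mulr0 addr0 mul1r.
  move=> z _; have /andP[a0 aM] := V0 z.
  by rewrite subr_ge0 lef_pV2 // posrE.
have Sinc u v : u < v -> S u < S v.
  move=> uv; rewrite -subr_gt0; apply: lt_le_trans (SM _ _ (ltW uv)).
  by rewrite divr_gt0 // subr_gt0.
have Sinj : injective S.
  move=> u v e; apply/eqP; case: ltgtP => // /Sinc; by rewrite e ltxx.
have Ssurj s : exists u, S u = s.
  pose c := M * `|s - S 0|.
  have c0 : 0 <= c by rewrite mulr_ge0 // ltW.
  have h1 : s <= S c.
    have := SM 0 c c0; rewrite subr0 /c mulrAC mulfV ?gt_eqF // mul1r => h.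
    by rewrite -(lerD2r (- S 0)); apply: le_trans h; exact: ler_norm.
  have h2 : S (- c) <= s.
    have := SM (- c) 0; rewrite oppr_le0 => /(_ c0).
    rewrite sub0r opprK /c mulrAC mulfV ?gt_eqF // mul1r => h.
    rewrite -lerN2 -(lerD2l (S 0)); apply: le_trans h.
    by rewrite distrC; exact: ler_norm.
  have [|||u _ <-] := @IVT R S (- c) c s; last by exists u.
  - by apply: (le_trans _ c0); rewrite oppr_le0.
  - exact: cts_within.
  - by rewrite ge_min h2 /= le_max h1 orbT.
pose U s := projT1 (cid (Ssurj s)).
have US : cancel U S by move=> s; rewrite /U; case: cid.
have SU : cancel S U by move=> u; apply: Sinj; rewrite US.
exists S, U; split => // s.
have h1 : {near U s, cancel S U} by apply: filterE => x; rewrite SU.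
have h2 : \forall x \near U s, {for x, continuous S} by apply: filterE => x; exact: cS.
have h3 : (V (U s))^-1 != 0 by rewrite invr_eq0; have /andP[/gt_eqF ->] := V0 (U s).
by have := is_derive_inverse h1 h2 (dS (U s)) h3; rewrite US invrK.
Qed.

Lemma gronwall (E dE : R -> R) (K s0 : R) : (forall s : R, is_derive s 1 E (dE s)) ->
  (forall s : R, 0 <= E s) -> (forall s : R, `|dE s| <= K * E s) -> E s0 = 0 ->
  forall s : R, E s = 0.
Proof.
move=> DE E0 EK Es0 s; apply/eqP; rewrite eq_le E0 andbT.
have dexp (c z : R) : is_derive z 1 (fun x : R => expR (c * x)) (expR (c * z) * c).
  have d : is_derive z 1 (fun x : R => c * x) c by derive; rewrite mul0r mulr1 add0r.
  exact: (@der_comp _ expR (fun x : R => c * x) z _ c (is_derive_expR (c * z)) d).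
have [h|h] := leP s0 s.
  have := @der_homo _ (fun x : R => - (E x * expR (- K * x)))
    (fun x => - (dE x - K * E x) * expR (- K * x)) s0 s h.
  rewrite Es0 mul0r oppr0 oppr_ge0 pmulr_lle0 ?expR_gt0//; apply.
    by move=> z _; have d1 := DE z; have d2 := dexp (- K) z; derive; rewrite /=; ring.
  move=> z _; rewrite mulr_ge0 ?expR_ge0// oppr_ge0 subr_le0.
  by apply: le_trans (EK z); exact: ler_norm.
have := @der_homo _ (fun x : R => E x * expR (K * x))
    (fun x => (dE x + K * E x) * expR (K * x)) s s0 (ltW h).
rewrite Es0 mul0r pmulr_lle0 ?expR_gt0//; apply.
  by move=> z _; have d1 := DE z; have d2 := dexp K z; derive; rewrite /=; ring.
move=> z _; rewrite mulr_ge0 ?expR_ge0//.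
by have := EK z; rewrite ler_norml => /andP[+ _]; rewrite -subr_ge0 opprK addrC.
Qed.

(** The integral combinations of [A] and [B] form a subgroup of the reals; were it
    not dense, it would have a least positive element, of which [A] and [B]
    would both be multiples. *)
Lemma kronecker (A B : R) : 0 < B -> irrational (A / B) ->
  forall b e : R, 0 < e -> exists k l : int, `|k%:~R * A + l%:~R * B - b| < e.
Proof.
move=> B0 irr.
pose H x := exists k l : int, x = k%:~R * A + l%:~R * B.
have HD x y : H x -> H y -> H (x - y).
  move=> [k [l ->]] [k' [l' ->]]; exists (k - k'), (l - l').
  by rewrite !intrD !rmorphN /=; ring.
have HZ x (n : int) : H x -> H (n%:~R * x).
  move=> [k [l ->]]; exists (n * k), (n * l).
  by rewrite !intrM; ring.
have HA : H A by exists 1, 0; rewrite mul1r mul0r addr0.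
have HB : H B by exists 0, 1; rewrite mul1r mul0r add0r.
have small e : 0 < e -> exists2 h, H h & 0 < h < e.
  move=> e0; apply: contrapT => no.
  (* the infimum [m] of the positive elements is attained, and generates the
     group *)
  pose P := [set h | H h /\ 0 < h].
  have lbP : lbound P 0 by move=> h [_ /ltW].
  have infP : has_inf P by split; [exists B|exists 0].
  pose m := inf P.
  have lem h : P h -> m <= h by move=> Ph; apply: ge_inf => //; exists 0.
  have em : e <= m.
    apply: lb_le_inf; first by exists B.
    by move=> h [Hh h0]; rewrite leNgt; apply/negP => he; apply: no; exists h; rewrite ?h0.
  have m0 : 0 < m := lt_le_trans e0 em.
  have Pm : P m.
    have [h Ph] := inf_adherent m0 infP; rewrite -/m => hm.
    have := lem _ Ph; rewrite le_eqVlt => /orP[/eqP -> //|mh].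
    have mh' : 0 < h - m by rewrite subr_gt0.
    have [h' Ph'] := inf_adherent mh' infP; rewrite -/m addrC subrK => h'h.
    have : P (h - h') by split; [apply: HD; [case: Ph|case: Ph']|rewrite subr_gt0].
    move=> /lem; rewrite leNgt => /negP[].
    by rewrite ltrBlDr; apply: lt_le_trans hm _; rewrite lerD2l lem.
  have mult x : H x -> exists n : int, x = n%:~R * m.
    move=> Hx; exists (Num.floor (x / m)).
    have xm : x = x / m * m by rewrite divfK // gt_eqF.
    have f1 : (Num.floor (x / m))%:~R * m <= x by rewrite [leRHS]xm ler_pM2r // floor_le_tmp.
    have f2 : x < ((Num.floor (x / m)) + 1)%:~R * m.
      by rewrite [ltLHS]xm ltr_pM2r //; apply: floorD1_gt.
    apply/eqP; rewrite eq_le f1 andbT leNgt; apply/negP => f3.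
    have : P (x - (Num.floor (x / m))%:~R * m).
      by split; [apply: HD => //; apply: HZ; case: Pm|rewrite subr_gt0].
    move=> /lem; rewrite leNgt => /negP[].
    by rewrite ltrBlDr; move: f2; rewrite intrD mulrDl mul1r addrC.
  have [i ei] := mult _ HA; have [j ej] := mult _ HB.
  apply: irr; rewrite ei ej.
  have j0 : j%:~R != 0 :> R.
    by apply/eqP => j0; move: B0; rewrite ej j0 mul0r ltxx.
  exists (i%:~R / j%:~R) => //.
  by rewrite fmorph_div /= !ratr_int invfM mulrACA mulfV ?mulr1 // gt_eqF.
move=> b e /small[h [k [l hkl]] /andP[h0 he]].
pose n := Num.floor (b / h).
exists (n * k), (n * l).
have bh : b = b / h * h by rewrite divfK // gt_eqF.
have f1 : n%:~R * h <= b by rewrite [leRHS]bh ler_pM2r // floor_le_tmp.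
have f2 : b < (n + 1)%:~R * h by rewrite [ltLHS]bh ltr_pM2r //; apply: floorD1_gt.
rewrite !intrM -!mulrA -mulrDr -hkl distrC ger0_norm ?subr_ge0 //.
by apply: lt_trans he; rewrite ltrBlDr; move: f2; rewrite intrD mulrDl mul1r addrC.
Qed.

End flows.

Section improper.
Context {R : realType}.
Notation mu := (@lebesgue_measure R).
Variables (a b : R) (u v : nat -> R).
Hypothesis uv : forall n, [/\ a < u n, u n < v n & v n < b].
Hypothesis u_dec : {homo u : n m / (n <= m)%N >-> m <= n}.
Hypothesis v_inc : {homo v : n m / (n <= m)%N >-> n <= m}.
Hypothesis u_a : u n @[n --> \oo] --> a.
Hypothesis v_b : v n @[n --> \oo] --> b.
Implicit Types (F f H h : R -> R) (la lb ha hb x : R).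

Let bigcup_uv : \bigcup_n `[u n, v n]%classic = `]a, b[%classic.
Proof.
apply/seteqP; split => x /=.
  move=> [n _ /=]; rewrite !in_itv /= => /andP[h1 h2].
  by have [h3 _ h4] := uv n; rewrite (lt_le_trans h3) //= (le_lt_trans h2).
rewrite in_itv /= => /andP[ax xb].
have : \forall n \near \oo, u n <= x by apply: cvgr_le u_a _ _.
have : \forall n \near \oo, x <= v n by apply: cvgr_ge v_b _ _.
move=> h1 h2; have [n _ hn] := filterI h1 h2.
exists n => //=; rewrite in_itv /=.
by have [/= -> ->] := hn n (leqnn n).
Qed.

Let meas f : (forall x, a < x < b -> {for x, continuous f}) ->
  measurable_fun `]a, b[ f.
Proof.
move=> cf; apply: measurable_realfun.open_continuous_measurable_fun; first exact: itv_open.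
by move=> x; rewrite inE /= in_itv /= => /cf.
Qed.

(** The intervals [[u n, v n]] exhaust [(a, b)], so the fundamental theorem of
    calculus on each of them and monotone convergence give the integral. *)
Lemma improper_FTC2_ge0 F f la lb :
  (forall x : R, a < x < b -> is_derive x 1 F (f x)) ->
  (forall x, a < x < b -> {for x, continuous f}) ->
  (forall x, a < x < b -> 0 <= f x) ->
  F (u n) @[n --> \oo] --> la -> F (v n) @[n --> \oo] --> lb ->
  (\int[mu]_(x in `]a, b[) (f x)%:E)%E = (lb - la)%:E.
Proof.
move=> dF cf f0 Fla Flb.
have sub n x : x \in `[u n, v n] -> a < x < b.
  rewrite in_itv /= => /andP[h1 h2]; have [h3 _ h4] := uv n.
  by rewrite (lt_le_trans h3) //= (le_lt_trans h2).
have e n : (\int[mu]_(x in `[u n, v n]) (f x)%:E)%E = (F (v n) - F (u n))%:E.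
  rewrite EFinB; apply: continuous_FTC2.
  - by have [] := uv n.
  - apply: continuous_in_subspaceT => x; rewrite inE /= => /sub.
    exact: cf.
  - split.
    + by move=> x /subset_itv_oo_cc /sub /dF [].
    + have h : a < u n < b.
        by have [h1 h2 h3] := uv n; rewrite h1 (lt_trans h2).
      by apply: cvg_at_right_filter; exact: (der_continuous (dF _ h)).
    + have h : a < v n < b.
        by have [h1 h2 h3] := uv n; rewrite h3 (lt_trans h1).
      by apply: cvg_at_left_filter; exact: (der_continuous (dF _ h)).
  - by move=> x /subset_itv_oo_cc /sub /dF /der_val.
have lim1 : (\int[mu]_(x in `[u n, v n]) (f x)%:E)%E @[n --> \oo] -->
     (\int[mu]_(x in `]a, b[) (f x)%:E)%E.
  rewrite -bigcup_uv; apply: ge0_nondecreasing_set_cvg_integral.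
  - move=> n m nm; apply/subsetPset => x /=; rewrite !in_itv /= => /andP[h1 h2].
    by rewrite (le_trans (u_dec nm)) //= (le_trans h2) ?v_inc.
  - by move=> n; exact: measurable_itv.
  - move=> n; apply/measurable_realfun.measurable_EFinP; apply: (measurable_funS _ _ (meas cf)).
      exact: measurable_itv.
    by move=> x /= /sub; rewrite in_itv.
  - by move=> n x /= /sub /f0; rewrite lee_fin.
have lim2 : (\int[mu]_(x in `[u n, v n]) (f x)%:E)%E @[n --> \oo] --> (lb - la)%:E.
  under eq_cvg do rewrite e.
  by apply: cvg_EFin; [exact: nearW | exact: cvgB].
exact: (cvg_unique _ lim1 lim2).
Qed.

(** Domination by the derivative [h] of a function with limits at the ends makes
    [f + h] and [h] nonnegative with finite integrals, and [f] is their
    difference. *)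
Lemma improper_FTC2 F f H h la lb ha hb :
  (forall x : R, a < x < b -> is_derive x 1 F (f x)) ->
  (forall x, a < x < b -> {for x, continuous f}) ->
  (forall x : R, a < x < b -> is_derive x 1 H (h x)) ->
  (forall x, a < x < b -> {for x, continuous h}) ->
  (forall x, a < x < b -> `|f x| <= h x) ->
  F (u n) @[n --> \oo] --> la -> F (v n) @[n --> \oo] --> lb ->
  H (u n) @[n --> \oo] --> ha -> H (v n) @[n --> \oo] --> hb ->
  \int[mu]_(x in `[a, b]) f x = lb - la.
Proof.
move=> dF cf dH ch fh Fla Flb Hha Hhb.
have h0 x : a < x < b -> 0 <= h x by move=> /fh; apply: le_trans.
pose k x := f x + h x.
have dK (x : R) : a < x < b -> is_derive x 1 (fun y => F y + H y) (k x).
  by move=> xab; apply: der_add; [exact: dF|exact: dH].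
have ck x : a < x < b -> {for x, continuous k}.
  by move=> xab; apply: cvgD; [exact: cf|exact: ch].
have k0 x : a < x < b -> 0 <= k x.
  by move=> /fh; rewrite ler_norml => /andP[]; rewrite -subr_ge0 opprK.
have e1 := improper_FTC2_ge0 dH ch h0 Hha Hhb.
have e2 : (\int[mu]_(x in `]a, b[) (k x)%:E)%E = (lb + hb - (la + ha))%:E.
  by apply: (improper_FTC2_ge0 dK ck k0); exact: cvgD.
have int (g : R -> R) (c : R) : (forall x, a < x < b -> {for x, continuous g}) ->
   (forall x, a < x < b -> 0 <= g x) ->
   (\int[mu]_(x in `]a, b[) (g x)%:E)%E = c%:E -> mu.-integrable `]a, b[ (EFin \o g).
  move=> cg g0 eg; apply/integrableP; split.
    by apply/measurable_realfun.measurable_EFinP; exact: meas.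
  rewrite [ltLHS](_ : _ = (\int[mu]_(x in `]a, b[) (g x)%:E)%E); first by rewrite eg ltry.
  by apply: eq_integral => x; rewrite inE /= in_itv /= => /g0 ?; rewrite ger0_norm.
have i1 := int _ _ ch h0 e1; have i2 := int _ _ ck k0 e2.
rewrite /Rintegral integral_itv_bndoo; last by apply/measurable_realfun.measurable_EFinP; exact: meas.
rewrite -[LHS]/(\int[mu]_(x in `]a, b[) f x).
transitivity (\int[mu]_(x in `]a, b[) (k x - h x)).
  by apply: eq_Rintegral => x _; rewrite /k addrK.
rewrite RintegralB //; first by rewrite /Rintegral e1 e2 /=; ring.
Qed.

End improper.

(** * Helicoidal drops as orbits of a planar system *)
Section geometry.
Context {R : realType}.
Implicit Types (a C w s t r x : R) (al be : profile R).

Definition rad al s : R := px al s ^+ 2 + py al s ^+ 2.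

Lemma xi_rad al s : xi1 al s ^+ 2 + xi2 al s ^+ 2 = rad al s.
Proof.
rewrite /xi1 /xi2 /rad; have := cos2sin2 (pth al s).
set c := cos _; set d := sin _ => e; ring: e.
Qed.

Lemma rad_ge0 al s : 0 <= rad al s.
Proof. by rewrite addr_ge0 ?sqr_ge0. Qed.

Lemma px_xi al s : px al s = xi1 al s * cos (pth al s) + xi2 al s * sin (pth al s).
Proof.
rewrite /xi1 /xi2; have := cos2sin2 (pth al s).
set c := cos _; set d := sin _ => e; ring: e.
Qed.

Lemma py_xi al s : py al s = xi1 al s * sin (pth al s) - xi2 al s * cos (pth al s).
Proof.
rewrite /xi1 /xi2; have := cos2sin2 (pth al s).
set c := cos _; set d := sin _ => e; ring: e.
Qed.

Lemma der_px al s : is_derive s 1 (px al) (cos (pth al s)).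
Proof. exact: px_arc. Qed.
Lemma der_py al s : is_derive s 1 (py al) (sin (pth al s)).
Proof. exact: py_arc. Qed.
Lemma der_pth al s : is_derive s 1 (pth al) (derive1 (pth al) s).
Proof. by rewrite derive1E; apply: derivableP; exact: pth_derivable. Qed.
Hint Resolve der_px der_py der_pth : ders.

Lemma der_xi1 al s :
  is_derive s 1 (xi1 al) (1 - derive1 (pth al) s * xi2 al s).
Proof.
rewrite /xi1 /xi2; derive.
have := cos2sin2 (pth al s).
set c := cos _; set d := sin _ => e; ring: e.
Qed.

Lemma der_xi2 al s : is_derive s 1 (xi2 al) (derive1 (pth al) s * xi1 al s).
Proof.
rewrite /xi1 /xi2; derive.
set c := cos _; set d := sin _; ring.
Qed.

Lemma der_rad al s : is_derive s 1 (rad al) (2 * xi1 al s).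
Proof. rewrite /rad; derive; rewrite /xi1 /=; ring. Qed.
Hint Resolve der_xi1 der_xi2 der_rad : ders.

Lemma row3P (u v : 'rV[R]_3) : u 0 (inord 0) = v 0 (inord 0) ->
  u 0 (inord 1) = v 0 (inord 1) -> u 0 (inord 2) = v 0 (inord 2) -> u = v.
Proof.
move=> h0 h1 h2; apply/rowP => -[[|[|[|//]]] i].
- by rewrite (_ : Ordinal i = inord 0) //; apply/val_inj; rewrite /= inordK.
- by rewrite (_ : Ordinal i = inord 1) //; apply/val_inj; rewrite /= inordK.
- by rewrite (_ : Ordinal i = inord 2) //; apply/val_inj; rewrite /= inordK.
Qed.

Lemma vec3_0 x y z : @vec3 R x y z 0 (inord 0) = x. Proof. by rewrite mxE inordK. Qed.
Lemma vec3_1 x y z : @vec3 R x y z 0 (inord 1) = y. Proof. by rewrite mxE inordK. Qed.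
Lemma vec3_2 x y z : @vec3 R x y z 0 (inord 2) = z. Proof. by rewrite mxE inordK. Qed.
Definition vec3E := (vec3_0, vec3_1, vec3_2).

Lemma dot3E (u v : 'rV[R]_3) : dot3 u v = u 0 (inord 0) * v 0 (inord 0)
  + u 0 (inord 1) * v 0 (inord 1) + u 0 (inord 2) * v 0 (inord 2).
Proof.
rewrite /dot3 !big_ord_recr big_ord0 /= add0r.
by congr (_ * _ + _ * _ + _ * _); congr (fun_of_matrix _ _ _); apply/val_inj; rewrite /= inordK.
Qed.

Lemma dpar1_vec3 (f g h : R -> R -> R) s t a b c :
  is_derive s 1 (f^~ t) a -> is_derive s 1 (g^~ t) b -> is_derive s 1 (h^~ t) c ->
  dpar1 (fun s t => vec3 (f s t) (g s t) (h s t)) s t = vec3 a b c.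
Proof.
move=> df dg dh; apply: row3P; rewrite mxE vec3E.
- by under eq_fun do rewrite vec3E; exact: der_val df.
- by under eq_fun do rewrite vec3E; exact: der_val dg.
- by under eq_fun do rewrite vec3E; exact: der_val dh.
Qed.

Lemma dpar2_vec3 (f g h : R -> R -> R) s t a b c :
  is_derive t 1 (f s) a -> is_derive t 1 (g s) b -> is_derive t 1 (h s) c ->
  dpar2 (fun s t => vec3 (f s t) (g s t) (h s t)) s t = vec3 a b c.
Proof.
move=> df dg dh; apply: row3P; rewrite mxE vec3E.
- by under eq_fun do rewrite vec3E; exact: der_val df.
- by under eq_fun do rewrite vec3E; exact: der_val dg.
- by under eq_fun do rewrite vec3E; exact: der_val dh.
Qed.

Lemma phi_s w al : dpar1 (phi w al) = fun s t =>
  vec3 (cos (pth al s - w * t)) (sin (pth al s - w * t)) 0.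
Proof.
apply/funext => s; apply/funext => t; apply: dpar1_vec3; derive;
  rewrite ?cosB ?sinB; ring.
Qed.

Lemma phi_t w al : dpar2 (phi w al) = fun s t =>
  vec3 (w * (- px al s * sin (w * t) + py al s * cos (w * t)))
       (- w * (px al s * cos (w * t) + py al s * sin (w * t))) 1.
Proof.
apply/funext => s; apply/funext => t; apply: dpar2_vec3; derive; ring.
Qed.

(** The first fundamental form has determinant [1 + (w xi1) ^ 2], and the three
    coefficients of the second one are read off from the second derivatives; the
    rest is trigonometry in the angle [pth - w t]. *)
Lemma mean_curvatureE w al s t :
  2 * mean_curvature (phi w al) (nu w al) s t =
  (w ^+ 2 * xi2 al s - derive1 (pth al) s * (1 + w ^+ 2 * rad al s))
  / Num.sqrt (1 + w ^+ 2 * xi1 al s ^+ 2) ^+ 3.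
Proof.
rewrite /mean_curvature phi_s phi_t.
set T := derive1 _ _; set D := Num.sqrt _.
have D2 : D ^+ 2 = 1 + w ^+ 2 * xi1 al s ^+ 2.
  by rewrite /D sqr_sqrtr // addr_ge0 // mulr_ge0 ?sqr_ge0.
have D0 : D != 0.
  rewrite /D gt_eqF // sqrtr_gt0 ltr_pwDl //.
  by rewrite mulr_ge0 ?sqr_ge0.
have -> : dpar1 (fun s t : R => vec3 (cos (pth al s - w * t)) (sin (pth al s - w * t)) 0) s t
  = vec3 (- sin (pth al s - w * t) * T) (cos (pth al s - w * t) * T) 0.
  by apply: dpar1_vec3; derive; rewrite /T; ring.
have -> : dpar2 (fun s t : R => vec3 (cos (pth al s - w * t)) (sin (pth al s - w * t)) 0) s t
  = vec3 (sin (pth al s - w * t) * w) (- cos (pth al s - w * t) * w) 0.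
  by apply: dpar2_vec3; derive; ring.
have -> : dpar2 (fun s t : R =>
  vec3 (w * (- px al s * sin (w * t) + py al s * cos (w * t)))
       (- w * (px al s * cos (w * t) + py al s * sin (w * t))) 1) s t
  = vec3 (- w ^+ 2 * (px al s * cos (w * t) + py al s * sin (w * t)))
     (- w ^+ 2 * (- px al s * sin (w * t) + py al s * cos (w * t))) 0.
  by apply: dpar2_vec3; derive; ring.
have -> : nu w al s t = vec3 (D^-1 * sin (pth al s - w * t))
    (- D^-1 * cos (pth al s - w * t)) (- D^-1 * w * xi1 al s).
  rewrite /nu -/D; apply: row3P; rewrite [LHS]mxE !vec3E; ring.
rewrite !dot3E !vec3E.
have := cos2sin2 (pth al s - w * t); have := cos2sin2 (w * t).
have -> : xi2 al s = (px al s * cos (w * t) + py al s * sin (w * t)) * sin (pth al s - w * t)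
    - (- px al s * sin (w * t) + py al s * cos (w * t)) * cos (pth al s - w * t).
  rewrite /xi2 sinB cosB; have := cos2sin2 (w * t).
  set c := cos (w * t); set d := sin (w * t) => e; ring: e.
have : D ^+ 2 = 1 + w ^+ 2 * ((px al s * cos (w * t) + py al s * sin (w * t)) * cos (pth al s - w * t)
    + (- px al s * sin (w * t) + py al s * cos (w * t)) * sin (pth al s - w * t)) ^+ 2.
  rewrite D2 /xi1 sinB cosB; have := cos2sin2 (w * t).
  set c := cos (w * t); set d := sin (w * t) => e; ring: e.
have : rad al s = (px al s * cos (w * t) + py al s * sin (w * t)) ^+ 2
   + (- px al s * sin (w * t) + py al s * cos (w * t)) ^+ 2.
  rewrite /rad; have := cos2sin2 (w * t).
  set c := cos (w * t); set d := sin (w * t) => e; ring: e.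
set X := px al s * _ + _; set Y := - px al s * _ + _.
set c := cos (pth al s - _); set d := sin (pth al s - _).
move=> -> D2' _ e.
(* [E G - F ^ 2 = D ^ 2], and the numerator is [D^-1] times the one announced *)
rewrite [X in 2 * (_ / (2 * X))](_ : _ = D ^+ 2); last first.
  by rewrite D2'; ring: e.
rewrite [X in 2 * (X / _)](_ : _ = D^-1 * (w ^+ 2 * (X * d - Y * c)
   - T * (1 + w ^+ 2 * (X ^+ 2 + Y ^+ 2)))).
  by field.
ring: e.
Qed.

Lemma axis_distE w al s t : axis_dist (phi w al s t) ^+ 2 = rad al s.
Proof.
rewrite /axis_dist sqr_sqrtr ?addr_ge0 ?sqr_ge0 // /phi !vec3E /rad.
have := cos2sin2 (w * t).
set c := cos (w * t); set d := sin (w * t) => e; ring: e.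
Qed.

Lemma axis_dist_sqrt w al s t : axis_dist (phi w al s t) = Num.sqrt (rad al s).
Proof. by rewrite -(axis_distE w al s t) sqrtr_sqr ger0_norm // sqrtr_ge0. Qed.

Lemma W_gt0 w x : 0 < 1 + w ^+ 2 * x ^+ 2.
Proof. by rewrite ltr_pwDl // mulr_ge0 ?sqr_ge0. Qed.

Lemma rotating_dropE a w al : rotating_drop a w al <-> forall s,
  w ^+ 2 * xi2 al s - derive1 (pth al) s * (1 + w ^+ 2 * rad al s) =
  Num.sqrt (1 + w ^+ 2 * xi1 al s ^+ 2) ^+ 3 * (1 - a / 2 * rad al s).
Proof.
split=> h s => [|t]; first have := h s 0; rewrite mean_curvatureE axis_distE.
  by move=> <-; rewrite [RHS]mulrC divfK // expf_neq0 // gt_eqF // sqrtr_gt0 W_gt0.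
by rewrite h [LHS]mulrC mulKf // expf_neq0 // gt_eqF // sqrtr_gt0 W_gt0.
Qed.

(** The derivative of [Gfun] along the TreadmillSled is a multiple of the
    defect in the drop equation. *)
Lemma Gfun_cst a w al : rotating_drop a w al ->
  exists C, represents a C w al.
Proof.
move=> dr; exists (Gfun a w (treadmill al 0)); split => //.
move=> _ [s _ <-]; rewrite /Glevel /=.
apply: (@is_derive_0_is_cst _ (fun s => Gfun a w (treadmill al s))) => {}s.
rewrite /Gfun /=; have W := W_gt0 w (xi1 al s).
derive; rewrite ?gt_eqF ?sqrtr_gt0 //.
have := (rotating_dropE a w al).1 dr s; rewrite -xi_rad.
have : Num.sqrt (1 + w ^+ 2 * xi1 al s ^+ 2) ^+ 2 = 1 + w ^+ 2 * xi1 al s ^+ 2.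
  by rewrite sqr_sqrtr // ltW.
have : Num.sqrt (1 + w ^+ 2 * xi1 al s ^+ 2) != 0 by rewrite gt_eqF ?sqrtr_gt0.
set D := Num.sqrt _; set T := derive1 _ _.
set X := xi1 al s; set Y := xi2 al s => D0 D2 e.
transitivity (2 * X / D ^+ 3 * (T * D ^+ 2 - w ^+ 2 * Y * (1 - T * Y)
    + D ^+ 3 * (1 - a / 2 * (X ^+ 2 + Y ^+ 2)))).
  by field.
by rewrite -e D2; ring.
Qed.

(** The quadratic [P] of the definition of [rho], and the two square roots that
    occur there.  [rho2 r] is the value of [xi2] on the level set at squared norm
    [r], and [turn r] the value of [pth']. *)
Definition Pquad a C r : R := 4 * C - 4 * r + a * r ^+ 2.
Definition Sq w r : R := Num.sqrt (1 + w ^+ 2 * r).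
Definition Yq a C w r : R := Num.sqrt (64 + w ^+ 2 * Pquad a C r ^+ 2).
Definition rho2 a C w r : R := Pquad a C r * Sq w r / Yq a C w r.
Definition turn a C w r : R :=
  w ^+ 2 * Pquad a C r / (Sq w r * Yq a C w r)
  + 128 * (2 * a * r - 4) * Sq w r / Yq a C w r ^+ 3.
(** The value of [(2 xi1) ^ 2], which is [r' ^ 2], on the level set at squared
    norm [r], and that of [xi1']. *)
Definition rad_speed2 a C w r : R :=
  4 * (64 * r - Pquad a C r ^+ 2) / (64 + w ^+ 2 * Pquad a C r ^+ 2).
Definition xi1_speed a C w r : R :=
  1 - w ^+ 2 * Pquad a C r ^+ 2 / (64 + w ^+ 2 * Pquad a C r ^+ 2)
  - 128 * (2 * a * r - 4) * (1 + w ^+ 2 * r) * Pquad a C r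
    / (64 + w ^+ 2 * Pquad a C r ^+ 2) ^+ 2.

Lemma Y2_gt0 a C w r : 0 < 64 + w ^+ 2 * Pquad a C r ^+ 2.
Proof. by rewrite ltr_pwDl // mulr_ge0 ?sqr_ge0. Qed.

Lemma Yq2 a C w r : Yq a C w r ^+ 2 = 64 + w ^+ 2 * Pquad a C r ^+ 2.
Proof. by rewrite sqr_sqrtr // ltW // Y2_gt0. Qed.

Lemma Yq_gt0 a C w r : 0 < Yq a C w r.
Proof. by rewrite sqrtr_gt0 Y2_gt0. Qed.

Lemma S2_gt0 w r : 0 <= r -> 0 < 1 + w ^+ 2 * r.
Proof. by move=> r0; rewrite ltr_pwDl // mulr_ge0 ?sqr_ge0. Qed.

Lemma Sq2 w r : 0 <= r -> Sq w r ^+ 2 = 1 + w ^+ 2 * r.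
Proof. by move=> r0; rewrite sqr_sqrtr // ltW // S2_gt0. Qed.

Lemma Sq_gt0 w r : 0 <= r -> 0 < Sq w r.
Proof. by move=> r0; rewrite sqrtr_gt0 S2_gt0. Qed.

Lemma rho2_sq a C w r : 0 <= r -> 4 * (r - rho2 a C w r ^+ 2) = rad_speed2 a C w r.
Proof.
move=> r0; rewrite /rho2 /rad_speed2 expr_div_n exprMn Yq2 Sq2 //.
by field; rewrite exprMn gt_eqF // Y2_gt0.
Qed.

Lemma xi1_speed_turn a C w r : 0 <= r -> 1 - turn a C w r * rho2 a C w r = xi1_speed a C w r.
Proof.
move=> r0; rewrite /turn /rho2 /xi1_speed -Yq2 -Sq2 //.
have := Yq_gt0 a C w r; have := Sq_gt0 w r0.
move: (Yq _ _ _ _) (Sq _ _) => Y S /gt_eqF S0 /gt_eqF Y0.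
by field; rewrite S0 Y0.
Qed.

Lemma der_Pquad a C r : is_derive r 1 (Pquad a C) (2 * a * r - 4).
Proof. rewrite /Pquad; derive; ring. Qed.
Hint Resolve der_Pquad : ders.

(** The acceleration of [r]: as [(r') ^ 2 = rad_speed2 r] and [r' = 2 xi1],
    differentiating gives [4 xi1' = rad_speed2' r]. *)
Lemma der_rad_speed2 a C w r : is_derive r 1 (rad_speed2 a C w) (4 * xi1_speed a C w r).
Proof.
have Y := Y2_gt0 a C w r.
rewrite /rad_speed2 /xi1_speed; derive; rewrite ?gt_eqF //.
by field; rewrite exprMn gt_eqF.
Qed.

Lemma der_rho2 a C w r : 0 <= r -> is_derive r 1 (rho2 a C w) (turn a C w r / 2).
Proof.
move=> r0; have Y := Y2_gt0 a C w r; have S := S2_gt0 w r0.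
have Y0 := Yq_gt0 a C w r; have S0 := Sq_gt0 w r0.
rewrite /rho2 /turn /Sq /Yq; derive; rewrite -/(Sq w r) -/(Yq a C w r) ?gt_eqF //.
have := Yq2 a C w r; have := Sq2 w r0.
move: Y0 S0; move: (Yq a C w r) (Sq w r) => y z y0 z0 e1 e2.
transitivity ((2 * a * r - 4) * z * (y ^+ 2 - w ^+ 2 * Pquad a C r ^+ 2) / y ^+ 3
   + w ^+ 2 * Pquad a C r / (2 * z * y)).
  by field; rewrite !gt_eqF.
by rewrite e2; field; rewrite !gt_eqF.
Qed.

(** On the level set [xi1 ^ 2] is a function of [r], and this makes
    [1 + (w xi1) ^ 2] the quotient of [64 * (1 + w ^ 2 * r)] by
    [64 + w ^ 2 * Pquad ^ 2]. *)
Lemma level_sqrt a C w r x : 0 <= r -> x ^+ 2 = r - rho2 a C w r ^+ 2 ->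
  Num.sqrt (1 + w ^+ 2 * x ^+ 2) = 8 * Sq w r / Yq a C w r.
Proof.
move=> r0 e; have y0 := Yq_gt0 a C w r; have z0 := Sq_gt0 w r0.
have pos : 0 <= 8 * Sq w r / Yq a C w r.
  by rewrite divr_ge0 ?ltW // mulr_gt0.
rewrite -[RHS]ger0_norm // -sqrtr_sqr; congr Num.sqrt.
rewrite e /rho2 !expr_div_n !exprMn.
have := Yq2 a C w r; have := Sq2 w r0.
move: y0 z0; move: (Yq a C w r) (Sq w r) => y z y0 z0 e1 e2.
rewrite mulrBr addrA -e1.
transitivity (z ^+ 2 * (y ^+ 2 - w ^+ 2 * Pquad a C r ^+ 2) / y ^+ 2).
  by field; rewrite gt_eqF.
by rewrite e2; ring.
Qed.

Lemma Glevel_iff a C w (p : R * R) :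
  Glevel a C w p <-> p.2 = rho2 a C w (p.1 ^+ 2 + p.2 ^+ 2).
Proof.
case: p => x y; rewrite /Glevel /Gfun /=; set r := x ^+ 2 + y ^+ 2.
have r0 : 0 <= r by rewrite addr_ge0 ?sqr_ge0.
have y0 := Yq_gt0 a C w r; have z0 := Sq_gt0 w r0.
split=> [e|e]; last first.
  rewrite (@level_sqrt a C w r) // -?e; last by rewrite /r addrK.
  rewrite e /rho2 /Pquad; move: y0 z0; move: (Yq _ _ _ _) (Sq _ _) => u v u0 v0.
  by field; rewrite !gt_eqF.
have W := W_gt0 w x; have D2 := sqr_sqrtr (ltW W).
have := W; rewrite -sqrtr_gt0; move: D2 e; set D := Num.sqrt _ => D2 e D0.
have e1 : y = Pquad a C r * D / 8 by rewrite /Pquad -e; field; rewrite gt_eqF.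
have : D * Yq a C w r = 8 * Sq w r.
  apply/eqP; rewrite -(@eqrXn2 _ 2) ?mulr_ge0 ?ltW //; apply/eqP.
  rewrite !exprMn Yq2 (Sq2 w r0) mulrDr mulrCA.
  have -> : D ^+ 2 * Pquad a C r ^+ 2 = 64 * y ^+ 2 by rewrite e1; field.
  by rewrite D2 /r; ring.
rewrite e1 /rho2; move: y0 z0; move: (Yq _ _ _ _) (Sq _ _) => u v u0 v0 e2.
by rewrite (_ : v = D * u / 8); [field; rewrite gt_eqF|rewrite e2; field].
Qed.

(** The drop equation and the level [C] together say that [xi2] and [pth'] are
    given functions of [r]; the level equation is solved for [xi2] by
    [Glevel_iff], and the drop equation for [pth'] with [level_sqrt]. *)
Lemma represents_iff a C w al : represents a C w al <->
  forall s, xi2 al s = rho2 a C w (rad al s) /\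
            derive1 (pth al) s = turn a C w (rad al s).
Proof.
have key s : xi2 al s = rho2 a C w (rad al s) ->
  Num.sqrt (1 + w ^+ 2 * xi1 al s ^+ 2) = 8 * Sq w (rad al s) / Yq a C w (rad al s).
  move=> h; apply: level_sqrt; first exact: rad_ge0.
  by rewrite -h -xi_rad addrK.
split.
  move=> [/rotating_dropE dr lev] s.
  have h : xi2 al s = rho2 a C w (rad al s).
    by have /Glevel_iff /= := lev _ (imageT (treadmill al) s); rewrite xi_rad.
  split => //; have := dr s; rewrite key // h.
  have r0 := rad_ge0 al s.
  have y0 := Yq_gt0 a C w (rad al s); have z0 := Sq_gt0 w r0.
  rewrite /rho2 /turn -Sq2 //; move: y0 z0; set T := derive1 _ _.
  move: (Yq _ _ _ _) (Sq _ _) => y z y0 z0 e.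
  apply: (mulIf (x := z ^+ 2)); first by rewrite expf_neq0 // gt_eqF.
  have -> : T * z ^+ 2 = w ^+ 2 * (Pquad a C (rad al s) * z / y)
      - (8 * z / y) ^+ 3 * (1 - a / 2 * rad al s) by rewrite -e; ring.
  by field; rewrite !gt_eqF.
move=> h; split.
  apply/rotating_dropE => s; have [h1 h2] := h s; rewrite key // h2 h1.
  have r0 := rad_ge0 al s.
  have y0 := Yq_gt0 a C w (rad al s); have z0 := Sq_gt0 w r0.
  rewrite /rho2 /turn -(Sq2 w r0); move: y0 z0.
  move: (Yq _ _ _ _) (Sq _ _) => y z y0 z0.
  by field; rewrite !gt_eqF.
by move=> _ [s _ <-]; apply/Glevel_iff; rewrite /= xi_rad; have [-> _] := h s.
Qed.

End geometry.
#[global] Hint Resolve der_px der_py der_pth der_xi1 der_xi2 der_rad der_Pquad : ders.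

(** * Recovering a profile curve from its TreadmillSled; Lipschitz bounds *)
Section motion.
Context {R : realType}.
Implicit Types (a C w s t r x : R) (al be : profile R).

Lemma turn_continuous a C w r : 0 <= r -> {for r, continuous (turn a C w)}.
Proof.
move=> r0; have Y := Y2_gt0 a C w r; have S := S2_gt0 w r0.
have Y0 := Yq_gt0 a C w r; have S0 := Sq_gt0 w r0.
rewrite /turn /Sq /Yq; eapply der_continuous; der;
  rewrite -/(Sq w r) -/(Yq a C w r) ?mulf_neq0 ?expf_neq0 ?gt_eqF //.
Qed.

(** A solution of the system for [r] and [xi1] determines the curve: [pth] is a
    primitive of [turn r], and [px], [py] are obtained from [xi1], [xi2], [pth]
    by a rotation of angle [pth]. *)
Lemma profile_of_radial a C w (r xi : R -> R) :
  (forall s : R, is_derive s 1 r (2 * xi s)) ->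
  (forall s : R, is_derive s 1 xi (xi1_speed a C w (r s))) ->
  (forall s : R, 0 <= r s) ->
  (forall s : R, xi s ^+ 2 = r s - rho2 a C w (r s) ^+ 2) ->
  exists2 al, represents a C w al &
    forall s, treadmill al s = (xi s, rho2 a C w (r s)).
Proof.
move=> dr dxi r0 xi2.
have ct : continuous (fun s => turn a C w (r s)).
  move=> s; apply: (@continuous_comp _ _ _ r (turn a C w)).
    exact: der_cts dr s.
  exact: turn_continuous.
have [th dth] := primitive ct.
have drho (s : R) : is_derive s 1 (fun s => rho2 a C w (r s)) (turn a C w (r s) * xi s).
  rewrite (_ : _ * _ = turn a C w (r s) / 2 * (2 * xi s)); last by field.
  exact: (@der_comp _ (rho2 a C w) r s _ _ (der_rho2 a C w (r0 s)) (dr s)).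
pose X s := xi s * cos (th s) + rho2 a C w (r s) * sin (th s).
pose Y s := xi s * sin (th s) - rho2 a C w (r s) * cos (th s).
have dX s : is_derive s 1 X (cos (th s)).
  have d1 := dxi s; have d2 := dth s; have d3 := drho s.
  rewrite /X; derive; rewrite -xi1_speed_turn //; ring.
have dY s : is_derive s 1 Y (sin (th s)).
  have d1 := dxi s; have d2 := dth s; have d3 := drho s.
  rewrite /Y; derive; rewrite -xi1_speed_turn //; ring.
have dthd (s : R) : derivable th s 1 by have [] := dth s.
pose al := Profile dX dY dthd.
have e1 s : xi1 al s = xi s.
  rewrite /xi1 /= /X /Y; have := cos2sin2 (th s).
  set c := cos _; set d := sin _ => e; ring: e.
have e2 s : Defs.xi2 al s = rho2 a C w (r s).
  rewrite /Defs.xi2 /= /X /Y; have := cos2sin2 (th s).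
  set c := cos _; set d := sin _ => e; ring: e.
exists al; last by move=> s; rewrite /treadmill e1 e2.
apply/represents_iff => s.
have -> : rad al s = r s by rewrite -xi_rad e1 e2 xi2 subrK.
by split; [exact: e2|exact: der_val (dth s)].
Qed.

(** [Pquad ^ 2] has the leading term [a ^ 2 * r ^ 4], which dominates [64 * r]; so
    all the drops of a level set stay at bounded distance from the axis. *)
Lemma Pquad_bound a C : a != 0 -> exists2 B : R, 0 <= B &
  forall r, 0 <= r -> Pquad a C r ^+ 2 <= 64 * r -> r <= B.
Proof.
move=> a0; have a2 : 0 < a ^+ 2 by rewrite exprn_even_gt0.
pose K := 64 + 32 * `|C| + 16 + 8 * `|a * C| + 8 * `|a|.
have K0 : 0 <= K by rewrite !addr_ge0 // mulr_ge0.
exists (1 + K / a ^+ 2); first by rewrite addr_ge0 // divr_ge0 // ltW.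
move=> r r0 h.
have [r1|r1] := leP r 1; first by rewrite (le_trans r1) // lerDl divr_ge0 // ltW.
rewrite -lerBlDl ler_pdivlMr //.
apply: (@le_trans _ _ (r * a ^+ 2)); first by rewrite ler_pM2r // lerBlDr lerDl.
have r3 : 0 < r ^+ 3 by rewrite exprn_gt0 // (lt_trans _ r1).
rewrite -(ler_pM2l r3).
have p1 : r <= r ^+ 3 by rewrite -{1}(expr1 r) ler_eXn2l.
have p2 : r ^+ 2 <= r ^+ 3 by rewrite ler_eXn2l.
have h' : r ^+ 3 * (r * a ^+ 2) <=
    64 * r + 32 * (C * r) + 8 * (- (a * C) * r ^+ 2) + 8 * (a * r ^+ 3).
  rewrite (_ : r ^+ 3 * _ = Pquad a C r ^+ 2 - 16 * C ^+ 2 - 16 * r ^+ 2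
    + 32 * (C * r) + 8 * (- (a * C) * r ^+ 2) + 8 * (a * r ^+ 3)); last by rewrite /Pquad; ring.
  rewrite !lerD2r (le_trans _ h) // lerBlDr (@le_trans _ _ (Pquad a C r ^+ 2)) ?lerDl ?mulr_ge0 ?sqr_ge0 //.
  by rewrite lerBlDr lerDl mulr_ge0 // sqr_ge0.
apply: (le_trans h').
have b1 : C * r <= `|C| * r ^+ 3.
  by rewrite (le_trans (ler_norm _)) // normrM ler_wpM2l // ger0_norm.
have b2 : - (a * C) * r ^+ 2 <= `|a * C| * r ^+ 3.
  by rewrite (le_trans (ler_norm _)) // normrM normrN ler_wpM2l // ger0_norm ?sqr_ge0.
have b3 : a * r ^+ 3 <= `|a| * r ^+ 3 by rewrite ler_wpM2r ?ler_norm // ltW.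
rewrite (_ : r ^+ 3 * K = 64 * r ^+ 3 + 32 * (`|C| * r ^+ 3) + 16 * r ^+ 3
  + 8 * (`|a * C| * r ^+ 3) + 8 * (`|a| * r ^+ 3)); last by rewrite /K; ring.
move: p1 p2 b1 b2 b3 r3; move: (`|C| * _) (`|a * C| * _) (`|a| * _) => u v z.
move: (C * r) (- (a * C) * r ^+ 2) (a * r ^+ 3) (r ^+ 3) => x1 x2 x3 x4; lra.
Qed.

Lemma rad_Pquad a C w al s : represents a C w al -> Pquad a C (rad al s) ^+ 2 <= 64 * rad al s.
Proof.
move=> /represents_iff /(_ s)[h _].
have : 0 <= rad_speed2 a C w (rad al s).
  by rewrite -rho2_sq ?rad_ge0 // -h -{1}(xi_rad al s) addrK mulr_ge0 // sqr_ge0.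
have Y := Y2_gt0 a C w (rad al s) => q0.
rewrite -subr_ge0 (_ : _ - _ = rad_speed2 a C w (rad al s) *
  (64 + w ^+ 2 * Pquad a C (rad al s) ^+ 2) / 4).
  by rewrite mulr_ge0 // mulr_ge0 // ltW.
by rewrite /rad_speed2; field; rewrite exprMn gt_eqF.
Qed.

Lemma rad_bound a C w al : a != 0 -> represents a C w al ->
  exists2 B : R, 0 <= B & forall s, rad al s <= B.
Proof.
move=> a0 rep; have [B B0 h] := Pquad_bound C a0.
by exists B => // s; apply: h; [exact: rad_ge0|exact: rad_Pquad rep].
Qed.

(** Bounded Lipschitz functions on [[0, B]]: they are closed under products, and
    under the inverse when the values are at least [1], as needed for the
    rational function [xi1_speed]. *)
Definition bounded_lipschitz (B : R) (f : R -> R) := exists2 M : R, 0 <= M & forall x y,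
  0 <= x <= B -> 0 <= y <= B -> `|f x| <= M /\ `|f x - f y| <= M * `|x - y|.

Lemma bounded_lipschitz_cst B c : bounded_lipschitz B (fun=> c).
Proof. by exists `|c| => // x y _ _; split => //; rewrite subrr normr0 mulr_ge0. Qed.

Lemma bounded_lipschitz_id B : bounded_lipschitz B (fun x => x).
Proof.
exists (1 + `|B|); first by rewrite addr_ge0.
move=> x y /andP[x0 xB] _; split; last by rewrite ler_peMl // lerDl.
by rewrite ger0_norm // (le_trans xB) // (le_trans (ler_norm B)) // lerDr.
Qed.

Lemma bounded_lipschitz_add B f g : bounded_lipschitz B f -> bounded_lipschitz B g -> bounded_lipschitz B (fun x => f x + g x).
Proof.
move=> [M M0 hf] [N N0 hg]; exists (M + N); first exact: addr_ge0.
move=> x y xB yB; have [f1 f2] := hf x y xB yB; have [g1 g2] := hg x y xB yB.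
split; first by rewrite (le_trans (ler_normD _ _)) // lerD.
by rewrite opprD addrACA mulrDl (le_trans (ler_normD _ _)) // lerD.
Qed.

Lemma bounded_lipschitz_opp B f : bounded_lipschitz B f -> bounded_lipschitz B (fun x => - f x).
Proof.
move=> [M M0 hf]; exists M => // x y xB yB; have [f1 f2] := hf x y xB yB.
by rewrite normrN -opprD normrN.
Qed.

Lemma bounded_lipschitz_mul B f g : bounded_lipschitz B f -> bounded_lipschitz B g -> bounded_lipschitz B (fun x => f x * g x).
Proof.
move=> [M M0 hf] [N N0 hg]; exists (M * N + M * N); first by rewrite addr_ge0 ?mulr_ge0.
move=> x y xB yB; have [f1 f2] := hf x y xB yB; have [g1 g2] := hg x y xB yB.
have [g3 _] := hg y x yB xB.
split; first by rewrite normrM (@le_trans _ _ (M * N)) ?ler_pM // lerDl mulr_ge0.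
rewrite (_ : _ - _ = f x * (g x - g y) + (f x - f y) * g y); last by ring.
rewrite (le_trans (ler_normD _ _)) // [leRHS]mulrDl lerD // normrM.
  by rewrite -mulrA ler_pM.
by rewrite mulrAC ler_pM.
Qed.

Lemma bounded_lipschitz_inv B f : (forall x, 1 <= f x) -> bounded_lipschitz B f -> bounded_lipschitz B (fun x => (f x)^-1).
Proof.
move=> f1 [M M0 hf]; exists (1 + M); first by rewrite addr_ge0.
have f0 x : 0 < f x by apply: lt_le_trans (f1 x).
have fi x : (f x)^-1 <= 1 by rewrite invf_le1.
move=> x y xB yB; have [_ f2] := hf x y xB yB.
split; first by rewrite ger0_norm ?invr_ge0 ?(ltW (f0 _)) // (le_trans (fi x)) // lerDl.
rewrite (_ : _ - _ = (f y - f x) * ((f x)^-1 * (f y)^-1)); last first.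
  by field; rewrite !gt_eqF.
rewrite normrM distrC ger0_norm ?mulr_ge0 ?invr_ge0 ?(ltW (f0 _)) //.
apply: (@le_trans _ _ (M * `|x - y|)); last by rewrite ler_wpM2r // lerDr.
rewrite -[leRHS]mulr1 ler_pM // ?mulr_ge0 ?invr_ge0 ?(ltW (f0 _)) //.
by rewrite -[leRHS](mulr1 1) ler_pM ?invr_ge0 ?(ltW (f0 _)).
Qed.

Lemma bounded_lipschitz_pow B f n : bounded_lipschitz B f -> bounded_lipschitz B (fun x => f x ^+ n).
Proof.
move=> hf; elim: n => [|n IH]; first exact: bounded_lipschitz_cst.
by under eq_fun do rewrite exprS; exact: bounded_lipschitz_mul.
Qed.

Lemma bounded_lipschitz_xi1_speed B a C w : bounded_lipschitz B (xi1_speed a C w).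
Proof.
have bP : bounded_lipschitz B (Pquad a C).
  rewrite /Pquad; apply: bounded_lipschitz_add; last by apply: bounded_lipschitz_mul; [exact: bounded_lipschitz_cst|exact/bounded_lipschitz_pow/bounded_lipschitz_id].
  apply: bounded_lipschitz_add; first exact: bounded_lipschitz_cst.
  by apply: bounded_lipschitz_opp; apply: bounded_lipschitz_mul; [exact: bounded_lipschitz_cst|exact: bounded_lipschitz_id].
have bw : bounded_lipschitz B (fun r => w ^+ 2 * Pquad a C r ^+ 2).
  by apply: bounded_lipschitz_mul; [exact: bounded_lipschitz_cst|exact: bounded_lipschitz_pow].
have bY : bounded_lipschitz B (fun r => 64 + w ^+ 2 * Pquad a C r ^+ 2).
  by apply: bounded_lipschitz_add => //; exact: bounded_lipschitz_cst.
have Y1 x : 1 <= 64 + w ^+ 2 * Pquad a C x ^+ 2.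
  have : 0 <= w ^+ 2 * Pquad a C x ^+ 2 by rewrite mulr_ge0 ?sqr_ge0.
  by move: (_ * _) => z; lra.
have bl c d : bounded_lipschitz B (fun r => c * r + d).
  by apply: bounded_lipschitz_add; [apply: bounded_lipschitz_mul; [exact: bounded_lipschitz_cst|exact: bounded_lipschitz_id]|exact: bounded_lipschitz_cst].
rewrite /xi1_speed; apply: bounded_lipschitz_add; first apply: bounded_lipschitz_add; first exact: bounded_lipschitz_cst.
  by apply: bounded_lipschitz_opp; apply: bounded_lipschitz_mul => //; exact: bounded_lipschitz_inv.
apply: bounded_lipschitz_opp; apply: bounded_lipschitz_mul; last first.
  apply: bounded_lipschitz_inv; last exact: bounded_lipschitz_pow.
  by move=> x; rewrite exprn_ege1.
apply: bounded_lipschitz_mul => //; apply: bounded_lipschitz_mul; last first.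
  by have := bl (w ^+ 2) 1; under eq_fun do rewrite addrC.
by apply: bounded_lipschitz_mul; [exact: bounded_lipschitz_cst|exact: bl].
Qed.

End motion.

(** * Uniqueness and congruence *)
Section uniqueness.
Context {R : realType}.
Implicit Types (a C w s t r x : R) (al be : profile R).

(** Shift of the parameter by [s0] and rotation by [c].  It is expressed with
    [pth] and the TreadmillSled, which determine the curve. *)
Definition moved al be s0 c : Prop := forall s,
  pth be s = pth al (s + s0) + c /\ treadmill be s = treadmill al (s + s0).

Lemma der_shift (f : R -> R) (s0 s d : R) : is_derive (s + s0) 1 f d ->
  is_derive s 1 (fun s => f (s + s0)) d.
Proof.
move=> df; rewrite -[d]mulr1.
have d1 : is_derive s 1 (fun s : R => s + s0) 1 by derive; rewrite addr0.
exact: (@der_comp _ f (fun s => s + s0) s _ _ df d1).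
Qed.

Lemma represents_xi1 a C w al s : represents a C w al ->
  is_derive s 1 (xi1 al) (xi1_speed a C w (rad al s)).
Proof.
move=> /represents_iff /(_ s)[h1 h2].
rewrite -xi1_speed_turn ?rad_ge0 // -h1 -h2; exact: der_xi1.
Qed.

(** Gronwall's lemma applies to the squared distance of two solutions of the
    system for [r] and [xi1], as [xi1_speed] is Lipschitz on the bounded range of
    [r].  Then [pth] has the same derivative for both. *)
Lemma represents_unique a C w al be s0 : a != 0 ->
  represents a C w al -> represents a C w be ->
  treadmill be 0 = treadmill al s0 -> exists c, moved al be s0 c.
Proof.
move=> a0 ral rbe [e1 e2].
have [B1 _ hB1] := rad_bound a0 ral; have [B2 _ hB2] := rad_bound a0 rbe.
have [L L0 lip] := @bounded_lipschitz_xi1_speed R (Num.max B1 B2) a C w.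
have radB1 s : 0 <= rad al s <= Num.max B1 B2 by rewrite rad_ge0 le_max hB1.
have radB2 s : 0 <= rad be s <= Num.max B1 B2 by rewrite rad_ge0 le_max hB2 orbT.
pose dr s := rad be s - rad al (s + s0); pose dx s := xi1 be s - xi1 al (s + s0).
have ddr s : is_derive s 1 dr (2 * dx s).
  have d1 := der_shift (der_rad al (s + s0)).
  by rewrite /dr; derive; rewrite /dx; ring.
have ddx s : is_derive s 1 dx (xi1_speed a C w (rad be s) - xi1_speed a C w (rad al (s + s0))).
  have d1 := der_shift (represents_xi1 (s + s0) ral).
  have d2 := represents_xi1 s rbe.
  by rewrite /dx; derive.
have E0 : forall s : R, dr s ^+ 2 + dx s ^+ 2 = 0.
  apply: (@gronwall R (fun s => dr s ^+ 2 + dx s ^+ 2) (fun s => 2 * dr s * (2 * dx s) +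
    2 * dx s * (xi1_speed a C w (rad be s) - xi1_speed a C w (rad al (s + s0)))) (2 + L) 0).
  - by move=> s; have d1 := ddr s; have d2 := ddx s; derive; ring.
  - by move=> s; rewrite addr_ge0 ?sqr_ge0.
  - move=> s; have [_] := lip _ _ (radB2 s) (radB1 (s + s0)); rewrite -/(dr s).
    move: (xi1_speed _ _ _ _ - _) => k hk.
    have h1 : 2 * (`|dr s| * `|dx s|) <= dr s ^+ 2 + dx s ^+ 2.
      rewrite -[dr s ^+ 2]real_normK ?num_real // -[dx s ^+ 2]real_normK ?num_real //.
      by rewrite -subr_ge0; have := sqr_ge0 (`|dr s| - `|dx s|); congr (0 <= _); ring.
    rewrite (le_trans (ler_normD _ _)) // !normrM !(@ger0_norm _ 2) // [leRHS]mulrDl lerD //.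
      by move: h1; move: (`|dr s|) (`|dx s|) => u v; lra.
    rewrite (@le_trans _ _ (2 * `|dx s| * (L * `|dr s|))) ?ler_wpM2l ?mulr_ge0 //.
    rewrite (_ : 2 * _ * _ = L * (2 * (`|dr s| * `|dx s|))); last by ring.
    by rewrite ler_wpM2l.
  - rewrite /dr /dx add0r -!xi_rad /xi1 in e1 e2 *.
    rewrite -/(xi1 be 0) -/(xi1 al s0) in e1 *.
    by rewrite e1 e2; ring.
have E1 s : rad be s = rad al (s + s0) /\ xi1 be s = xi1 al (s + s0).
  have /eqP := E0 s; rewrite paddr_eq0 ?sqr_ge0 // !sqrf_eq0 /dr /dx !subr_eq0.
  by move=> /andP[/eqP -> /eqP ->].
have E2 s : treadmill be s = treadmill al (s + s0).
  have [h1 h2] := E1 s; rewrite /treadmill h2.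
  have /represents_iff /(_ s)[-> _] := rbe.
  by have /represents_iff /(_ (s + s0))[-> _] := ral; rewrite h1.
exists (pth be 0 - pth al s0) => s; split; last exact: E2.
have D0 (z : R) : is_derive z 1 (fun s => pth be s - pth al (s + s0)) 0.
  have d1 := der_shift (der_pth al (z + s0)); derive.
  have /represents_iff /(_ z)[_ ->] := rbe.
  have /represents_iff /(_ (z + s0))[_ ->] := ral.
  by have [-> _] := E1 z; rewrite subrr.
have /= := @is_derive_0_is_cst R _ s 0 D0.
by rewrite add0r => <-; ring.
Qed.

Lemma moved_px al be s0 c s : moved al be s0 c ->
  px be s = cos c * px al (s + s0) - sin c * py al (s + s0).
Proof.
move=> /(_ s)[h [h1 h2]]; rewrite !px_xi !py_xi h1 h2 h cosD sinD; ring.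
Qed.

Lemma moved_py al be s0 c s : moved al be s0 c ->
  py be s = sin c * px al (s + s0) + cos c * py al (s + s0).
Proof.
move=> /(_ s)[h [h1 h2]]; rewrite !px_xi !py_xi h1 h2 h cosD sinD; ring.
Qed.

(** Rotating the profile curve by [c] moves the surface by [c / w] along its
    axis. *)
Lemma moved_congruent w al be s0 c : 0 < w -> moved al be s0 c -> congruent w al be.
Proof.
move=> w0 mv; exists 1%:M, (vec3 0 0 (c / w)).
rewrite trmx1 mulmx1 det1; split => //.
have key s t : phi w al (s + s0) t *m 1%:M + vec3 0 0 (c / w) = phi w be s (t + c / w).
  rewrite mulmx1; apply: row3P; rewrite [LHS]mxE /phi !vec3E ?addr0 //;
  rewrite (moved_px s mv) (moved_py s mv) (_ : w * (t + c / w) = w * t + c);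
    rewrite ?cosD ?sinD; try by field; rewrite gt_eqF.
    have := cos2sin2 c; set p := cos c; set q := sin c => e; ring: e.
  have := cos2sin2 c; set p := cos c; set q := sin c => e; ring: e.
apply/seteqP; split => v /=.
  move=> [u [s [t ->]] <-]; exists (s - s0), (t + c / w).
  by rewrite -key subrK.
move=> [s [t ->]]; exists (phi w al (s + s0) (t - c / w)).
  by exists (s + s0), (t - c / w).
by rewrite key subrK.
Qed.

Lemma congruent_sym w al be : congruent w al be -> congruent w be al.
Proof.
move=> [M [v [MM dM e]]]; exists M^T, (- v *m M^T).
have MM' : M^T *m M = 1%:M by rewrite mulmx1C.
rewrite trmxK det_tr; split => //.
apply/seteqP; split => u /=.
  move=> [u' hu' <-]; move: hu'; rewrite -e => -[u'' hu'' <-].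
  by rewrite mulmxDl mulNmx addrK -mulmxA MM mulmx1.
move=> hu; exists (u *m M + v); first by rewrite -e; exists u.
by rewrite mulmxDl mulNmx addrK -mulmxA MM mulmx1.
Qed.

Lemma bounded_multiples (p q B : R) : (forall n : nat, (p + n%:R * q) ^+ 2 <= B) -> q = 0.
Proof.
move=> h; apply/eqP/negPn/negP => q0.
have q0' : 0 < `|q| by rewrite normr_gt0.
pose K := (B + 1 + `|p|) / `|q|.
have [n hn] : exists n : nat, K < n%:R.
  by exists (Num.truncn `|K|).+1; rewrite (le_lt_trans (ler_norm K)) // truncnS_gt.
have := h n; apply/negP; rewrite -ltNge.
have h1 : B + 1 < `|p + n%:R * q|.
  rewrite (@lt_le_trans _ _ (`|n%:R * q| - `|p|)) //.
    by move: hn; rewrite /K ltr_pdivrMr // normrM normr_nat ltrBrDr.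
  by rewrite lerBlDl; have := ler_normB (p + n%:R * q) p; rewrite addrC addKr addrC.
have B0 : 0 <= B by have := h 0%N; apply: le_trans; rewrite sqr_ge0.
rewrite -real_normK ?num_real // expr2.
move: (`|p + n%:R * q|) h1 => z h1; nra.
Qed.

Lemma dot3_mulmx (u v : 'rV[R]_3) : dot3 u v = (u *m v^T) 0 0.
Proof. by rewrite /dot3 mxE; apply: eq_bigr => i _; rewrite mxE. Qed.

(** A rigid motion that carries one surface onto the other preserves the direction
    of the axis, because the image of an orbit of the helicoidal period
    [2 pi / w] has to stay in the cylinder of radius [sqrt B].  Two points of the
    surface at the same parameter [s] and half a period apart are at horizontal
    distance [2 sqrt r]; the horizontal distance of their images is at most the
    sum of the distances of these images to the axis. *)
Lemma congruent_rad w al be (B : R) : 0 < w -> (forall s, rad be s <= B) ->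
  congruent w al be -> forall s, exists s', rad al s <= rad be s'.
Proof.
move=> w0 hB [M [v [MM dM e]]] s.
have img s1 t : exists s' t', phi w al s1 t *m M + v = phi w be s' t'.
  have : surface w be (phi w al s1 t *m M + v).
    by rewrite -e; exists (phi w al s1 t) => //; exists s1, t.
  by [].
have dM3 (u u' : 'rV[R]_3) : dot3 (u *m M) (u' *m M) = dot3 u u'.
  by rewrite !dot3_mulmx trmx_mul mulmxA -(mulmxA u) MM mulmx1.
pose e3 : 'rV[R]_3 := vec3 0 0 1; pose m := e3 *m M.
have per n : phi w al 0 ((2 * pi / w) *+ n) = phi w al 0 0 + ((2 * pi / w) *+ n) *: e3.
  have e0 : w * ((2 * pi / w) *+ n) = 0 + (pi *+ 2) *+ n.
    rewrite add0r mulrnAr; congr (_ *+ n); rewrite mulr2n.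
    by field; rewrite gt_eqF.
  have ec : cos (w * ((2 * pi / w) *+ n)) = 1.
    by rewrite e0 (periodicn (@cosD2pi R)) cos0.
  have es : sin (w * ((2 * pi / w) *+ n)) = 0.
    by rewrite e0 (periodicn (@sinD2pi R)) sin0.
  apply: row3P; rewrite [RHS]mxE [X in _ = _ + X]mxE /phi !vec3E ?ec ?es ?(mulr0 w) ?cos0 ?sin0; ring.
have hor (q : R) (j : 'I_3) : (j == inord 0) || (j == inord 1) ->
    q = m 0 j -> q = 0.
  move=> hj qm; suff : 2 * pi / w * q = 0.
    move/eqP; rewrite mulf_eq0 gt_eqF ?divr_gt0 ?mulr_gt0 ?pi_gt0 //=; by move/eqP.
  have := @bounded_multiples ((phi w al 0 0 *m M + v) 0 j) (2 * pi / w * q) B; apply => n.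
  have [s' [t' e']] := img 0 ((2 * pi / w) *+ n).
  apply: le_trans (hB s'); rewrite -(axis_distE w be s' t') -e' /axis_dist.
  rewrite sqr_sqrtr ?addr_ge0 ?sqr_ge0 // per mulmxDl -scalemxAl -/m.
  have -> : (phi w al 0 0 *m M + v) 0 j + n%:R * (2 * pi / w * q)
     = (phi w al 0 0 *m M + (2 * pi / w *+ n) *: m + v) 0 j.
    by rewrite [in RHS]mxE [in RHS]mxE [X in _ + X + _]mxE [in LHS]mxE qm; ring.
  by case/orP: hj => /eqP ->; rewrite ?lerDl ?lerDr sqr_ge0.
have m0 : m 0 (inord 0) = 0 by apply: (hor _ (inord 0)); rewrite ?eqxx.
have m1 : m 0 (inord 1) = 0 by apply: (hor _ (inord 1)); rewrite ?eqxx ?orbT.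
(* so the image [m] of the vertical unit vector is vertical *)
have mm : m 0 (inord 2) ^+ 2 = 1.
  have := dM3 e3 e3; rewrite -/m !dot3E m0 m1 !vec3E => h.
  by rewrite expr2; move: h; rewrite !mulr0 !add0r mul1r.
(* [A] and [A'] are half a helicoidal period apart *)
pose A := phi w al s 0; pose A' := phi w al s (pi / w).
have [s1 [t1 e1]] := img s 0; have [s2 [t2 e2]] := img s (pi / w).
rewrite -/A -/A' in e1 e2.
pose d := (A - A') *m M.
have dE : d = phi w be s1 t1 - phi w be s2 t2.
  by rewrite -e1 -e2 /d mulmxBl opprD addrACA subrr addr0.
have AA : A - A' = vec3 (2 * px al s) (2 * py al s) (- (pi / w)).
  have e0 : w * (pi / w) = pi by field; rewrite gt_eqF.
  apply: row3P; rewrite [LHS]mxE [X in _ + X]mxE /A /A' /phi !vec3E ?e0 ?mulr0 ?cospi ?sinpi ?cos0 ?sin0; ring.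
have d3 : d 0 (inord 2) ^+ 2 = (pi / w) ^+ 2.
  have := dM3 (A - A') e3; rewrite -/m -/d !dot3E m0 m1 AA !vec3E !mulr0 !add0r mulr1 => h.
  by rewrite -[RHS]sqrrN -h exprMn mm mulr1.
have dd : d 0 (inord 0) ^+ 2 + d 0 (inord 1) ^+ 2 = 4 * rad al s.
  have := dM3 (A - A') (A - A'); rewrite -/d AA !dot3E !vec3E -!expr2 d3 sqrrN => h.
  by apply: (addIr ((pi / w) ^+ 2)); rewrite h /rad; ring.
have dle : 4 * rad al s <= 2 * (rad be s1 + rad be s2).
  rewrite -dd -(axis_distE w be s1 t1) -(axis_distE w be s2 t2) /axis_dist !sqr_sqrtr ?addr_ge0 ?sqr_ge0 //.
  rewrite dE; move: (phi w be s1 t1) (phi w be s2 t2) => p q.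
  rewrite !mxE; move: (p _ _) (p _ _) (q _ _) (q _ _) => x y z t.
  have := sqr_ge0 (x + z); have := sqr_ge0 (y + t); lra.
have [h|h] := leP (rad al s) (rad be s1); first by exists s1.
exists s2; lra.
Qed.

End uniqueness.

(** * Explicit motions *)
Section rolling.
Context {R : realType}.
Implicit Types (a C w s t r x : R) (al be : profile R).

(** A change of parameter [r = G u] that solves the system for [r] and [xi1]:
    [G1] is the derivative of [G] and [V] the speed [u'], so that [r' = G1 u * V u]. *)
Definition rolling a C w (G G1 V : R -> R) : Prop :=
  [/\ forall u : R, is_derive u 1 G (G1 u), continuous V
    & exists M, forall u, 0 < V u <= M] /\
  [/\ forall u : R, is_derive u 1 (fun u => G1 u * V u) (2 * xi1_speed a C w (G u) / V u),
      forall u, 0 <= G u & forall u, (G1 u * V u) ^+ 2 = rad_speed2 a C w (G u)].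

(** The profile curves that follow this solution; [U] is the parameter [u] as a
    function of arc length and [S] its inverse. *)
Definition rolls a C w (G G1 V : R -> R) al : Prop := exists S U : R -> R,
  [/\ forall u : R, is_derive u 1 S (V u)^-1, cancel S U, cancel U S,
      forall s : R, is_derive s 1 U (V (U s))
    & forall s, treadmill al s = (G1 (U s) * V (U s) / 2, rho2 a C w (G (U s)))].

(** The speed condition in [rolling] is the equation [xi1' = xi1_speed r] written
    in the parameter [u], so the solution [u = U s] of [U' = V U] yields a
    solution of the system. *)
Lemma rolling_exists a C w G G1 V : rolling a C w G G1 V ->
  exists2 al, represents a C w al & rolls a C w G G1 V al.
Proof.
move=> [[dG cV [M V0]] [dGV G0 GV2]].
have [S [U [dS SU US dU]]] := flow_inverse cV V0.
have [||||al rep e] := @profile_of_radial R a C w (fun s => G (U s))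
   (fun s => G1 (U s) * V (U s) / 2).
- move=> s; rewrite (_ : 2 * _ = G1 (U s) * V (U s)); last by field.
  exact: (@der_comp _ G U s _ _ (dG (U s)) (dU s)).
- move=> s; have Vs : V (U s) != 0 by have /andP[/gt_eqF ->] := V0 (U s).
  rewrite (_ : xi1_speed _ _ _ _ = (2 * xi1_speed a C w (G (U s)) / V (U s)) * V (U s) / 2); last first.
    by field.
  have d1 := @der_comp _ (fun u => G1 u * V u) U s _ _ (dGV (U s)) (dU s).
  by derive; rewrite mulr0 addr0.
- by move=> s; exact: G0.
- move=> s; have := rho2_sq a C w (G0 (U s)); rewrite -GV2 => h.
  by rewrite exprMn -h; field.
- by exists al => //; exists S, U; split.
Qed.

Lemma rad_at a C w G G1 V al s u : rolling a C w G G1 V ->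
  treadmill al s = (G1 u * V u / 2, rho2 a C w (G u)) -> rad al s = G u.
Proof.
move=> [_ [_ G0 GV2]] [h1 h2]; rewrite -xi_rad h1 h2.
have := rho2_sq a C w (G0 u); rewrite -GV2 => h.
by rewrite exprMn -h; field.
Qed.

Lemma rolls_rad a C w G G1 V al : rolling a C w G G1 V -> rolls a C w G G1 V al ->
  exists U : R -> R, forall s, rad al s = G (U s).
Proof.
by move=> ro [S [U [_ _ _ _ e]]]; exists U => s; exact: rad_at ro (e s).
Qed.

Lemma rolls_moved a C w G G1 V al be s0 c :
  rolls a C w G G1 V al -> moved al be s0 c -> rolls a C w G G1 V be.
Proof.
move=> [S [U [dS SU US dU e]]] mv; exists (fun u => S u - s0), (fun s => U (s + s0)).
split.
- by move=> u; have d1 := dS u; derive; rewrite ?oppr0 ?addr0.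
- by move=> u; rewrite subrK.
- by move=> s; rewrite US addrK.
- move=> s; exact: der_shift.
- by move=> s; have [_ ->] := mv s.
Qed.

(** If a drop passes through a point of the TreadmillSled of an explicit motion,
    it is this motion up to a rotation and a shift. *)
Lemma rolls_unique a C w G G1 V al be u0 : a != 0 -> 0 < w ->
  represents a C w al -> rolls a C w G G1 V al -> represents a C w be ->
  treadmill be 0 = (G1 u0 * V u0 / 2, rho2 a C w (G u0)) ->
  congruent w al be /\ rolls a C w G G1 V be.
Proof.
move=> a0 w0 ral ro rbe e0; have ro' := ro.
move: ro' => [S [U [dS SU US dU e]]].
have e1 : treadmill be 0 = treadmill al (S u0) by rewrite e SU.
have [c mv] := represents_unique a0 ral rbe e1.
by split; [exact: moved_congruent mv|exact: rolls_moved mv].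
Qed.

Definition ovalG (r1 r2 u : R) := (r1 + r2) / 2 - (r2 - r1) / 2 * cos u.
Definition ovalG1 (r1 r2 u : R) := (r2 - r1) / 2 * sin u.
Definition ovalV (r1 r2 : R) (K : R -> R) u := Num.sqrt (K (ovalG r1 r2 u)).

Lemma der_ovalG r1 r2 (u : R) : is_derive u 1 (ovalG r1 r2) (ovalG1 r1 r2 u).
Proof. rewrite /ovalG /ovalG1; derive; ring. Qed.

Lemma ovalG_itv r1 r2 u : r1 <= r2 -> r1 <= ovalG r1 r2 u <= r2.
Proof.
move=> r12; rewrite /ovalG; have := cos_le1 u; have := cos_geN1 u.
move: (cos u) => c h1 h2; apply/andP; split; nra.
Qed.

Lemma ovalG_sq r1 r2 u :
  (ovalG r1 r2 u - r1) * (r2 - ovalG r1 r2 u) = ovalG1 r1 r2 u ^+ 2.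
Proof.
rewrite /ovalG /ovalG1; have := cos2sin2 u; move: (cos u) (sin u) => c d e.
by field: e.
Qed.

(** With [r = m - A cos u] one has [(r - r1) (r2 - r) = (A sin u) ^ 2], so the
    square root in [r' = sqrt (rad_speed2 r)] is taken of the positive cofactor
    [K] only, and the turning points are no longer singular. *)
Lemma oval_rolling a C w r1 r2 (K dK : R -> R) : 0 <= r1 < r2 ->
  (forall r : R, is_derive r 1 K (dK r)) ->
  (forall r, rad_speed2 a C w r = (r - r1) * (r2 - r) * K r) ->
  (forall r, r1 <= r <= r2 -> 0 < K r) ->
  rolling a C w (ovalG r1 r2) (ovalG1 r1 r2) (ovalV r1 r2 K).
Proof.
move=> /andP[r10 r12] dK1 QK K0.
have Kg u : 0 < K (ovalG r1 r2 u) by apply: K0; exact: ovalG_itv (ltW r12).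
have dKG u := @der_comp _ K (ovalG r1 r2) u _ _ (dK1 (ovalG r1 r2 u)) (der_ovalG r1 r2 u).
have dV u := der_sqrt (Kg u) (dKG u).
have V0 u : 0 < ovalV r1 r2 K u by rewrite sqrtr_gt0.
have V2 u : ovalV r1 r2 K u ^+ 2 = K (ovalG r1 r2 u) by rewrite sqr_sqrtr // ltW.
have dQ r : 4 * xi1_speed a C w r = ((r2 - r) - (r - r1)) * K r + (r - r1) * (r2 - r) * dK r.
  apply: (der_uniq (der_rad_speed2 a C w r)).
  rewrite (_ : rad_speed2 a C w = fun r => (r - r1) * (r2 - r) * K r); last exact/funext.
  by have d1 := dK1 r; derive; ring.
split; split.
- exact: der_ovalG.
- by apply: der_cts => u; exact: dV.
- have [c _ hc] := @EVT_max R K r1 r2 (ltW r12) (cts_within (der_cts dK1)).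
  exists (Num.sqrt (K c)) => u; rewrite V0 /= ler_sqrt ?Kg //.
    by apply: hc; rewrite in_itv /= ovalG_itv // ltW.
  rewrite ltW // (lt_le_trans (Kg u)) //.
  by apply: hc; rewrite in_itv /= ovalG_itv // ltW.
- move=> u; have d1 := dV u; have d2 : is_derive u 1 (ovalG1 r1 r2) ((r2 - r1) / 2 * cos u).
    by rewrite /ovalG1; derive; ring.
  rewrite (_ : 2 * xi1_speed a C w _ / _ = (4 * xi1_speed a C w (ovalG r1 r2 u)) / (2 * ovalV r1 r2 K u)); last first.
    by field; rewrite gt_eqF.
  rewrite dQ /ovalV; derive; rewrite -/(ovalV r1 r2 K u) -V2 ovalG_sq.
  have := V0 u; move: (ovalV r1 r2 K u) => v v0.
  by rewrite /ovalG /ovalG1; field; rewrite gt_eqF.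
- by move=> u; rewrite (le_trans r10) //; have /andP[] := ovalG_itv u (ltW r12).
- by move=> u; rewrite exprMn V2 -ovalG_sq QK.
Qed.

(** The hyperbolic tangent. *)
Definition th (u : R) : R := 1 - 2 / (expR (2 * u) + 1).

Lemma th_den u : 0 < expR (2 * u) + 1 :> R.
Proof. by rewrite addr_gt0 ?expR_gt0. Qed.

Lemma der_th (u : R) : is_derive u 1 th (1 - th u ^+ 2).
Proof.
have d0 : is_derive u 1 (fun u : R => 2 * u) 2 by derive; rewrite mul0r mulr1 add0r.
have d1 := @der_comp _ expR (fun u : R => 2 * u) u _ _ (is_derive_expR (2 * u)) d0.
have D := th_den u; rewrite /th; derive; rewrite ?gt_eqF //.
by field; rewrite gt_eqF.
Qed.

Lemma th_lt1 u : -1 < th u < 1.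
Proof.
have D := th_den u; have E := @expR_gt0 R (2 * u).
rewrite /th; apply/andP; split; last by rewrite ltrBlDl ltrDr divr_gt0.
rewrite ltrBrDr -ltrBrDl ltr_pdivrMr //; move: E D; move: (expR _) => z; lra.
Qed.

Lemma th_sq u : th u ^+ 2 < 1.
Proof. have := th_lt1 u; move: (th u) => z /andP[]; nra. Qed.

Lemma th_surj y : -1 < y < 1 -> exists u, th u = y.
Proof.
move=> /andP[y1 y2]; exists (ln ((1 + y) / (1 - y)) / 2).
have h1 : 0 < 1 + y by rewrite -ltrBlDl sub0r.
have h2 : 0 < 1 - y by rewrite subr_gt0.
rewrite /th [in expR _]mulrC divfK // lnK ?posrE ?divr_gt0 //.
by field; rewrite gt_eqF //=; apply/eqP => h; lra.
Qed.

Definition spiralG (e d u : R) := e + (d - e) * th u ^+ 2.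
Definition spiralG1 (e d u : R) := 2 * (d - e) * th u * (1 - th u ^+ 2).
Definition spiralV (e d : R) (K : R -> R) u := Num.sqrt ((d - e) * K (spiralG e d u)) / 2.

Lemma der_spiralG e d (u : R) : is_derive u 1 (spiralG e d) (spiralG1 e d u).
Proof. have d1 := der_th u; rewrite /spiralG /spiralG1; derive; ring. Qed.

Lemma spiralG_d e d u : d - spiralG e d u = (d - e) * (1 - th u ^+ 2).
Proof. by rewrite /spiralG; ring. Qed.

(** With [t = tanh u] and [r = e + (d - e) t ^ 2] one has
    [(r - e) (d - r) ^ 2 = (d - e) ((d - e) t (1 - t ^ 2)) ^ 2], while the
    derivative of [r] with respect to [u] is [2 (d - e) t (1 - t ^ 2)]; again
    only a positive cofactor is left under the square root, and [r = d] is
    reached for infinite [u] only. *)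
Lemma spiral_rolling a C w (e d : R) (K dK : R -> R) : 0 <= e -> 0 <= d -> e != d ->
  (forall r : R, is_derive r 1 K (dK r)) ->
  (forall r, rad_speed2 a C w r = (r - e) * (d - r) ^+ 2 * K r) ->
  (forall t, 0 <= t < 1 -> 0 < (d - e) * K (e + (d - e) * t)) ->
  rolling a C w (spiralG e d) (spiralG1 e d) (spiralV e d K).
Proof.
move=> e0 d0 ed dK1 QK K0.
have t0 u : 0 <= th u ^+ 2 < 1 by rewrite sqr_ge0 th_sq.
have Kg u : 0 < (d - e) * K (spiralG e d u) by apply: K0.
have dKG (u : R) : is_derive u 1 (fun u => (d - e) * K (spiralG e d u))
     ((d - e) * (dK (spiralG e d u) * spiralG1 e d u)).
  have d1 := @der_comp _ K (spiralG e d) u _ _ (dK1 (spiralG e d u)) (der_spiralG e d u).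
  by derive; ring.
have dV0 u := @der_sqrt _ (fun u => (d - e) * K (spiralG e d u)) u _ (Kg u) (dKG u).
have dV (u : R) : is_derive u 1 (spiralV e d K)
   ((d - e) * (dK (spiralG e d u) * spiralG1 e d u) / (8 * spiralV e d K u)).
  have d1 := dV0 u; rewrite /spiralV; derive.
  by field; rewrite gt_eqF // sqrtr_gt0.
have V0 u : 0 < spiralV e d K u by rewrite divr_gt0 // sqrtr_gt0.
have V2 u : spiralV e d K u ^+ 2 = (d - e) * K (spiralG e d u) / 4.
  by rewrite expr_div_n sqr_sqrtr ?(ltW (Kg u)) //; congr (_ / _); ring.
have dQ r : 4 * xi1_speed a C w r = ((d - r) ^+ 2 - 2 * (r - e) * (d - r)) * K r
     + (r - e) * (d - r) ^+ 2 * dK r.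
  apply: (der_uniq (der_rad_speed2 a C w r)).
  rewrite (_ : rad_speed2 a C w = fun r => (r - e) * (d - r) ^+ 2 * K r); last exact/funext.
  by have d1 := dK1 r; derive; ring.
split; split.
- exact: der_spiralG.
- by apply: der_cts => u; exact: dV.
- have cK : continuous (fun t : R => (d - e) * K (e + (d - e) * t)).
    apply: (@der_cts _ _ (fun t => (d - e) * (dK (e + (d - e) * t) * (d - e)))) => t; have d2 : is_derive t 1 (fun t : R => e + (d - e) * t) (d - e) by derive; ring.
    have d1 := @der_comp _ K (fun t : R => e + (d - e) * t) t _ _ (dK1 _) d2.
    by derive; ring.
  have [c _ hc] := @EVT_max R _ 0 1 ler01 (cts_within cK).
  exists (Num.sqrt ((d - e) * K (e + (d - e) * c)) / 2) => u.
  have h : (d - e) * K (spiralG e d u) <= (d - e) * K (e + (d - e) * c).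
    by apply: hc; rewrite in_itv /=; have /andP[-> /ltW ->] := t0 u.
  by rewrite V0 /= ler_pM2r ?invr_gt0 // ler_sqrt // (le_trans (ltW (Kg u)) h).
- move=> u; have d1 := dV u; have d3 := der_th u.
  rewrite (_ : 2 * xi1_speed a C w _ / _ = (4 * xi1_speed a C w (spiralG e d u)) / (2 * spiralV e d K u)); last first.
    by field; rewrite gt_eqF.
  have dG1 : is_derive u 1 (spiralG1 e d)
     (2 * (d - e) * (1 - th u ^+ 2) * (1 - 3 * th u ^+ 2)).
    by rewrite /spiralG1; derive; ring.
  rewrite dQ; derive; rewrite spiralG_d.
  have de : d - e != 0 by rewrite subr_eq0 eq_sym.
  have -> : K (spiralG e d u) = 4 * spiralV e d K u ^+ 2 / (d - e) by rewrite V2; field.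
  have := V0 u; move: (spiralV e d K u) => v v0.
  by rewrite /spiralG /spiralG1; field; rewrite gt_eqF // de.
- move=> u; rewrite /spiralG; have /andP[h1 /ltW h2] := t0 u.
  move: (th u ^+ 2) h1 h2 => z h1 h2; nra.
- move=> u; rewrite exprMn V2 QK spiralG_d /spiralG /spiralG1.
  move: (K _) => k; by field.
Qed.

End rolling.

(** * Ovals: TreadmillSleds between two simple roots *)
Section ovals.
Context {R : realType}.
Implicit Types (a C w s t r x : R) (al be : profile R).

Lemma qdropE a C r : (qdrop a C).[r] = 64 * r - Pquad a C r ^+ 2.
Proof. rewrite /qdrop /Pquad !(hornerE, hornerXn, hornerZ) /=. ring. Qed.

Lemma rad_speed2_qdrop a C w r :
  rad_speed2 a C w r = (2 / Yq a C w r) ^+ 2 * (qdrop a C).[r].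
Proof.
rewrite qdropE /rad_speed2 -Yq2; have := Yq_gt0 a C w r; move: (Yq _ _ _ _) => y y0.
by field; rewrite gt_eqF.
Qed.

Lemma rad_speed2_gt0 a C w r : (0 < rad_speed2 a C w r) = (0 < (qdrop a C).[r]).
Proof. by rewrite rad_speed2_qdrop pmulr_rgt0 // exprn_gt0 // divr_gt0 // Yq_gt0. Qed.

Lemma rhoE a C w r : rho a C w r = (Num.sqrt (rad_speed2 a C w r) / 2, rho2 a C w r).
Proof.
rewrite /rho /rho2 /Sq -/(Pquad a C r) (mulrC (_ ^+ 2) (w ^+ 2)) -/(Yq a C w r).
rewrite (mulrC r); congr (_, _).
rewrite rad_speed2_qdrop sqrtrM ?sqr_ge0 // sqrtr_sqr ger0_norm ?divr_ge0 ?(ltW (Yq_gt0 _ _ _ _)) //.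
by have := Yq_gt0 a C w r; move: (Yq _ _ _ _) => y y0; field; rewrite gt_eqF.
Qed.

(** The reflection [u -> - u] exchanges the two halves of the TreadmillSled. *)
Lemma sled_of_rolls a C w (G G1 V : R -> R) (i : interval R) al :
  rolling a C w G G1 V -> rolls a C w G G1 V al ->
  (forall u, G u \in i) -> (forall r, r \in i -> exists u, G u = r) ->
  (forall u, [/\ G (- u) = G u, G1 (- u) = - G1 u & V (- u) = V u]) ->
  sled_param a C w i al.
Proof.
move=> [_ [_ G0 GV2]] [S [U [_ SU US _ e]]] Gi iG ev.
have abs u : Num.sqrt (rad_speed2 a C w (G u)) = `|G1 u * V u| by rewrite -GV2 sqrtr_sqr.
apply/seteqP; split => p /=.
  move=> [s _ <-]; rewrite e; set u := U s.
  have [h|h] := leP 0 (G1 u * V u).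
    by left; exists (G u); [exact: Gi|rewrite rhoE abs ger0_norm].
  right; exists (rho a C w (G u)); first by exists (G u) => //; exact: Gi.
  by rewrite rhoE abs /= ltr0_norm // mulNr opprK.
have hit u : range (treadmill al) (G1 u * V u / 2, rho2 a C w (G u)).
  by exists (S u) => //; rewrite e SU.
have both r : r \in i -> range (treadmill al) (Num.sqrt (rad_speed2 a C w r) / 2, rho2 a C w r) /\
   range (treadmill al) (- (Num.sqrt (rad_speed2 a C w r) / 2), rho2 a C w r).
  move=> /iG[u <-]; rewrite abs; have [h1 h2 h3] := ev u.
  have := hit u; have := hit (- u); rewrite h1 h2 h3 => k1 k2.
  have [h|h] := leP 0 (G1 u * V u).
    by rewrite ger0_norm //; split => //; move: k1; rewrite !mulNr.
  by rewrite ltr0_norm // !mulNr opprK; split => //; move: k1; rewrite !mulNr.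
move=> [[r ri <-]|[q [r ri <-] <-]]; first by rewrite rhoE; have [] := both r ri.
by rewrite rhoE; have [] := both r ri.
Qed.

(** The cofactor [K] is required to be positive on the interval only, as there
    may be further roots outside. *)
Definition simple_interval a C w r1 r2 (K dK : R -> R) : Prop :=
  [/\ 0 <= r1 < r2, forall r : R, is_derive r 1 K (dK r),
      forall r, rad_speed2 a C w r = (r - r1) * (r2 - r) * K r
    & forall r, r1 <= r <= r2 -> 0 < K r].

Section oval.
Variables (a C w r1 r2 : R) (K dK : R -> R).
Hypothesis SI : simple_interval a C w r1 r2 K dK.

Let G := ovalG r1 r2.
Let G1 := ovalG1 r1 r2.
Let V := ovalV r1 r2 K.

Let r12 : r1 < r2. Proof. by have [/andP[]] := SI. Qed.
Let r10 : 0 <= r1. Proof. by have [/andP[]] := SI. Qed.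

Lemma simple_rolling : rolling a C w G G1 V.
Proof. by have [h1 h2 h3 h4] := SI; exact: oval_rolling. Qed.

Lemma ovalG_even (u : R) : [/\ G (- u) = G u, G1 (- u) = - G1 u & V (- u) = V u].
Proof.
have h : G (- u) = G u by rewrite /G /ovalG cosN.
by rewrite /V /ovalV -/G h /G1 /ovalG1 sinN mulrN.
Qed.

Lemma ovalG_surj r : r1 <= r <= r2 -> exists2 u, 0 <= u <= pi & G u = r.
Proof.
move=> /andP[h1 h2]; pose c := ((r1 + r2) / 2 - r) / ((r2 - r1) / 2).
have d0 : 0 < (r2 - r1) / 2 by rewrite divr_gt0 // subr_gt0.
have c1 : -1 <= c <= 1.
  by rewrite /c ler_pdivlMr // ler_pdivrMr //; apply/andP; split; lra.
exists (acos c); first by rewrite acos_ge0 // acos_lepi.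
rewrite /G /ovalG acosK ?in_itv //= /c.
by field; rewrite subr_eq0 gt_eqF.
Qed.

Lemma oval_sled al : rolls a C w G G1 V al -> sled_param a C w `[r1, r2] al.
Proof.
move=> ro; apply: (sled_of_rolls simple_rolling ro); last exact: ovalG_even.
- by move=> u; rewrite in_itv /=; exact: ovalG_itv (ltW r12).
- by move=> r; rewrite in_itv /= => /ovalG_surj[u _ <-]; exists u.
Qed.

Lemma oval_positive r : r1 < r < r2 -> 0 < (qdrop a C).[r].
Proof.
have [_ _ QK K0] := SI => /andP[h1 h2].
by rewrite -(rad_speed2_gt0 a C w) QK mulr_gt0 ?mulr_gt0 ?subr_gt0 // K0 // !ltW.
Qed.

Lemma oval_root_interval : root_interval a C r1 r2.
Proof.
have [h1 _ QK K0] := SI.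
have rt r : rad_speed2 a C w r = 0 -> root (qdrop a C) r.
  move/eqP; rewrite rad_speed2_qdrop mulf_eq0 gt_eqF //.
  by rewrite exprn_gt0 // divr_gt0 // Yq_gt0.
split => //; last exact: oval_positive.
- by apply: rt; rewrite QK subrr !mul0r.
- by apply: rt; rewrite QK subrr mulr0 mul0r.
Qed.

(** The cofactor [K] may change its sign away from the interval; near the ends it
    is still positive, so that there is always a forbidden radius between the
    oval and a point outside it. *)
Lemma oval_gap r : (0 <= r < r1 \/ r2 < r) ->
  exists2 r', (r <= r' < r1 \/ r2 < r' <= r) & rad_speed2 a C w r' < 0.
Proof.
have [_ dK' QK K0] := SI; have cK := der_cts dK'.
have near_pos x : 0 < K x -> \forall y \near x, 0 < K y.
  by move=> kx; have := cK x; move/cvgr_gt; apply.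
move=> [/andP[rr0 rr]|rr].
  have : 0 < K r1 by apply: K0; rewrite lexx ltW.
  move/near_pos => /nbhs_ballP[e /= e0 h].
  pose r' := Num.max r (r1 - e / 2).
  have r'1 : r' < r1 by rewrite /r' gt_max rr ltrBlDr ltrDl divr_gt0.
  exists r'; first by left; rewrite r'1 /r' le_max lexx.
  rewrite QK pmulr_llt0; last first.
    apply: h; rewrite /ball /= ger0_norm ?subr_ge0 ?(ltW r'1) //.
    rewrite ltrBlDr -ltrBlDl (@lt_le_trans _ _ (r1 - e / 2)) //; last by rewrite /r' le_max lexx orbT.
    by rewrite ltrD2l ltrN2 gtr_pMr // invf_lt1 // ltr1n.
  by rewrite nmulr_rlt0 ?subr_lt0 // subr_gt0 (lt_trans r'1).
have : 0 < K r2 by apply: K0; rewrite lexx andbT ltW.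
move/near_pos => /nbhs_ballP[e /= e0 h].
pose r' := Num.min r (r2 + e / 2).
have r'1 : r2 < r' by rewrite /r' lt_min rr ltrDl divr_gt0.
exists r'; first by right; rewrite r'1 /r' ge_min lexx.
rewrite QK pmulr_llt0; last first.
  apply: h; rewrite /ball /= distrC ger0_norm ?subr_ge0 ?(ltW r'1) //.
  rewrite ltrBlDl (@le_lt_trans _ _ (r2 + e / 2)) //; first by rewrite /r' ge_min lexx orbT.
  by rewrite ltrD2l gtr_pMr // invf_lt1 // ltr1n.
by rewrite pmulr_rlt0 ?subr_lt0 // subr_gt0 (lt_trans _ r'1).
Qed.

Lemma treadmill_cts al : continuous (treadmill al).
Proof.
move=> s.
apply: (@cvg_pair _ _ _ (nbhs s) (nbhs (xi1 al s)) (nbhs (xi2 al s))).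
  exact: (der_continuous (der_xi1 al s)).
exact: (der_continuous (der_xi2 al s)).
Qed.

Lemma level_rad_speed2 (p : R * R) : Glevel a C w p -> 0 <= rad_speed2 a C w (p.1 ^+ 2 + p.2 ^+ 2) /\
  `|p.1| = Num.sqrt (rad_speed2 a C w (p.1 ^+ 2 + p.2 ^+ 2)) / 2.
Proof.
move=> /Glevel_iff e; set r := p.1 ^+ 2 + _ in e *.
have r0 : 0 <= r by rewrite addr_ge0 ?sqr_ge0.
have Q : rad_speed2 a C w r = (2 * p.1) ^+ 2.
  by rewrite -rho2_sq // -e /r addrK; ring.
by rewrite Q sqr_ge0 sqrtr_sqr normrM ger0_norm //; split => //; field.
Qed.

(** The image of the component under [p -> |p| ^ 2] is an interval that avoids
    the forbidden radii of [oval_gap], hence is contained in [[r1, r2]]. *)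
Lemma oval_component al : represents a C w al -> rolls a C w G G1 V al ->
  connected_component (Glevel a C w) (treadmill al 0) = range (treadmill al).
Proof.
move=> [_ lev] ro; have sl := oval_sled ro.
have in_range (p : R * R) : Glevel a C w p -> r1 <= p.1 ^+ 2 + p.2 ^+ 2 <= r2 -> range (treadmill al) p.
  move=> lp rp; have [_ hp] := level_rad_speed2 lp.
  rewrite sl; have /Glevel_iff e := lp.
  have [h|h] := leP 0 p.1.
    left; exists (p.1 ^+ 2 + p.2 ^+ 2); first by rewrite /= in_itv.
    by rewrite rhoE -hp -e ger0_norm //; case: (p).
  right; exists (rho a C w (p.1 ^+ 2 + p.2 ^+ 2)).
    by exists (p.1 ^+ 2 + p.2 ^+ 2) => //=; rewrite in_itv.
  by rewrite rhoE -hp -e /= ltr0_norm // opprK; case: (p).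
apply/seteqP; split; last first.
  apply: connected_component_max => //.
  apply: connected_continuous_connected; last exact/continuous_subspaceT/treadmill_cts.
  by apply/connected_intervalP => x y _ _ z _.
move=> p cp; have lp := connected_component_sub cp.
apply: in_range => //.
set A := connected_component _ _ in cp.
pose f (q : R * R) := q.1 ^+ 2 + q.2 ^+ 2.
have cf : continuous f.
  move=> q; apply: cvgD; apply: (@continuous_comp _ _ _ _ (fun x : R => x ^+ 2)).
  - exact: cvg_fst.
  - exact: exprn_continuous.
  - exact: cvg_snd.
  - exact: exprn_continuous.
have /connected_intervalP itv : connected (f @` A).
  apply: connected_continuous_connected; first exact: component_connected.
  exact: continuous_subspaceT.
have [U eU] := rolls_rad simple_rolling ro.
have f0 : r1 <= f (treadmill al 0) <= r2.
  by rewrite /f /= xi_rad eU; exact: ovalG_itv (ltW r12).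
have A0 : (f @` A) (f (treadmill al 0)).
  by exists (treadmill al 0) => //; apply: connected_component_refl; apply: lev.
have Ap : (f @` A) (f p) by exists p.
have no r : (f @` A) r -> ~ rad_speed2 a C w r < 0.
  move=> [q Aq <-]; have [q0 _] := level_rad_speed2 (connected_component_sub Aq).
  by apply/negP; rewrite -leNgt.
have /andP[f01 f02] := f0.
have fp0 : 0 <= f p by rewrite addr_ge0 ?sqr_ge0.
apply/andP; split; rewrite leNgt; apply/negP => h.
  have [|r' hr' Q] := @oval_gap (f p); first by left; rewrite fp0.
  apply: (no r') => //; apply: (itv _ _ Ap A0).
  case: hr' => /andP[k1 k2]; first by rewrite k1 ltW // (lt_le_trans k2).
  by exfalso; have := lt_trans (lt_le_trans k1 k2) h; rewrite ltNge ltW.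
have [|r' hr' Q] := @oval_gap (f p); first by right.
apply: (no r') => //; apply: (itv _ _ A0 Ap).
case: hr' => /andP[k1 k2]; last by rewrite k2 andbT (le_trans f02) // ltW.
by exfalso; have := lt_le_trans h k1; rewrite ltNge ltW // (lt_trans k2).
Qed.

End oval.
End ovals.

Section pieces.
Context {R : realType}.
Implicit Types (w s t r x : R) (al be : profile R).
Variables (a C w r1 r2 : R) (K dK : R -> R).
Hypothesis SI : simple_interval a C w r1 r2 K dK.

Notation G := (ovalG r1 r2).
Notation G1 := (ovalG1 r1 r2).
Notation V := (ovalV r1 r2 K).

Lemma oval_2pi u : [/\ G (u + pi *+ 2) = G u, G1 (u + pi *+ 2) = G1 u
  & V (u + pi *+ 2) = V u].
Proof.
have h : G (u + pi *+ 2) = G u by rewrite /ovalG cosD2pi.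
by rewrite /ovalV h /ovalG1 sinD2pi.
Qed.

Lemma ovalV_gt0 u : 0 < V u.
Proof. by have [[_ _ [M h]] _] := simple_rolling SI; have /andP[] := h u. Qed.

Lemma roll_period (S U : R -> R) : (forall u : R, is_derive u 1 S (V u)^-1) ->
  cancel S U -> cancel U S ->
  let T := S (pi *+ 2) - S 0 in
  [/\ {homo S : x y / x < y}, 0 < T, forall u, S (u + pi *+ 2) = S u + T
    & forall s, U (s + T) = U s + pi *+ 2].
Proof.
move=> dS SU US T.
have Sinc : {homo S : x y / x < y}.
  move=> x y xy; have p z : x < z < y -> 0 < (V z)^-1 by rewrite invr_gt0 ovalV_gt0.
  exact: (@der_homo_lt _ S (fun u => (V u)^-1) x y xy (fun z _ => dS z) p).
have T0 : 0 < T by rewrite subr_gt0; apply: Sinc; rewrite mulrn_wgt0 // pi_gt0.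
have ST u : S (u + pi *+ 2) = S u + T.
  have D (z : R) : is_derive z 1 (fun u => S (u + pi *+ 2) - S u) 0.
    have d1 := dS z; have d2 := der_shift (dS (z + pi *+ 2)).
    by derive; have [_ _ ->] := oval_2pi z; rewrite subrr.
  have /= := @is_derive_0_is_cst R _ u 0 D.
  by rewrite add0r -/T => <-; rewrite [RHS]addrC subrK.
split => // s; rewrite -{1}(US s) -ST SU //.
Qed.

(** One turn of [u], from [0] to [2 pi], runs once through the oval: the radius
    gives [cos u] and the sign of [xi1] then gives [sin u]. *)
Lemma oval_piece_exists al : represents a C w al -> rolls a C w G G1 V al ->
  exists x y : R, set_inj `[x, y[ (treadmill al) /\
    treadmill al @` `[x, y[ = range (treadmill al).
Proof.
move=> rep [S [U [dS SU US dU e]]].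
have [Sinc T0 ST UT] := roll_period dS SU US.
have Uinc x y : (U x < U y) = (x < y).
  have [h|h|h] := ltgtP (U x) (U y); last by rewrite -(US x) -(US y) h ltxx.
    by rewrite -(US x) -(US y) Sinc.
  by apply/esym/negbTE; rewrite -leNgt ltW // -(US x) -(US y) Sinc.
have Ule x y : (U x <= U y) = (x <= y) by rewrite !leNgt Uinc.
have UI x : (S 0 <= x < S (pi *+ 2)) = (0 <= U x < pi *+ 2).
  by rewrite -(Ule _ x) -(Uinc x) !SU.
exists (S 0), (S (pi *+ 2)); split.
- move=> x y; rewrite !inE /= !in_itv /= !UI => /andP[x0 x1] /andP[y0 y1].
  rewrite !e => -[e1 e2].
  suff: U x = U y by move=> h; rewrite -(US x) -(US y) h.
  have eG : G (U x) = G (U y).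
    have := e x; have := e y => -[k1 k2] [k3 k4].
    have [_ [_ G0 GV2]] := simple_rolling SI.
    have r1' := rho2_sq a C w (G0 (U x)); have r2' := rho2_sq a C w (G0 (U y)).
    move: r1' r2'; rewrite -!GV2 -e2 => q1 q2.
    have e1' : G1 (U x) * V (U x) = G1 (U y) * V (U y).
      by apply: (mulIf (x := 2^-1)) => //; rewrite invr_eq0.
    move: q1 q2; rewrite e1' => <- /(mulfI _) h; apply/esym; apply: (addIr (- rho2 a C w (G (U x)) ^+ 2)).
    by apply: h.
  have eV : V (U x) = V (U y) by rewrite /ovalV eG.
  have [/andP[r10 r12] _ _ _] := SI.
  have d0 : (r2 - r1) / 2 != 0 by rewrite mulf_neq0 ?invr_eq0 // subr_eq0 gt_eqF.
  have ec : cos (U x) = cos (U y).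
    by move: eG; rewrite /ovalG => /addrI /oppr_inj /(mulfI d0).
  have es : sin (U x) = sin (U y).
    have : G1 (U x) * V (U x) = G1 (U y) * V (U y).
      by apply: (mulIf (x := 2^-1)) => //; rewrite invr_eq0.
    rewrite eV => /(mulIf (negbT (gt_eqF (ovalV_gt0 (U y))))).
    by rewrite /ovalG1 => /(mulfI d0).
  have c1 : cos ((U x - U y) / 2 *+ 2) = 1.
    rewrite -mulr_natr divfK // cosB ec es -!expr2; exact: cos2Dsin2.
  have s0 : sin ((U x - U y) / 2) = 0.
    move: c1; rewrite cos_mulr2n => h.
    have : sin ((U x - U y) / 2) ^+ 2 = 0 by have := cos2Dsin2 ((U x - U y) / 2); lra.
    by move/eqP; rewrite sqrf_eq0 => /eqP.
  apply/eqP; rewrite -subr_eq0; apply/negPn/negP => ne.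
  have : 0 < `|U x - U y| / 2 < pi.
    rewrite divr_gt0 ?normr_gt0 //= ltr_pdivrMr // mulr_natr ltr_norml.
    by apply/andP; split; lra.
  move/sin_gt0_pi; have [h|h] := leP 0 (U x - U y).
    by rewrite ger0_norm // s0 ltxx.
  by rewrite ltr0_norm // mulNr sinN s0 oppr0 ltxx.
- apply/seteqP; split; first by move=> p [x _ <-]; exists x.
  have sl := oval_sled SI (ex_intro _ S (ex_intro _ U (And5 dS SU US dU e))).
  move=> p; rewrite sl.
  have pi0 := pi_gt0 R.
  have base r : r \in `[r1, r2] -> exists2 u, 0 <= u <= pi &
     (Num.sqrt (rad_speed2 a C w r) / 2 = G1 u * V u / 2 /\ rho2 a C w r = rho2 a C w (G u)).
    rewrite in_itv /= => /(ovalG_surj SI)[u u0 <-]; exists u => //; split => //.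
    have [_ [_ _ GV2]] := simple_rolling SI.
    rewrite -GV2 sqrtr_sqr ger0_norm // mulr_ge0 ?(ltW (ovalV_gt0 u)) //.
    have [/andP[r10 r12] _ _ _] := SI.
    by rewrite /ovalG1 mulr_ge0 ?divr_ge0 ?subr_ge0 ?(ltW r12) // sin_ge0_pi.
  have inI u : 0 <= u < pi *+ 2 -> `[S 0, S (pi *+ 2)[%classic (S u).
    move=> /andP[u0 u1]; rewrite /= in_itv /= Sinc // andbT.
    by move: u0; rewrite [0 <= u]le_eqVlt => /orP[/eqP <-//|/Sinc/ltW].
  case=> [[r ri <-]|[q [r ri <-] <-]]; rewrite rhoE; have [u /andP[u0 u1] [e1 e2]] := base r ri.
    exists (S u); last by rewrite e SU e1 e2.
    by apply: inI; rewrite u0 (le_lt_trans u1) // mulr2n ltrDl.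
  have [u00|u00] := eqVneq u 0.
    exists (S u); last by rewrite e SU /= e1 e2 u00 /ovalG1 sin0 mulr0 !mul0r oppr0.
    by apply: inI; rewrite u0 (le_lt_trans u1) // mulr2n ltrDl.
  exists (S (- u + pi *+ 2)).
    apply: inI; rewrite gtrDr oppr_lt0 lt_def u00 u0 andbT addrC subr_ge0.
    by rewrite (le_trans u1) // mulr2n lerDl ltW.
  rewrite e SU /=; have [-> -> ->] := oval_2pi (- u).
  by have [-> -> ->] := @ovalG_even R r1 r2 K u; rewrite e1 e2 !mulNr.
Qed.

(** The TreadmillSled has the period [T] in arc length, so an interval on which
    it is injective is at most [T] away from each of its points. *)
Lemma oval_piece_finite al I : rolls a C w G G1 V al -> is_interval I ->
  set_inj I (treadmill al) -> (lebesgue_measure I < +oo)%E.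
Proof.
move=> [S [U [dS SU US dU e]]] itvI inj.
have [Sinc T0 ST UT] := roll_period dS SU US.
set T := _ - _ in T0 ST UT.
have per s : treadmill al (s + T) = treadmill al s.
  by rewrite !e UT; have [-> -> ->] := oval_2pi (U s).
have small x y : I x -> I y -> x <= y -> y - x < T.
  move=> Ix Iy xy; rewrite ltNge; apply/negP => h.
  have IT : I (x + T) by apply: (itvI _ _ Ix Iy); rewrite lerDl (ltW T0) /= -lerBrDl.
  have /eqP := inj _ _ (mem_set IT) (mem_set Ix) (per x).
  by rewrite -subr_eq0 addrC addKr gt_eqF.
have [->|/set0P[c Ic]] := eqVneq I set0; first by rewrite measure0 ltry.
have sub : I `<=` `[c - T, c + T]%classic.
  move=> x Ix; rewrite /= in_itv /=; have [h|h] := leP c x.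
    have := small _ _ Ic Ix h; lra.
  have := small _ _ Ix Ic (ltW h); lra.
apply: (@le_lt_trans _ _ (lebesgue_measure `[c - T, c + T]%classic)).
  apply: le_measure => //; rewrite inE.
    exact: measurable_realfun.is_interval_measurable.
  exact: measurable_itv.
by rewrite lebesgue_measure_itv /=; case: ifP => _; rewrite ?ltry // -EFinB ltry.
Qed.

(** Off the axis [xi1 = 0] the two partial derivatives cannot both vanish, by
    inspection of signs.  On that axis a critical point would make [xi1_speed],
    that is, the derivative of [rad_speed2], vanish at a simple root. *)
Lemma oval_regular p : Glevel a C w p -> r1 <= p.1 ^+ 2 + p.2 ^+ 2 <= r2 ->
  derive1 (fun u => Gfun a w (u, p.2)) p.1 != 0 \/
  derive1 (fun u => Gfun a w (p.1, u)) p.2 != 0.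
Proof.
case: p => x y /= lp rp.
have W := W_gt0 w x.
have D0 : 0 < Num.sqrt (1 + w ^+ 2 * x ^+ 2) by rewrite sqrtr_gt0.
set D := Num.sqrt _ in D0; set r := x ^+ 2 + y ^+ 2 in rp.
have -> : derive1 (fun u => Gfun a w (u, y)) x =
   x * (2 - a * r - 2 * y * w ^+ 2 / D ^+ 3).
  apply: der_val; rewrite /Gfun /=; derive; rewrite -/D ?gt_eqF //.
  by rewrite /r; field; rewrite gt_eqF.
have -> : derive1 (fun u => Gfun a w (x, u)) y = 2 / D + y * (2 - a * r).
  apply: der_val; rewrite /Gfun /=; derive; rewrite -/D ?gt_eqF //.
  by rewrite /r; field; rewrite gt_eqF.
have [x0|x0] := eqVneq x 0; last first.
  have [h|h] := eqVneq (2 - a * r - 2 * y * w ^+ 2 / D ^+ 3) 0; last by left; rewrite mulf_neq0.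
  right; move/eqP: h; rewrite subr_eq0 => /eqP ->.
  rewrite gt_eqF // ltr_pwDl ?divr_gt0 //.
  rewrite (_ : _ * _ = 2 * w ^+ 2 * y ^+ 2 / D ^+ 3); last by field; rewrite gt_eqF.
  apply: divr_ge0; first by rewrite mulr_ge0 ?sqr_ge0 // mulr_ge0 ?sqr_ge0.
  exact/exprn_ge0/ltW.
right; apply/negP => /eqP crit.
have D1 : D = 1 by rewrite /D x0 expr0n /= mulr0 addr0 sqrtr1.
have ry : r = y ^+ 2 by rewrite /r x0 expr0n /= add0r.
have PP8 : Pquad a C (y ^+ 2) = 8 * y.
  by move: lp; rewrite /Glevel /Gfun /= -/D -/r D1 ry /Pquad => <-; field.
have QQ0 : rad_speed2 a C w r = 0 by rewrite /rad_speed2 ry PP8; rewrite (_ : 64 * _ - _ = 0) ?mulr0 ?mul0r //; ring.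
have S := S2_gt0 w (sqr_ge0 y).
have kap0 : xi1_speed a C w r = 0.
  have -> : xi1_speed a C w r = (2 + 2 * y - a * y ^+ 3) / (2 * (1 + w ^+ 2 * y ^+ 2)).
    rewrite /xi1_speed ry PP8; field.
    rewrite exprMn !gt_eqF //= (_ : _ + _ = 64 * (1 + w ^+ 2 * y ^+ 2)); last by ring.
    by rewrite mulr_gt0.
  by move: crit; rewrite D1 ry => h; rewrite (_ : 2 + _ - _ = 0) ?mul0r // -h; field.
have [/andP[_ r12] dK1 QK K0] := SI.
have : 4 * xi1_speed a C w r = ((r2 - r) - (r - r1)) * K r + (r - r1) * (r2 - r) * dK r.
  apply: (der_uniq (der_rad_speed2 a C w r)).
  rewrite (_ : rad_speed2 a C w = fun r => (r - r1) * (r2 - r) * K r); last exact/funext.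
  by have d1 := dK1 r; derive; ring.
have Kr := K0 r rp.
move/eqP: (QK r); rewrite QQ0 eq_sym !mulf_eq0 (gt_eqF Kr) orbF !subr_eq0.
rewrite kap0 mulr0; case/orP => /eqP e h.
  have : (r2 - r1) * K r = 0 by rewrite h e subrr !mul0r addr0 subr0.
  by move/eqP; rewrite mulf_eq0 subr_eq0 !gt_eqF.
have : (r2 - r1) * K r = 0 by rewrite -[RHS]oppr0 h e subrr !mulr0 mul0r addr0 sub0r mulNr opprK.
by move/eqP; rewrite mulf_eq0 subr_eq0 !gt_eqF.
Qed.

End pieces.

(** * The polar angle along an oval *)
Section angles.
Context {R : realType}.
Implicit Types (x y c d : R).

Lemma cosDnat x (n : nat) : cos (x + n%:R * (pi *+ 2)) = cos x.
Proof. by rewrite mulr_natl; exact: (periodicn (@cosD2pi R)). Qed.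

Lemma cosDint x (k : int) : cos (x + k%:~R * (pi *+ 2)) = cos x.
Proof.
case: k => n; first exact: cosDnat.
by rewrite -[in RHS](subrK ((n.+1)%:R * (pi *+ 2)) x) cosDnat NegzE rmorphN /= mulNr.
Qed.

Lemma sinDnat x (n : nat) : sin (x + n%:R * (pi *+ 2)) = sin x.
Proof. by rewrite mulr_natl; exact: (periodicn (@sinD2pi R)). Qed.

Lemma sinDint x (k : int) : sin (x + k%:~R * (pi *+ 2)) = sin x.
Proof.
case: k => n; first exact: sinDnat.
by rewrite -[in RHS](subrK ((n.+1)%:R * (pi *+ 2)) x) sinDnat NegzE rmorphN /= mulNr.
Qed.

Lemma pi2_gt0 : 0 < pi *+ 2 :> R.
Proof. by rewrite mulrn_wgt0 // pi_gt0. Qed.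

Lemma mod2pi x : exists k : int, 0 <= x - k%:~R * (pi *+ 2) < pi *+ 2.
Proof.
exists (Num.floor (x / (pi *+ 2))); have P := pi2_gt0.
have e : x = x / (pi *+ 2) * (pi *+ 2) by rewrite divfK // gt_eqF.
have f1 : (Num.floor (x / (pi *+ 2)))%:~R * (pi *+ 2) <= x.
  by rewrite [leRHS]e ler_pM2r // floor_le_tmp.
have f2 : x < ((Num.floor (x / (pi *+ 2))) + 1)%:~R * (pi *+ 2).
  by rewrite [ltLHS]e ltr_pM2r //; apply: floorD1_gt.
by rewrite subr_ge0 f1 /= ltrBlDr; move: f2; rewrite intrD mulrDl mul1r addrC.
Qed.

Lemma same_angle x y : cos x = cos y -> sin x = sin y ->
  exists k : int, x = y + k%:~R * (pi *+ 2).
Proof.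
move=> ec es; have [k /andP[k1 k2]] := mod2pi (x - y); exists k.
set z := x - y - _ in k1 k2.
have c1 : cos z = 1.
  rewrite /z -mulNr -rmorphN cosDint cosB ec es -!expr2; exact: cos2Dsin2.
have s0 : sin (z / 2) = 0.
  have h : cos ((z / 2) *+ 2) = 1 by rewrite -mulr_natr divfK.
  move: h; rewrite cos_mulr2n => h.
  have : sin (z / 2) ^+ 2 = 0 by have := cos2Dsin2 (z / 2); lra.
  by move/eqP; rewrite sqrf_eq0 => /eqP.
have : z = 0.
  apply/eqP/negPn/negP => z0.
  have : 0 < z / 2 < pi.
    rewrite divr_gt0 //=; last by rewrite lt_def z0.
    by rewrite ltr_pdivrMr // mulr_natr.
  by move/sin_gt0_pi; rewrite s0 ltxx.
by rewrite /z => /eqP; rewrite subr_eq0 subr_eq addrC => /eqP.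
Qed.

Lemma unit_angle c d : c ^+ 2 + d ^+ 2 = 1 -> exists b, c = cos b /\ d = sin b.
Proof.
move=> cd.
have c1 : -1 <= c <= 1.
  rewrite -ler_norml -(@ler_pXn2r _ 2) ?nnegrE // expr1n real_normK ?num_real // -cd.
  by rewrite lerDl sqr_ge0.
have e : cos (acos c) = c by rewrite acosK // in_itv.
have : (sin (acos c)) ^+ 2 = d ^+ 2 by have := cos2Dsin2 (acos c); rewrite e; lra.
move/eqP; rewrite eqf_sqr => /orP[/eqP h|/eqP h].
  by exists (acos c).
by exists (- acos c); rewrite cosN sinN e h opprK.
Qed.

Lemma rotate_to (x y X Y : R) : X ^+ 2 + Y ^+ 2 = x ^+ 2 + y ^+ 2 ->
  exists b, X = cos b * x - sin b * y /\ Y = sin b * x + cos b * y.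
Proof.
move=> e; have [r0|r0] := eqVneq (x ^+ 2 + y ^+ 2) 0.
  move: e; rewrite r0 => /eqP; rewrite paddr_eq0 ?sqr_ge0 // !sqrf_eq0 => /andP[/eqP -> /eqP ->].
  move/eqP: r0; rewrite paddr_eq0 ?sqr_ge0 // !sqrf_eq0 => /andP[/eqP -> /eqP ->].
  by exists 0; rewrite !mulr0 subr0 addr0.
have [|b [eb1 eb2]] := @unit_angle ((x * X + y * Y) / (x ^+ 2 + y ^+ 2))
   ((x * Y - y * X) / (x ^+ 2 + y ^+ 2)).
  rewrite !expr_div_n -mulrDl.
  rewrite (_ : (x * X + y * Y) ^+ 2 + _ = (x ^+ 2 + y ^+ 2) * (X ^+ 2 + Y ^+ 2)); last by ring.
  by rewrite e -expr2 mulfV // expf_neq0.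
by exists b; rewrite -eb1 -eb2; split; field.
Qed.

End angles.

Section variation.
Context {R : realType}.
Implicit Types (w s t r x : R) (al be : profile R).
Variables (a C w r1 r2 : R) (K dK : R -> R).
Hypothesis SI : simple_interval a C w r1 r2 K dK.

Notation G := (ovalG r1 r2).
Notation G1 := (ovalG1 r1 r2).
Notation V := (ovalV r1 r2 K).

(** The polar angle moves at the speed [b r = xi2 / r].  The quotient is
    continuous up to the axis: either [0 < r1], or [C = 0] and [rho2] has a
    factor [r]. *)
Lemma polar_speed : exists b db : R -> R, forall r, r1 <= r <= r2 ->
  [/\ is_derive r 1 b (db r), rho2 a C w r = r * b r
    & turn a C w r = 2 * (b r + r * db r)].
Proof.
have [/andP[r10 r12] _ QK _] := SI.
have [C0|C0] := eqVneq C 0.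
  pose b r := (a * r - 4) * Sq w r / Yq a C w r.
  have rb r : rho2 a C w r = r * b r.
    rewrite /rho2 /b; have := Yq_gt0 a C w r; move: (Yq _ _ _ _) (Sq _ _) => y z y0.
    by rewrite /Pquad C0; field; rewrite gt_eqF.
  have dB r : 0 <= r -> exists d, is_derive r 1 b d.
    move=> r0; have Y := Y2_gt0 a C w r; have S := S2_gt0 w r0.
    have Y0 := Yq_gt0 a C w r; have S0 := Sq_gt0 w r0.
    by eexists; rewrite /b /Sq /Yq; der; rewrite -/(Sq w r) -/(Yq a C w r) ?gt_eqF.
  pose db r := derive1 b r.
  have dbE r : 0 <= r -> is_derive r 1 b (db r).
    by move=> /dB[d hd]; rewrite /db (der_val hd).
  exists b, db => r /andP[rr1 _]; have r0 := le_trans r10 rr1.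
  have d1 := dbE r r0; split => //.
  have : turn a C w r / 2 = b r + r * db r.
    apply: (der_uniq (der_rho2 a C w r0)).
    rewrite (_ : rho2 a C w = fun r => r * b r); last exact/funext.
    by derive; ring.
  by move=> <-; field.
have r1p : 0 < r1.
  rewrite lt_def r10 andbT; apply/eqP => r1e; move: (QK r1).
  rewrite subrr !mul0r r1e /rad_speed2 /Pquad => /eqP.
  rewrite !mulr0 subr0 expr0n /= mulr0 addr0 sub0r.
  by rewrite !mulf_eq0 invr_eq0 oppr_eq0 expf_eq0 mulf_eq0 (negbTE C0) /= !gt_eqF //
    ltr_pwDl // mulr_ge0 ?sqr_ge0.
exists (fun r => rho2 a C w r / r), (fun r => (turn a C w r / 2 * r - rho2 a C w r) / r ^+ 2).
move=> r /andP[rr1 _]; have rp := lt_le_trans r1p rr1.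
have d1 := der_rho2 a C w (ltW rp).
split; last by field; rewrite gt_eqF.
  by derive; rewrite ?gt_eqF //; field; rewrite gt_eqF.
by rewrite mulrC divfK // gt_eqF.
Qed.

End variation.

Section rotation.
Context {R : realType}.
Implicit Types (w s t r x : R) (al be : profile R).
Variables (a C w r1 r2 : R) (K dK : R -> R).
Hypothesis SI : simple_interval a C w r1 r2 K dK.

Notation G := (ovalG r1 r2).
Notation G1 := (ovalG1 r1 r2).
Notation V := (ovalV r1 r2 K).

Let r12 : r1 < r2. Proof. by have [/andP[]] := SI. Qed.
Let r10 : 0 <= r1. Proof. by have [/andP[]] := SI. Qed.

Section fixed_speed.
Variables b db : R -> R.
Hypothesis B : forall r, r1 <= r <= r2 ->
  [/\ is_derive r 1 b (db r), rho2 a C w r = r * b r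
    & turn a C w r = 2 * (b r + r * db r)].

(** In complex notation, with [phi] a primitive of the polar speed [b],
    [exp (2 i (pth - phi)) * (1 - 2 r b ^ 2 - 2 i xi1 b)] is constant.  The second
    factor is the square of the position divided by [r] and turned back by
    [2 pth]; so the identity says that [phi] is the polar angle up to
    a constant, in a form that makes sense when the curve meets the origin.
    Doubling the angle removes the jump by [pi] there. *)
Lemma double_phase al (phi : R -> R) : represents a C w al ->
  (forall s, r1 <= rad al s <= r2) ->
  (forall s : R, is_derive s 1 phi (b (rad al s))) ->
  forall s0 s1 : R,
  let eta s := 2 * (pth al s - phi s) in
  let A s := 1 - 2 * rad al s * b (rad al s) ^+ 2 in
  let D s := - 2 * xi1 al s * b (rad al s) in
  cos (eta s0) * A s0 - sin (eta s0) * D s0 = cos (eta s1) * A s1 - sin (eta s1) * D s1 /\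
  sin (eta s0) * A s0 + cos (eta s0) * D s0 = sin (eta s1) * A s1 + cos (eta s1) * D s1.
Proof.
move=> rep ri dphi s0 s1 eta A D.
have key s : [/\ is_derive s 1 eta (2 * (b (rad al s) + 2 * rad al s * db (rad al s))),
   is_derive s 1 A (2 * (b (rad al s) + 2 * rad al s * db (rad al s)) * D s) &
   is_derive s 1 D (- (2 * (b (rad al s) + 2 * rad al s * db (rad al s))) * A s)].
  have [d1 e1 e2] := B (ri s).
  have d2 : is_derive s 1 (fun s => b (rad al s)) (db (rad al s) * (2 * xi1 al s)).
    exact: (@der_comp _ b (rad al) s _ _ d1 (der_rad al s)).
  have d3 := dphi s; have d4 := represents_xi1 s rep.
  have /represents_iff /(_ s)[e3 e4] := rep.
  have xx : xi1 al s ^+ 2 = rad al s - (rad al s * b (rad al s)) ^+ 2.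
    by rewrite -e1 -e3 -xi_rad addrK.
  have d5 := der_pth al s; rewrite e4 in d5.
  split.
  - by rewrite /eta; derive; rewrite e2; ring.
  - by rewrite /A /D; derive; ring.
  - rewrite /A /D; derive; rewrite -xi1_speed_turn ?rad_ge0 // e1 e2.
    move: (b _) (db _) (xi1 _ _) xx => p q x xx; ring: xx.
split.
  apply: (@is_derive_0_is_cst R (fun s => cos (eta s) * A s - sin (eta s) * D s)) => s.
  by have [d1 d2 d3] := key s; derive; ring.
apply: (@is_derive_0_is_cst R (fun s => sin (eta s) * A s + cos (eta s) * D s)) => s.
by have [d1 d2 d3] := key s; derive; ring.
Qed.

Let arc (r : R) := acos (((r1 + r2) / 2 - r) / ((r2 - r1) / 2)).

Let arcG u : 0 <= u <= pi -> arc (G u) = u.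
Proof.
move=> u0; rewrite /arc /ovalG (_ : (_ - _) / _ = cos u).
  by rewrite cosK // in_itv.
by field; rewrite subr_eq0 gt_eqF.
Qed.

Let arc_spec r : r1 < r < r2 -> [/\ 0 < arc r < pi, G (arc r) = r &
  is_derive r 1 arc (V (arc r) / Num.sqrt (rad_speed2 a C w r))].
Proof.
move=> /andP[h1 h2].
have ri : r1 <= r <= r2 by rewrite !ltW.
have [u u0 e] := ovalG_surj SI ri.
have ru : arc r = u by rewrite -e arcG.
have dd : 0 < (r2 - r1) / 2 by rewrite divr_gt0 // subr_gt0.
have ui : 0 < u < pi.
  have /andP[k1 k2] := u0; rewrite !lt_def k1 k2 !andbT; apply/andP; split.
    by apply/eqP => u00; move: h1; rewrite -e u00 /ovalG cos0 mulr1; lra.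
  by apply/eqP => u00; move: h2; rewrite -e -u00 /ovalG cospi mulrN1; lra.
have su := sin_gt0_pi ui.
split => //; rewrite ru //.
have -> : Num.sqrt (rad_speed2 a C w r) = (r2 - r1) / 2 * sin u * V u.
  have [_ [_ _ GV2]] := simple_rolling SI.
  rewrite -e -GV2 sqrtr_sqr ger0_norm // ltW // !mulr_gt0 //.
    by rewrite -(pmulr_lgt0 _ (x := 2^-1)).
  exact: (ovalV_gt0 SI).
have cu : ((r1 + r2) / 2 - r) / ((r2 - r1) / 2) = cos u.
  by rewrite -e /ovalG; field; rewrite subr_eq0 gt_eqF.
have c1 : -1 < cos u < 1.
  have := cos2Dsin2 u; have : 0 < sin u ^+ 2 by rewrite exprn_gt0.
  move: (cos u) (sin u ^+ 2) => x y y0 xy; apply/andP; split; nra.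
have d1 : is_derive r 1 (fun r => ((r1 + r2) / 2 - r) / ((r2 - r1) / 2)) (- ((r2 - r1) / 2)^-1).
  by derive; ring.
have d2 := is_derive1_acos c1; rewrite -cu in d2.
have d3 := @der_comp _ acos (fun r => ((r1 + r2) / 2 - r) / ((r2 - r1) / 2)) r _ _ d2 d1.
rewrite (_ : V u / _ = - (Num.sqrt (1 - (((r1 + r2) / 2 - r) / ((r2 - r1) / 2)) ^+ 2))^-1 * - ((r2 - r1) / 2)^-1) //.
rewrite cu (_ : 1 - _ = sin u ^+ 2); last by rewrite cos2sin2; ring.
rewrite sqrtr_sqr gtr0_norm //.
by field; rewrite subr_eq0 !gt_eqF // (ovalV_gt0 SI).
Qed.

Let eps (n : nat) : R := harmonic n * (pi / 4).

Let eps_bound n : 0 < eps n <= pi / 4.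
Proof.
have p0 := pi_gt0 R.
have h0 : 0 < harmonic n :> R by exact: harmonic_gt0.
have h1 : harmonic n <= 1 :> R by rewrite /harmonic /= invf_le1 // ler1n.
by rewrite /eps mulr_gt0 ?divr_gt0 //= ler_piMl // ltW // divr_gt0.
Qed.

Let eps_homo : {homo eps : n m / (n <= m)%N >-> m <= n}.
Proof.
move=> n m nm; rewrite /eps ler_pM2r ?divr_gt0 ?pi_gt0 //.
by rewrite /harmonic /= lef_pV2 ?posrE // ler_nat ltnS.
Qed.

Let eps_cvg : eps n @[n --> \oo] --> (0 : R).
Proof. by rewrite -[X in _ --> X](mul0r (pi / 4)); apply: cvgMl; exact: cvg_harmonic. Qed.

Let G_inc x y : 0 <= x -> x < y -> y <= pi -> G x < G y.
Proof.
move=> x0 xy yp.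
have p z : x < z < y -> 0 < G1 z.
  move=> /andP[z1 z2]; rewrite /ovalG1 mulr_gt0 ?divr_gt0 ?subr_gt0 //.
  by apply: sin_gt0_pi; rewrite (le_lt_trans x0) //= (lt_le_trans z2).
exact: (@der_homo_lt _ G G1 x y xy (fun z _ => der_ovalG r1 r2 z) p).
Qed.

(** The substitution [r = ovalG u] turns the improper integral [angle_variation]
    into the increment of twice the polar angle over half a turn of [u].  The
    integrand is dominated by a multiple of [1 / sqrt (rad_speed2 r)], which is the
    derivative of the arc length. *)
Lemma angle_variationE (Phi : R -> R) :
  (forall u : R, is_derive u 1 Phi (b (G u) / V u)) ->
  angle_variation a C w r1 r2 = 2 * Phi pi - 2 * Phi 0.
Proof.
move=> dPhi; have p0 := pi_gt0 R.
have [_ [_ _ GV2]] := simple_rolling SI.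
have Vc : continuous (fun u => (V u)^-1).
  have [[_ cV _] _] := simple_rolling SI => u.
  by apply: cvgV; [rewrite gt_eqF // (ovalV_gt0 SI)|exact: cV].
(* [S] is the arc length, used to dominate the integrand *)
have [S dS] := primitive Vc.
have [M M0 bM] : exists2 M, 0 <= M & forall r, r1 <= r <= r2 -> `|b r| <= M.
  have cb : {within `[r1, r2], continuous b}.
    by apply: derivable_within_continuous => r; rewrite in_itv /= => /B[[]].
  have [c1 _ m1] := EVT_max (ltW r12) cb.
  have [c2 _ m2] := EVT_min (ltW r12) cb.
  exists (`|b c1| + `|b c2|); first by rewrite addr_ge0.
  move=> r ri; have h1 := m1 r ri; have h2 := m2 r ri; rewrite ler_norml.
  have k1 := ler_norm (b c1); have k2 := ler_norm (- b c2); rewrite normrN in k2.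
  have := normr_ge0 (b c1); have := normr_ge0 (b c2); lra.
pose F r := 2 * Phi (arc r); pose H r := 2 * M * S (arc r).
pose f r := (4 * C + a * r ^+ 2 - 4 * r) * Num.sqrt (1 + r * w ^+ 2)
     / (r * Num.sqrt (qdrop a C).[r]).
pose h r := 2 * M / Num.sqrt (rad_speed2 a C w r).
have pos r : r1 < r < r2 -> [/\ 0 < r, 0 < (qdrop a C).[r] & 0 < rad_speed2 a C w r].
  move=> /[dup] /andP[k1 k2] ri; rewrite rad_speed2_gt0 (oval_positive SI ri).
  by rewrite (le_lt_trans r10 k1).
have fE r : r1 < r < r2 -> f r = 2 * b r / Num.sqrt (rad_speed2 a C w r).
  move=> ri; have [rp q0 Q0] := pos r ri.
  have rii : r1 <= r <= r2 by have /andP[k1 k2] := ri; rewrite !ltW.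
  have [_ e _] := B rii.
  have -> : b r = rho2 a C w r / r by rewrite e mulrC mulKf // gt_eqF.
  have /(congr1 fst) /= := rhoE a C w r.
  rewrite -/(Pquad a C r) (mulrC (_ ^+ 2) (w ^+ 2)) -/(Yq a C w r) => k.
  have -> : Num.sqrt (rad_speed2 a C w r) = 2 * (Num.sqrt (qdrop a C).[r] / Yq a C w r).
    by rewrite k mulrC divfK.
  have sq0 : 0 < Num.sqrt (qdrop a C).[r] by rewrite sqrtr_gt0.
  rewrite /f /rho2 (mulrC r (w ^+ 2)) -/(Sq w r) /Pquad.
  have := Yq_gt0 a C w r; move: (Yq _ _ _ _) => y y0.
  move: (Num.sqrt (qdrop a C).[r]) sq0 => z z0.
  by field; rewrite !gt_eqF.
rewrite /angle_variation -/f.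
have uvP n : [/\ r1 < G (eps n), G (eps n) < G (pi - eps n) & G (pi - eps n) < r2].
  have /andP[e0 e1] := eps_bound n.
  have e2 : pi / 4 <= pi / 2 :> R by rewrite ler_pM2l // lef_pV2 ?posrE // ler_nat.
  have G0 : G 0 = r1 by rewrite /ovalG cos0; field.
  have Gp : G pi = r2 by rewrite /ovalG cospi; field.
  have g1 : G 0 < G (eps n) by apply: G_inc; lra.
  have g2 : G (eps n) < G (pi - eps n) by apply: G_inc; lra.
  have g3 : G (pi - eps n) < G pi by apply: G_inc; lra.
  by rewrite G0 in g1; rewrite Gp in g3; split.
have arc_u n : arc (G (eps n)) = eps n.
  by apply: arcG; have /andP[e0 e1] := eps_bound n; lra.
have arc_v n : arc (G (pi - eps n)) = pi - eps n.
  by apply: arcG; have /andP[e0 e1] := eps_bound n; lra.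
have cG : continuous G by apply: der_cts => u; exact: der_ovalG.
have lim0 (Q : R -> R) : continuous Q -> Q (eps n) @[n --> \oo] --> Q 0.
  by move=> cQ; exact: (@cvg_comp _ _ _ eps Q _ _ _ eps_cvg (cQ 0)).
have limp (Q : R -> R) : continuous Q -> Q (pi - eps n) @[n --> \oo] --> Q pi.
  move=> cQ; have l : pi - eps n @[n --> \oo] --> (pi : R).
    by rewrite -[X in _ --> X]subr0; apply: cvgB; [exact: cvg_cst|exact: eps_cvg].
  exact: (@cvg_comp _ _ _ (fun n => pi - eps n) Q _ _ _ l (cQ pi)).
apply: (@improper_FTC2 R r1 r2 (fun n => G (eps n)) (fun n => G (pi - eps n))
   uvP _ _ _ _ F f H h _ _ (2 * M * S 0) (2 * M * S pi)).
- move=> n m nm; have := eps_homo nm; rewrite le_eqVlt => /orP[/eqP -> //|k].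
  have /andP[e0 e1] := eps_bound n; have /andP[e0' e1'] := eps_bound m.
  by apply/ltW/G_inc; lra.
- move=> n m nm; have := eps_homo nm; rewrite le_eqVlt => /orP[/eqP -> //|k].
  have /andP[e0 e1] := eps_bound n; have /andP[e0' e1'] := eps_bound m.
  by apply/ltW/G_inc; lra.
- by have := lim0 _ cG; rewrite {2}/ovalG cos0 (_ : _ - _ = r1) //; field.
- by have := limp _ cG; rewrite {2}/ovalG cospi (_ : _ - _ = r2) //; field.
- move=> r ri; have [_ eG da] := arc_spec ri; have [rp q0 Q0] := pos r ri.
  have d1 := @der_comp _ Phi arc r _ _ (dPhi _) da; rewrite /F; derive.
  rewrite fE // eG; have := ovalV_gt0 SI (arc r); move: (V _) => v v0.
  by field; rewrite !gt_eqF // sqrtr_gt0.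
- move=> r ri; have [rp q0 Q0] := pos r ri.
  have ep : 0 < 1 + r * w ^+ 2 by rewrite mulrC S2_gt0 // ltW.
  have dq : is_derive r 1 (fun r => (qdrop a C).[r]) (64 - 2 * Pquad a C r * (2 * a * r - 4)).
    rewrite (_ : (fun r => (qdrop a C).[r]) = fun r => 64 * r - Pquad a C r ^+ 2).
      by derive; ring.
    by apply/funext => z; rewrite qdropE.
  rewrite /f; eapply der_continuous; der; rewrite ?mulf_neq0 ?gt_eqF ?sqrtr_gt0 //.
- move=> r ri; have [_ eG da] := arc_spec ri; have [rp q0 Q0] := pos r ri.
  have d1 := @der_comp _ S arc r _ _ (dS _) da; rewrite /H; derive.
  rewrite /h; have := ovalV_gt0 SI (arc r); move: (V _) => v v0.
  by field; rewrite !gt_eqF // sqrtr_gt0.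
- move=> r ri; have [rp q0 Q0] := pos r ri; have dQ := der_rad_speed2 a C w r.
  by rewrite /h; eapply der_continuous; der; rewrite ?gt_eqF ?sqrtr_gt0.
- move=> r ri; have [rp q0 Q0] := pos r ri; rewrite fE // /h.
  have sq0 : 0 < Num.sqrt (rad_speed2 a C w r) by rewrite sqrtr_gt0.
  rewrite normrM normfV (gtr0_norm sq0) ler_pM2r ?invr_gt0 // normrM ger0_norm //.
  by rewrite ler_pM2l // bM //; have /andP[k1 k2] := ri; rewrite !ltW.
- under eq_cvg do rewrite /F arc_u; apply: cvgMr; apply: lim0; exact: der_cts dPhi.
- under eq_cvg do rewrite /F arc_v; apply: cvgMr; apply: limp; exact: der_cts dPhi.
- under eq_cvg do rewrite /H arc_u; apply: cvgMr; apply: lim0; exact: der_cts dS.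
- under eq_cvg do rewrite /H arc_v; apply: cvgMr; apply: limp; exact: der_cts dS.
Qed.

End fixed_speed.
End rotation.

(** * Closing up and density *)
Section proper_dense.
Context {R : realType}.
Implicit Types (a C w s t r x : R) (al be : profile R).

Lemma period_int (T : Type) (f : R -> T) (P : R) : (forall u, f (u + P) = f u) ->
  forall (k : int) u, f (u + k%:~R * P) = f u.
Proof.
move=> per; have nat_per (n : nat) u : f (u + n%:R * P) = f u.
  elim: n u => [|n IH] u; first by rewrite mul0r addr0.
  by rewrite -[in RHS]IH -[in RHS]per -natr1 mulrDl mul1r addrA.
case=> n u; first exact: nat_per.
by rewrite -[in RHS](subrK ((n.+1)%:R * P) u) nat_per NegzE rmorphN /= mulNr.
Qed.

Lemma proper_of_period w al (P : R) : 0 < P ->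
  (forall u, alpha al (u + P) = alpha al u) -> properly_immersed w al.
Proof.
move=> P0 per A cA.
have cz : compact ((fun v : 'rV[R]_3 => v 0 (inord 2)) @` A).
  apply: continuous_compact => //; apply: continuous_subspaceT; exact: coord_continuous.
have [M [_ hM]] := compact_bounded cz.
have bz v : A v -> `|v 0 (inord 2)| <= M + 1.
  by move=> Av; apply: (hM (M + 1)); [rewrite ltrDl|exists v].
exists (`[0, P] `*` `[- (M + 1), M + 1])%classic.
  by apply: compact_setX; exact: segment_compact.
move=> s t At; have := bz _ At; rewrite /phi vec3_2 ler_norml => ht.
pose k := Num.floor (s / P).
have e : s = s / P * P by rewrite divfK // gt_eqF.
have f1 : k%:~R * P <= s by rewrite [leRHS]e ler_pM2r // floor_le_tmp.
have f2 : s <= (k + 1)%:~R * P by rewrite [leLHS]e ler_pM2r // ltW // floorD1_gt.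
exists ((- k)%:~R * P); first by move=> u; exact: period_int.
split; rewrite /= in_itv /= ?ht //.
rewrite rmorphN mulNr subr_ge0 f1 /= lerBlDr.
by move: f2; rewrite intrD mulrDl mul1r addrC.
Qed.

Lemma moved_iter al T c : moved al al T c -> forall n : nat,
  moved al al (n%:R * T) (n%:R * c).
Proof.
move=> mv; elim=> [|n IH] s; first by rewrite !mul0r !addr0.
have [h1 h2] := IH s; have [h3 h4] := mv (s + n%:R * T).
have -> : s + n.+1%:R * T = s + n%:R * T + T by rewrite -natr1; ring.
split; last by rewrite h2 h4.
by rewrite h1 h3 -natr1; ring.
Qed.

Lemma moved_iter_int al T c : moved al al T c -> forall k : int,
  moved al al (k%:~R * T) (k%:~R * c).
Proof.
move=> mv; case=> n; first exact: moved_iter.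
move=> s; have [h1 h2] := moved_iter mv n.+1 (s - n.+1%:R * T).
rewrite subrK in h1 h2.
rewrite NegzE rmorphN /= !mulNr; split => //.
by rewrite h1 addrK.
Qed.

Lemma proper_of_rational w al T c : 0 < T -> moved al al T c ->
  rational (c / pi) -> properly_immersed w al.
Proof.
move=> T0 mv /rationalP[p [q e]].
have p0 := pi_gt0 R.
have [n [l [n0 hn]]] : exists (n : nat) (l : int), (0 < n)%N /\ n%:R * c = l%:~R * (pi *+ 2).
  have ec : c = p%:~R / q%:R * pi by rewrite -e divfK // gt_eqF.
  have [q0|q0] := posnP q.
    by exists 1%N, 0; split => //; rewrite ec q0 mulr0n invr0 mulr0 !mul0r mulr0.
  exists (q * 2)%N, p; split; first by rewrite muln_gt0 q0.
  by rewrite ec natrM mulr2n; field; rewrite pnatr_eq0 -lt0n.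
have mvn := moved_iter mv n.
apply: (@proper_of_period w al (n%:R * T)); first by rewrite mulr_gt0 // ltr0n.
move=> u; rewrite /alpha (moved_px u mvn) (moved_py u mvn) hn.
by rewrite -[l%:~R * _]add0r cosDint sinDint cos0 sin0 !mul1r !mul0r subr0 add0r.
Qed.

(** The horizontal sections of the surface are invariant under the rotations by
    the multiples of [c], which are dense modulo [2 pi]. *)
Lemma dense_of_irrational w al T c r1 r2 : 0 < w -> 0 <= r1 -> moved al al T c ->
  (forall s, r1 <= rad al s <= r2) ->
  (forall r, r1 <= r <= r2 -> exists s, rad al s = r) ->
  irrational (c / pi) -> dense_between w al (Num.sqrt r1) (Num.sqrt r2).
Proof.
move=> w0 r10 mv ri surj irr; split.
  move=> v [s [t ->]] /=; rewrite axis_dist_sqrt.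
  have /andP[h1 h2] := ri s.
  by rewrite !ler_wsqrtr.
move=> v /= /andP[v1 v2] B nB.
set X := v 0 (inord 0); set Y := v 0 (inord 1); set z := v 0 (inord 2).
have XY0 : 0 <= X ^+ 2 + Y ^+ 2 by rewrite addr_ge0 ?sqr_ge0.
have r120 : r1 <= X ^+ 2 + Y ^+ 2 <= r2.
  have r20 : 0 <= r2.
    rewrite leNgt; apply/negP => h; move: v2; rewrite ler0_sqrtr ?(ltW h) //.
    by have /andP[h1 h2] := ri 0; have := le_trans (rad_ge0 al 0) h2; rewrite leNgt h.
  by move: v1 v2; rewrite /axis_dist -/X -/Y !ler_sqrt // => -> ->.
have [s0 es0] := surj _ r120.
have [b [eX eY]] : exists b, X = cos b * px al s0 - sin b * py al s0 /\
    Y = sin b * px al s0 + cos b * py al s0.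
  by apply: rotate_to; rewrite -es0.
pose M (g : R) : 'rV[R]_3 := vec3 (cos g * px al s0 - sin g * py al s0)
   (sin g * px al s0 + cos g * py al s0) z.
have Mb : M b = v by apply: row3P; rewrite !vec3E // -?eX -?eY.
have cM : M g @[g --> b] --> v.
  rewrite -Mb => D [P hP PD]; rewrite nbhs_simpl /=.
  have : \forall g \near b, forall ij : 'I_1 * 'I_3, P ij.1 ij.2 (M g ij.1 ij.2).
    apply: (@filter_forall _ _ (fun (ij : 'I_1 * 'I_3) (g : R) => P ij.1 ij.2 (M g ij.1 ij.2)) (nbhs b)) => -[i j] /=.
    have cs (c1 c2 : R) : continuous (fun g : R => cos g * c1 - sin g * c2).
      apply: (@der_cts _ _ (fun g => - sin g * c1 - cos g * c2)) => g; derive.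
        by ring.
    have cs' (c1 c2 : R) : continuous (fun g : R => sin g * c1 + cos g * c2).
      by apply: (@der_cts _ _ (fun g => cos g * c1 - sin g * c2)) => g; derive; ring.
    have cj : continuous (fun g => M g i j).
      rewrite (ord1 i); case: j => -[|[|[|//]]] jl.
      - rewrite (_ : Ordinal jl = inord 0); last by apply/val_inj; rewrite /= inordK.
        by under eq_fun do rewrite vec3E; exact: cs.
      - rewrite (_ : Ordinal jl = inord 1); last by apply/val_inj; rewrite /= inordK.
        by under eq_fun do rewrite vec3E; exact: cs'.
      - rewrite (_ : Ordinal jl = inord 2); last by apply/val_inj; rewrite /= inordK.
        by under eq_fun do rewrite vec3E; exact: cst_continuous.
    exact: (cj b _ (hP i j)).
  apply: filterS => g hg; apply: PD => i j; exact: (hg (i, j)).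
have /nbhs_ballP[e /= e0 he] := cM _ nB.
have [k [l hkl]] : exists k l : int, `|k%:~R * c + l%:~R * (pi *+ 2) - (b + w * z)| < e.
  apply: kronecker e0; first exact: pi2_gt0.
  move=> /rationalP[p [q epq]]; apply: irr; apply/rationalP.
  exists (p * 2), q; rewrite intrM mulrAC -epq mulr2n.
  by have := pi_gt0 R; move: (@pi R) => y y0; field; rewrite !gt_eqF ?addr_gt0.
have Bg : B (M (k%:~R * c - w * z + l%:~R * (pi *+ 2))).
  apply: he; rewrite /ball /= distrC.
  by rewrite (_ : _ - b = k%:~R * c + l%:~R * (pi *+ 2) - (b + w * z)) //; ring.
exists (M (k%:~R * c - w * z + l%:~R * (pi *+ 2))); split => //.
exists (s0 - k%:~R * T), z; rewrite /M !cosDint !sinDint /phi.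
have mvk := moved_iter_int mv k.
rewrite (moved_px (s0 - k%:~R * T) mvk) (moved_py (s0 - k%:~R * T) mvk) subrK cosB sinB.
by apply: row3P; rewrite !vec3E //; ring.
Qed.

Section rotation_angle.
Variables (a C w r1 r2 : R) (K dK : R -> R).
Hypothesis SI : simple_interval a C w r1 r2 K dK.

Notation G := (ovalG r1 r2).
Notation G1 := (ovalG1 r1 r2).
Notation V := (ovalV r1 r2 K).

(** A full turn of [u] takes the TreadmillSled back to its starting point, so the
    curve is rotated by some angle, here [- c].  Both ends are at the radius
    [r1], where [xi1 = 0]; comparing [double_phase] there shows that this angle
    is the increment of the polar angle up to a multiple of [pi]. *)
Lemma oval_rotation al : a != 0 -> represents a C w al -> rolls a C w G G1 V al ->
  exists (T c : R) (k : int), [/\ 0 < T, moved al al T c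
    & c = k%:~R * pi - angle_variation a C w r1 r2].
Proof.
move=> a0 rep ro; have [/andP[r10 r12] _ QK _] := SI.
have [b [db B]] := polar_speed SI.
have ro' := ro; have [S [U [dS SU US dU e]]] := ro'.
have [Sinc T0 ST UT] := roll_period SI dS SU US.
set T := _ - _ in T0 ST UT.
have radE s : rad al s = G (U s) := rad_at (simple_rolling SI) (e s).
have ri s : r1 <= rad al s <= r2 by rewrite radE ovalG_itv // ltW.
have [c mv] : exists c, moved al al T c.
  apply: (represents_unique a0 rep rep).
  rewrite -[T in RHS]add0r !e UT.
  by have [-> -> ->] := oval_2pi r1 r2 K (U 0).
have cb : continuous (fun s => b (rad al s)).
  apply: (@der_cts _ _ (fun s => db (rad al s) * (2 * xi1 al s))) => s.
  have [d1 _ _] := B _ (ri s).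
  exact: (@der_comp _ b (rad al) s _ _ d1 (der_rad al s)).
have [phi dphi] := primitive cb.
pose Phi u := phi (S u).
have dPhi (u : R) : is_derive u 1 Phi (b (G u) / V u).
  have h := @der_comp _ phi S u _ _ (dphi (S u)) (dS u).
  by rewrite radE SU in h.
have AV := angle_variationE SI B dPhi.
(* half a turn and a full turn are compared by the symmetry [u -> - u] *)
have even u : Phi u + Phi (- u) = Phi 0 + Phi 0.
  have D (z : R) : is_derive z 1 (fun u => Phi u + Phi (- u)) 0.
    have d1 := dPhi z.
    have d0 : is_derive z 1 (fun u : R => - u) (-1) by derive.
    have d2 := @der_comp _ Phi (fun u => - u) z _ _ (dPhi (- z)) d0.
    by derive; have [-> _ ->] := @ovalG_even R r1 r2 K z; ring.
  by have := @is_derive_0_is_cst R _ u 0 D; rewrite oppr0.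
have per u : Phi (u + pi *+ 2) - Phi u = Phi (pi *+ 2) - Phi 0.
  have D (z : R) : is_derive z 1 (fun u => Phi (u + pi *+ 2) - Phi u) 0.
    have d1 := dPhi z; have d2 := der_shift (dPhi (z + pi *+ 2)).
    by derive; have [-> _ ->] := oval_2pi r1 r2 K z; rewrite subrr.
  by have := @is_derive_0_is_cst R _ u 0 D; rewrite add0r.
have AV2 : angle_variation a C w r1 r2 = Phi (pi *+ 2) - Phi 0.
  rewrite AV -(per (- pi)) (_ : - pi + pi *+ 2 = pi); last by rewrite mulr2n; ring.
  by have := even pi; lra.
have [h1 h2] := double_phase B rep ri dphi (S 0) (S (pi *+ 2)).
have x0 : xi1 al (S 0) = 0.
  by have [-> _] := e (S 0); rewrite SU /ovalG1 sin0 mulr0 !mul0r.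
have x1 : xi1 al (S (pi *+ 2)) = 0.
  by have [-> _] := e (S (pi *+ 2)); rewrite SU /ovalG1 sin2pi mulr0 !mul0r.
have q0 : rad al (S 0) = r1 by rewrite radE SU /ovalG cos0; field.
have q1 : rad al (S (pi *+ 2)) = r1 by rewrite radE SU /ovalG cos2pi; field.
move: h1 h2; rewrite /= x0 x1 q0 q1 !(mulr0, mul0r) !(subr0, addr0).
(* the factor is [- 1], or [1] when [r1 = 0] *)
have A0 : 1 - 2 * r1 * b r1 ^+ 2 != 0.
  have r1i : r1 <= r1 <= r2 by rewrite lexx ltW.
  have [_ eb _] := B _ r1i.
  have : r1 - (r1 * b r1) ^+ 2 = 0.
    rewrite -eb; apply: (mulfI (x := 4)); first by [].
    by rewrite rho2_sq // QK subrr !mul0r mulr0.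
  have [->|r1n] := eqVneq r1 0; first by rewrite mulr0 mul0r subr0 oner_eq0.
  rewrite (_ : _ - _ = r1 * (1 - r1 * b r1 ^+ 2)); last by ring.
  move/eqP; rewrite mulf_eq0 (negbTE r1n) /= subr_eq0 => /eqP h.
  rewrite -mulrA -h mulr1 (_ : 1 - 2 = -1); first by rewrite oppr_eq0 oner_eq0.
  ring.
move=> /(mulIf A0) ec /(mulIf A0) es.
have [k ek] := same_angle ec es.
exists T, c, k; split => //.
have [eth _] := mv (S 0).
have ST0 : S (pi *+ 2) = S 0 + T by rewrite -ST add0r.
move: ek; rewrite ST0 eth AV2 /Phi ST0 mulr2n; lra.
Qed.

Lemma oval_dichotomy al : a != 0 -> 0 < w -> represents a C w al -> rolls a C w G G1 V al ->
  (rational (angle_variation a C w r1 r2 / pi) -> properly_immersed w al) /\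
  (irrational (angle_variation a C w r1 r2 / pi) ->
     dense_between w al (Num.sqrt r1) (Num.sqrt r2)).
Proof.
move=> a0 w0 rep ro; have [T [c [k [T0 mv ec]]]] := oval_rotation a0 rep ro.
have [/andP[r10 r12] _ _ _] := SI.
have [U radE] := rolls_rad (simple_rolling SI) ro.
have conv x y : y = k%:~R * pi - x -> rational (x / pi) -> rational (y / pi).
  move=> -> /rationalP[p [q e]].
  have p0 := pi_gt0 R.
  rewrite mulrBl mulfK ?gt_eqF // e; apply/rationalP.
  have [->|q0] := posnP q; first by exists k, 1%N; rewrite mulr0n invr0 mulr0 subr0 divr1.
  exists (k * q%:Z - p), q; rewrite intrD intrM rmorphN /= -pmulrn.
  by field; rewrite pnatr_eq0 -lt0n.
split=> h.
  exact: (@proper_of_rational w al T c T0 mv (conv _ _ ec h)).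
apply: (dense_of_irrational w0 r10 mv).
- by move=> s; rewrite radE ovalG_itv // ltW.
- move=> r /(ovalG_surj SI)[u _ <-].
  have [S [U' [_ SU _ _ e]]] := ro; exists (S u).
  by rewrite (rad_at (simple_rolling SI) (e (S u))) SU.
- by move=> hc; apply: h; apply: conv hc; rewrite ec; ring.
Qed.

End rotation_angle.
End proper_dense.

(** * Curves asymptotic to a circle *)
Section exceptional.
Context {R : realType}.
Implicit Types (a C w s t r x : R) (al be : profile R).

(** Both ends of the line at once. *)
Definition at_ends (P : R -> Prop) := exists A : R, forall s, A < `|s| -> P s.

Lemma at_ends_and (P Q : R -> Prop) : at_ends P -> at_ends Q ->
  at_ends (fun s => P s /\ Q s).
Proof.
move=> [A hA] [B hB]; exists (Num.max A B) => s; rewrite gt_max => /andP[h1 h2].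
by split; [exact: hA|exact: hB].
Qed.

Lemma at_ends_impl (P Q : R -> Prop) : (forall s, P s -> Q s) -> at_ends P -> at_ends Q.
Proof. by move=> PQ [A hA]; exists A => s /hA /PQ. Qed.

Lemma at_ends_pinfty (P : R -> Prop) : at_ends P -> \forall s \near +oo, P s.
Proof.
move=> [A hA]; exists A; split; first exact: num_real.
by move=> s As; apply: hA; apply: lt_le_trans As _; exact: ler_norm.
Qed.

Lemma at_ends_ninfty (P : R -> Prop) : at_ends P -> \forall s \near -oo, P s.
Proof.
move=> [A hA]; exists (- A); split; first exact: num_real.
move=> s As; apply: hA; rewrite -normrN; apply: (@lt_le_trans _ _ (- s)).
  by rewrite ltrNr.
exact: ler_norm.
Qed.

Lemma descent (f f' : R -> R) (k : R) : 0 < k -> (forall s : R, is_derive s 1 f (f' s)) ->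
  at_ends (fun s => f' s <= - k) ->
  f s @[s --> +oo] --> -oo /\ f s @[s --> -oo] --> +oo.
Proof.
move=> k0 df [A hA]; pose B := Num.max A 0.
have mono x y : x <= y -> (forall z, x < z < y -> A < `|z|) -> f y + k * y <= f x + k * x.
  move=> xy h; rewrite -lerN2.
  apply: (@der_homo _ (fun s => - (f s + k * s)) (fun s => - (f' s + k)) x y xy) => z zi.
    by have d := df z; derive; ring.
  by rewrite oppr_ge0 -lerBrDr sub0r; apply: hA; exact: h.
have AB : A <= B by rewrite le_max lexx.
have B0 : 0 <= B by rewrite le_max lexx orbT.
split.
  apply/cvgrNyPle => M; near=> s.
  have Bs : B <= s by near: s; apply: nbhs_pinfty_ge; exact: num_real.
  have h : f s + k * s <= f B + k * B.
    apply: mono => // z /andP[z1 z2]; rewrite ger0_norm; first exact: le_lt_trans z1.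
    by rewrite ltW // (le_lt_trans B0).
  have : (f B + k * B - M) / k <= s.
    by near: s; apply: nbhs_pinfty_ge; exact: num_real.
  by rewrite ler_pdivrMr // [leRHS]mulrC; move: h; move: (k * s) (k * B) => p q; lra.
apply/cvgryPge => M; near=> s.
have Bs : s <= - B by near: s; apply: nbhs_ninfty_le; exact: num_real.
have h : f (- B) + k * - B <= f s + k * s.
  apply: mono => // z /andP[z1 z2]; rewrite ltr0_norm; first by rewrite ltrNr (lt_le_trans z2) // lerN2.
  by rewrite (lt_le_trans z2) // oppr_le0.
have : s <= (f (- B) + k * - B - M) / k.
  by near: s; apply: nbhs_ninfty_le; exact: num_real.
by rewrite ler_pdivlMr // [leLHS]mulrC; move: h; move: (k * s) (k * - B) => p q; lra.
Unshelve. all: by end_near.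
Qed.

Lemma vec3_cvg (T : topologicalType) (F : set_system T) (FF : Filter F)
  (f g h : T -> R) (x y z : R) :
  f t @[t --> F] --> x -> g t @[t --> F] --> y -> h t @[t --> F] --> z ->
  vec3 (f t) (g t) (h t) @[t --> F] --> vec3 x y z.
Proof.
move=> fx gy hz D [P hP PD]; rewrite nbhs_simpl /=.
have hh (ij : 'I_1 * 'I_3) : \forall t \near F, P ij.1 ij.2 (vec3 (f t) (g t) (h t) ij.1 ij.2).
  case: ij => i j /=.
  have cj : (vec3 (f t) (g t) (h t) i j) @[t --> F] --> vec3 x y z i j.
    rewrite (ord1 i); case: j => -[|[|[|//]]] jl.
    - rewrite (_ : Ordinal jl = inord 0); last by apply/val_inj; rewrite /= inordK.
      by under eq_cvg do rewrite vec3E; rewrite vec3E.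
    - rewrite (_ : Ordinal jl = inord 1); last by apply/val_inj; rewrite /= inordK.
      by under eq_cvg do rewrite vec3E; rewrite vec3E.
    - rewrite (_ : Ordinal jl = inord 2); last by apply/val_inj; rewrite /= inordK.
      by under eq_cvg do rewrite vec3E; rewrite vec3E.
  exact: (cj _ (hP i j)).
have := filter_forall FF hh.
by apply: filterS => t ht; apply: PD => i j; exact: (ht (i, j)).
Qed.

Section asymptotics.
Variables (w : R) (al : profile R) (R0 : R).
Hypothesis R0_gt0 : 0 < R0.
Hypothesis rad_lim : forall e, 0 < e -> at_ends (fun s => `|rad al s - R0 ^+ 2| < e).
Hypothesis xi2_lim : forall e, 0 < e -> at_ends (fun s => `|xi2 al s + R0| < e).
Hypothesis turn_lim : forall e, 0 < e ->
  at_ends (fun s => `|derive1 (pth al) s + R0^-1| < e).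
Hypothesis rad_ne : forall s, rad al s != R0 ^+ 2.

Lemma asymptotic_not_periodic tau : (forall u, alpha al (u + tau) = alpha al u) -> tau = 0.
Proof.
move=> per; apply/eqP/negPn/negP => tau0.
have rper u : rad al (u + tau) = rad al u.
  by have [h1 h2] := per u; rewrite /rad h1 h2.
have e0 : 0 < `|rad al 0 - R0 ^+ 2| by rewrite normr_gt0 subr_eq0.
have [A hA] := rad_lim e0.
pose n := (Num.truncn (`|A| / `|tau|)).+1.
have h : A < `|0 + n%:Z%:~R * tau|.
  rewrite add0r normrM ger0_norm ?ler0z //.
  apply: (le_lt_trans (ler_norm A)); rewrite -ltr_pdivrMr ?normr_gt0 //.
  by rewrite -pmulrn; apply: truncnS_gt.
by have := hA _ h; rewrite (period_int rper) ltxx.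
Qed.

Lemma rad_bounded_ends : exists2 B, 0 <= B & forall s, rad al s <= B.
Proof.
have [A hA] := rad_lim ltr01.
have cr : continuous (rad al) by apply: der_cts => s; exact: der_rad.
have AA : - `|A| <= `|A| by rewrite (le_trans _ (normr_ge0 A)) // oppr_le0.
have [c _ hc] := EVT_max AA (cts_within cr).
exists (rad al c + (R0 ^+ 2 + 1)).
  by rewrite addr_ge0 ?rad_ge0 // addr_ge0 ?sqr_ge0.
move=> s; have [h|h] := leP `|s| `|A|.
  apply: (@le_trans _ _ (rad al c)); last by rewrite lerDl addr_ge0 ?sqr_ge0.
  by apply: hc; rewrite in_itv /= -ler_norml.
have := hA s (le_lt_trans (ler_norm A) h); have := rad_ge0 al c.
rewrite ltr_norml => c0 /andP[_]; lra.
Qed.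

(** The profile curve is bounded and has no period, so the whole section [t = 0]
    lies in a compact set while no compact set of parameters covers it. *)
Lemma asymptotic_not_proper : ~ properly_immersed w al.
Proof.
move=> prop; have [B B0 hB] := rad_bounded_ends.
pose sq := (`[- (B + 1), B + 1] `*` `[- (B + 1), B + 1])%classic : set (R * R).
have csq : compact sq by apply: compact_setX; exact: segment_compact.
pose K := (fun p : R * R => vec3 p.1 p.2 0 : 'rV[R]_3) @` sq.
have cK : compact K.
  apply: continuous_compact => //; apply: continuous_subspaceT => p.
  by apply: vec3_cvg; [exact: cvg_fst|exact: cvg_snd|exact: cvg_cst].
have [D cD hD] := prop K cK.
have xb (x r : R) : x ^+ 2 <= r -> r <= B -> - (B + 1) <= x <= B + 1.
  move=> h1 h2; apply/andP; split; nra.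
have inK s : K (phi w al s 0).
  exists (px al s, py al s).
    split; rewrite /= in_itv /=; apply: (xb _ (rad al s)) => //.
      by rewrite /rad lerDl sqr_ge0.
    by rewrite /rad lerDr sqr_ge0.
  by rewrite /phi /= mulr0 cos0 sin0; apply: row3P; rewrite !vec3E /=; ring.
have cD1 : compact (fst @` D).
  by apply: continuous_compact => //; apply: continuous_subspaceT => p; exact: cvg_fst.
have [M [_ hM]] := compact_bounded cD1.
have all s : `|s| <= M + 1.
  have [tau per Dt] := hD s 0 (inK s).
  have t0 := asymptotic_not_periodic per; rewrite t0 addr0 in Dt.
  by apply: (hM (M + 1)); [rewrite ltrDl|exists (s, 0)].
have := all (`|M| + 2); rewrite ger0_norm ?addr_ge0 //.
by have := ler_norm M; lra.
Qed.

Lemma turn_descent : at_ends (fun s => derive1 (pth al) s <= - (R0^-1 / 2)).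
Proof.
have e0 : 0 < R0^-1 / 2 by rewrite divr_gt0 // invr_gt0.
by apply: at_ends_impl (turn_lim e0) => s; rewrite ltr_norml => /andP[_]; lra.
Qed.

Lemma xi1_lim e : 0 < e -> at_ends (fun s => `|xi1 al s| < e).
Proof.
move=> e0; pose m := Num.min 1 (e ^+ 2 / (2 * R0 + 2)).
have m0 : 0 < m by rewrite lt_min ltr01 divr_gt0 ?exprn_gt0 // addr_gt0 // mulr_gt0.
have m1 : m <= 1 by rewrite ge_min lexx.
have m2 : m * (2 * R0 + 2) <= e ^+ 2.
  by rewrite -ler_pdivlMr ?addr_gt0 ?mulr_gt0 // ge_min lexx orbT.
apply: at_ends_impl (at_ends_and (rad_lim m0) (xi2_lim m0)) => s [].
rewrite -xi_rad !ltr_norml => /andP[_ h1] /andP[h2 h3].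
have h4 : xi1 al s ^+ 2 < e ^+ 2.
  apply: lt_le_trans m2; move: (xi1 al s ^+ 2) (xi2 al s) h1 h2 h3 => p y h1 h2 h3.
  have k1 : 0 <= R0 * (m - (y + R0)) by rewrite mulr_ge0 ?ltW // subr_gt0.
  have := sqr_ge0 (y + R0); move: h1 k1; rewrite !expr2; nra.
by move: (xi1 al s) h4 => x h4; apply/andP; split; nra.
Qed.

(** The direction of the tangent decreases at a speed that tends to [1 / R0], so
    it takes each value modulo [2 pi] near each end. *)
Lemma pth_hits (F : set_system R) (beta : R) :
  (F = pinfty_nbhs R \/ F = ninfty_nbhs R) ->
  forall P : set R, F P -> exists s k, P s /\ pth al s = beta + k%:~R * (pi *+ 2) :> R.
Proof.
move=> FE P FP.
have e0 : 0 < R0^-1 / 2 by rewrite divr_gt0 // invr_gt0.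
have [l1 l2] := descent e0 (der_pth al) turn_descent.
have cp : continuous (pth al) by apply: der_cts => s; exact: der_pth.
have hit x y k : x <= y -> pth al y <= beta + k%:~R * (pi *+ 2) <= pth al x ->
    exists2 s, x <= s <= y & pth al s = beta + k%:~R * (pi *+ 2).
  move=> xy h; have [|s] := @IVT R (pth al) x y (beta + k%:~R * (pi *+ 2)) xy (cts_within cp).
    have /andP[h1 h2] := h.
    by rewrite ge_min h1 orbT /= le_max h2.
  by rewrite in_itv /= => si e; exists s.
have lower x : exists k : int, beta + k%:~R * (pi *+ 2) <= x.
  have [k /andP[k1 k2]] := mod2pi (x - beta); exists k; lra.
have upper x : exists k : int, x <= beta + k%:~R * (pi *+ 2).
  have [k /andP[k1 k2]] := mod2pi (x - beta); exists (k + 1).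
  by rewrite intrD mulrDl mul1r; lra.
case: FE => FE; rewrite FE in FP; case: FP => A [_ hA].
  have [k hk] := lower (pth al (A + 1)).
  have /cvgrNyPle /(_ (beta + k%:~R * (pi *+ 2))) := l1.
  move=> [A' [_ hA']].
  have h1 : A' < Num.max A' (A + 1) + 1 by rewrite (@le_lt_trans _ _ (Num.max A' (A + 1))) ?ltrDl // le_max lexx.
  have h2 : A + 1 <= Num.max A' (A + 1) + 1 by rewrite (@le_trans _ _ (Num.max A' (A + 1))) ?lerDl // le_max lexx orbT.
  have [|s /andP[s1 s2] e] := hit _ _ k h2; first by rewrite hk hA'.
  by exists s, k; split => //; apply: hA; rewrite (lt_le_trans _ s1) // ltrDl.
have [k hk] := upper (pth al (A - 1)).
have /cvgryPge /(_ (beta + k%:~R * (pi *+ 2))) := l2.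
move=> [A' [_ hA']].
have h1 : Num.min A' (A - 1) - 1 < A' by rewrite (@lt_le_trans _ _ (Num.min A' (A - 1))) ?gtrDl ?oppr_lt0 // ge_min lexx.
have h2 : Num.min A' (A - 1) - 1 <= A - 1 by rewrite (@le_trans _ _ (Num.min A' (A - 1))) ?gerDl ?oppr_le0 // ge_min lexx orbT.
have [|s /andP[s1 s2] e] := hit _ _ k h2; first by rewrite hk hA'.
by exists s, k; split => //; apply: hA; rewrite (le_lt_trans s2) // gtrDl oppr_lt0.
Qed.

(** The radius tends to [R0], so cluster points are on the circle.  Since also
    [xi1 -> 0] and [xi2 -> - R0], the position is close to [R0] times a unit
    vector given by [pth], which takes every direction near each end. *)
Lemma cluster_circle (F : set_system R) :
  (forall P : R -> Prop, at_ends P -> F P) ->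
  (F = pinfty_nbhs R \/ F = ninfty_nbhs R) ->
  cluster (alpha al s @[s --> F]) = circle R0.
Proof.
move=> Fends FE.
have PF : ProperFilter F by case: FE => ->; exact: _.
apply/seteqP; split => p.
  move=> clp; apply/eqP/negPn/negP; rewrite -subr_eq0 => ne.
  pose f (q : R * R) := q.1 ^+ 2 + q.2 ^+ 2.
  pose e := `|f p - R0 ^+ 2| / 2.
  have e0 : 0 < e by rewrite divr_gt0 // normr_gt0.
  have cf : continuous f.
    move=> q; apply: cvgD; apply: (@continuous_comp _ _ _ _ (fun x : R => x ^+ 2)).
    - exact: cvg_fst.
    - exact: exprn_continuous.
    - exact: cvg_snd.
    - exact: exprn_continuous.
  have nB : nbhs p [set q | `|f p - f q| < e] by have /cvgrPdist_lt/(_ _ e0) := cf p.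
  have FA : (alpha al s @[s --> F]) [set q | `|f q - R0 ^+ 2| < e].
    exact: (Fends _ (rad_lim e0)).
  have [q [/= q1 q2]] := clp _ _ FA nB.
  have := ler_normD (f q - R0 ^+ 2) (f p - f q).
  rewrite (_ : f q - R0 ^+ 2 + (f p - f q) = f p - R0 ^+ 2); last by ring.
  by move: q1 q2; rewrite /e; lra.
move=> cp A B FA /nbhs_ballP[e /= e0 hB].
have [beta [eb1 eb2]] : exists b, p.2 / R0 = cos b /\ - p.1 / R0 = sin b.
  apply: unit_angle; rewrite !expr_div_n sqrrN -mulrDl addrC cp mulfV //.
  by rewrite expf_neq0 // gt_eqF.
have e2 : 0 < e / 2 by rewrite divr_gt0.
have G : F [set s | A (alpha al s) /\ (`|xi1 al s| < e / 2 /\ `|xi2 al s + R0| < e / 2)].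
  by apply: filterI => //; apply: Fends; apply: at_ends_and; [exact: xi1_lim|exact: xi2_lim].
have [s [k [[As [x1 x2]] ek]]] := pth_hits beta FE G.
exists (alpha al s); split => //; apply: hB.
have p1 : p.1 = - R0 * sin beta by rewrite -eb2; field; rewrite gt_eqF.
have p2 : p.2 = R0 * cos beta by rewrite -eb1; field; rewrite gt_eqF.
have bnd (x y c d : R) : `|x| < e / 2 -> `|y| < e / 2 -> `|c| <= 1 -> `|d| <= 1 -> `|x * c + y * d| < e.
  move=> hx hy hc hd; apply: (le_lt_trans (ler_normD _ _)); rewrite !normrM.
  rewrite (@le_lt_trans _ _ (`|x| + `|y|)) ?lerD ?ler_piMr //; lra.
have c1 : `|cos beta| <= 1 by rewrite ler_norml cos_geN1 cos_le1.
have s1 : `|sin beta| <= 1 by rewrite ler_norml sin_geN1 sin_le1.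
split; rewrite /ball /= distrC ?p1 ?p2 ?px_xi ?py_xi ek cosDint sinDint.
  rewrite (_ : _ - _ = xi1 al s * cos beta + (xi2 al s + R0) * sin beta); last by ring.
  exact: bnd.
rewrite (_ : _ - _ = xi1 al s * sin beta + (xi2 al s + R0) * - cos beta); last by ring.
by apply: bnd; rewrite ?normrN.
Qed.

Lemma asymptotic_limit_cycle : limit_cycle al R0.
Proof.
split.
- apply/seteqP; split => // p [[s _ <-]]; rewrite /circle /= => e.
  by have := rad_ne s; rewrite /rad e eqxx.
- by apply: cluster_circle; [exact: at_ends_pinfty|left].
- by apply: cluster_circle; [exact: at_ends_ninfty|right].
Qed.

(** The angle is a primitive of the speed of the polar angle about [p]; the
    derivatives of the position divided by the distance to [p], turned back by
    this primitive, vanish. *)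
Lemma polar_lift (p : R * R) : (forall s, alpha al s <> p) ->
  exists psi : R -> R,
  (forall s : R, is_derive s 1 psi (((px al s - p.1) * sin (pth al s)
     - (py al s - p.2) * cos (pth al s)) /
    ((px al s - p.1) ^+ 2 + (py al s - p.2) ^+ 2))) /\
  forall s, exists2 d : R, 0 < d & alpha al s = (p.1 + d * cos (psi s), p.2 + d * sin (psi s)).
Proof.
move=> off; pose u s := px al s - p.1; pose v s := py al s - p.2.
have du (s : R) : is_derive s 1 u (cos (pth al s)) by rewrite /u; derive; rewrite ?oppr0 ?addr0.
have dv (s : R) : is_derive s 1 v (sin (pth al s)) by rewrite /v; derive; rewrite ?oppr0 ?addr0.
have uv s : 0 < u s ^+ 2 + v s ^+ 2.
  rewrite lt_def addr_ge0 ?sqr_ge0 // andbT; apply/negP.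
  rewrite paddr_eq0 ?sqr_ge0 // !sqrf_eq0 !subr_eq0 => /andP[/eqP h1 /eqP h2].
  by apply: (off s); rewrite /alpha h1 h2; case: (p).
have cN : continuous (fun s => (u s * sin (pth al s) - v s * cos (pth al s)) / (u s ^+ 2 + v s ^+ 2)).
  move=> s; have d1 := du s; have d2 := dv s; have d3 := der_pth al s.
  by eapply der_continuous; der; rewrite gt_eqF.
have [psi dpsi] := primitive cN.
pose D s := Num.sqrt (u s ^+ 2 + v s ^+ 2).
have D0 s : 0 < D s by rewrite sqrtr_gt0.
have DD s : D s ^+ 2 = u s ^+ 2 + v s ^+ 2 by rewrite sqr_sqrtr // ltW.
have dD (s : R) : is_derive s 1 D ((u s * cos (pth al s) + v s * sin (pth al s)) / D s).
  have d1 := du s; have d2 := dv s; rewrite /D; derive => //.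
  by rewrite -/(D s); field; rewrite gt_eqF.
pose E1 s := (u s * cos (psi s) + v s * sin (psi s)) / D s.
pose E2 s := (v s * cos (psi s) - u s * sin (psi s)) / D s.
have dE1 (s : R) : is_derive s 1 E1 0.
  have d1 := du s; have d2 := dv s; have d3 := dD s; have d4 := dpsi s.
  rewrite /E1; derive; rewrite ?gt_eqF // -DD.
  move: (D0 s) (DD s); move: (D s) (u s) (v s) => z x y z0 e.
  move: (cos (pth al s)) (sin (pth al s)) (cos (psi s)) (sin (psi s)) => c d c' d'.
  transitivity ((c * c' + d * d') / z - (x * c + y * d) * (x * c' + y * d') / z ^+ 3
     + (x * d - y * c) * (y * c' - x * d') / z ^+ 3); first by field; rewrite gt_eqF.
  rewrite (_ : (c * c' + d * d') / z = (c * c' + d * d') * z ^+ 2 / z ^+ 3); last by field; rewrite gt_eqF.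
  by rewrite e; field; rewrite gt_eqF.
have dE2 (s : R) : is_derive s 1 E2 0.
  have d1 := du s; have d2 := dv s; have d3 := dD s; have d4 := dpsi s.
  rewrite /E2; derive; rewrite ?gt_eqF // -DD.
  move: (D0 s) (DD s); move: (D s) (u s) (v s) => z x y z0 e.
  move: (cos (pth al s)) (sin (pth al s)) (cos (psi s)) (sin (psi s)) => c d c' d'.
  transitivity ((d * c' - c * d') / z - (x * c + y * d) * (y * c' - x * d') / z ^+ 3
     - (x * d - y * c) * (y * d' + x * c') / z ^+ 3); first by field; rewrite gt_eqF.
  rewrite (_ : (d * c' - c * d') / z = (d * c' - c * d') * z ^+ 2 / z ^+ 3); last by field; rewrite gt_eqF.
  by rewrite e; field; rewrite gt_eqF.
have cE1 s : E1 s = E1 0 := @is_derive_0_is_cst R E1 s 0 dE1.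
have cE2 s : E2 s = E2 0 := @is_derive_0_is_cst R E2 s 0 dE2.
have [c [ec es]] : exists c, E1 0 = cos c /\ E2 0 = sin c.
  apply: unit_angle; rewrite /E1 /E2.
  have := cos2sin2 (psi 0); move: (D0 0) (DD 0); move: (D 0) (u 0) (v 0) => z x y z0 e.
  move: (cos (psi 0)) (sin (psi 0)) => c' d' e'.
  transitivity ((x ^+ 2 + y ^+ 2) / z ^+ 2); last by rewrite -e mulfV // expf_neq0 // gt_eqF.
  by rewrite !expr_div_n -mulrDl; congr (_ / _); ring: e'.
exists (fun s => psi s + c); split.
  by move=> s; have d4 := dpsi s; derive; rewrite addr0.
move=> s; exists (D s) => //.
have h1 : u s = D s * cos (psi s + c).
  rewrite cosD -ec -es -(cE1 s) -(cE2 s) /E1 /E2.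
  have := cos2sin2 (psi s); move: (D0 s); move: (D s) (u s) (v s) => z x y z0.
  move: (cos (psi s)) (sin (psi s)) => c' d' e'.
  by field: e'; rewrite gt_eqF.
have h2 : v s = D s * sin (psi s + c).
  rewrite sinD -ec -es -(cE1 s) -(cE2 s) /E1 /E2.
  have := cos2sin2 (psi s); move: (D0 s); move: (D s) (u s) (v s) => z x y z0.
  move: (cos (psi s)) (sin (psi s)) => c' d' e'.
  by field: e'; rewrite gt_eqF.
by rewrite -h1 -h2 /u /v /alpha; congr (_, _); ring.
Qed.

(** For [p] inside the circle the position relative to [p] eventually turns
    at a speed bounded away from zero, because [xi2] is close to [- R0] and
    [|p| < R0]. *)
Lemma asymptotic_winding p : disk R0 p -> (forall s, alpha al s <> p) -> infinite_winding al p.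
Proof.
move=> dp off; have [psi [dpsi lift]] := polar_lift off.
pose m := (R0 - Num.sqrt (p.1 ^+ 2 + p.2 ^+ 2)) / 2.
have pn0 : 0 <= p.1 ^+ 2 + p.2 ^+ 2 by rewrite addr_ge0 ?sqr_ge0.
have m0 : 0 < m.
  rewrite divr_gt0 // subr_gt0 -[ltRHS]ger0_norm ?ltW // -sqrtr_sqr ltr_sqrt //.
  by rewrite exprn_gt0.
pose M := 4 * R0 ^+ 2 + 2.
have M0 : 0 < M by rewrite addr_gt0 // mulr_gt0 // exprn_gt0.
have speed : at_ends (fun s => ((px al s - p.1) * sin (pth al s)
     - (py al s - p.2) * cos (pth al s)) /
    ((px al s - p.1) ^+ 2 + (py al s - p.2) ^+ 2) <= - (m / M)).
  apply: at_ends_impl (at_ends_and (rad_lim ltr01) (xi2_lim m0)) => s [].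
  rewrite !ltr_norml => /andP[_ h1] /andP[_ h2].
  set N := _ - _; set d := _ + _.
  have dM : d <= M.
    have q1 := sqr_ge0 (px al s + p.1); have q2 := sqr_ge0 (py al s + p.2).
    move: dp h1; rewrite /disk /= /d /M /rad.
    move: (px al s) (py al s) p.1 p.2 (R0 ^+ 2) q1 q2 => x y p1 p2 z q1 q2 e1 e2; nra.
  have d0 : 0 < d.
    rewrite /d lt_def addr_ge0 ?sqr_ge0 // andbT; apply/negP.
    rewrite paddr_eq0 ?sqr_ge0 // !sqrf_eq0 !subr_eq0 => /andP[/eqP k1 /eqP k2].
    by apply: (off s); rewrite /alpha k1 k2; case: (p).
  have Nm : N <= - m.
    have -> : N = xi2 al s - (p.1 * sin (pth al s) - p.2 * cos (pth al s)).
      by rewrite /N /xi2; ring.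
    have : - (p.1 * sin (pth al s) - p.2 * cos (pth al s)) <= Num.sqrt (p.1 ^+ 2 + p.2 ^+ 2).
      apply: (le_trans (ler_norm _)); rewrite normrN -sqrtr_sqr ler_sqrt //.
      have := cos2Dsin2 (pth al s); have := sqr_ge0 (p.1 * cos (pth al s) + p.2 * sin (pth al s)).
      move: (cos _) (sin _) p.1 p.2 => c z p1 p2 q1 q2.
      rewrite -subr_ge0 (_ : _ - _ = (p1 * c + p2 * z) ^+ 2 + (p1 ^+ 2 + p2 ^+ 2) * (1 - (c ^+ 2 + z ^+ 2))); last by ring.
      by rewrite q2 subrr mulr0 addr0.
    by rewrite /m in h2 *; lra.
  rewrite ler_pdivrMr // mulNr lerNr; apply: (@le_trans _ _ m).
    by rewrite mulrAC ler_pdivrMr // ler_pM2l.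
  by rewrite lerNr.
have [l1 l2] := descent (divr_gt0 m0 M0) dpsi speed.
exists psi; split => //; last by right.
by apply: der_cts => s; exact: dpsi.
Qed.

(** A point of the disk off the curve is needed: on the circle of radius
    [sqrt r0] the curve has at most two points. *)
Lemma asymptotic_exceptional (r0 s1 s2 : R) : 0 < r0 < R0 ^+ 2 ->
  (forall s, rad al s = r0 -> s = s1 \/ s = s2) -> exceptional w al.
Proof.
move=> /andP[r00 r0R] two; split; first exact: asymptotic_not_proper.
exists R0; split => //; first exact: asymptotic_limit_cycle.
  have z2 : Num.sqrt r0 ^+ 2 = r0 by rewrite sqr_sqrtr // ltW.
  have z0 : 0 < Num.sqrt r0 by rewrite sqrtr_gt0.
  set z := Num.sqrt r0 in z2 z0.
  apply: contrapT => no.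
  have hit x y : x ^+ 2 + y ^+ 2 = r0 -> exists2 s, alpha al s = (x, y) & s = s1 \/ s = s2.
    move=> e; apply: contrapT => off; apply: no; exists (x, y); split.
      by rewrite /disk /= e.
    move=> [s _ es]; apply: off; exists s => //; apply: two.
    by case: es => e1 e2; rewrite /rad e1 e2.
  have [|s es h] := hit z 0; first by rewrite z2 expr0n /= addr0.
  have [|s' es' h'] := hit (- z) 0; first by rewrite sqrrN z2 expr0n /= addr0.
  have [|s'' es'' h''] := hit 0 z; first by rewrite z2 expr0n /= add0r.
  have n1 : s <> s' by move=> k; move: es; rewrite k es' => /(congr1 fst) /=; lra.
  have n2 : s <> s'' by move=> k; move: es; rewrite k es'' => /(congr1 fst) /=; lra.
  have n3 : s' <> s'' by move=> k; move: es'; rewrite k es'' => /(congr1 fst) /=; lra.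
  by case: h => k; case: h' => k'; case: h'' => k''; move: n1 n2 n3; rewrite k k' k''.
move=> p [dp off]; apply: asymptotic_winding => // s es; apply: off; by exists s.
Qed.

End asymptotics.
End exceptional.

(** * Spirals and cylinders *)
Section spirals.
Context {R : realType}.
Implicit Types (a C w s t r x e d : R) (al be : profile R).

(** On the level set a point is determined by its squared norm and the sign of
    its first coordinate. *)
Lemma level_hit a C w (G G1 V : R -> R) (p : R * R) u : rolling a C w G G1 V ->
  (forall u, [/\ G (- u) = G u, G1 (- u) = - G1 u & V (- u) = V u]) ->
  Glevel a C w p -> G u = p.1 ^+ 2 + p.2 ^+ 2 ->
  exists u0, p = (G1 u0 * V u0 / 2, rho2 a C w (G u0)).
Proof.
move=> [_ [_ G0 GV2]] ev lp eu.
have [_ hp] := level_rad_speed2 lp; have /Glevel_iff e2 := lp.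
rewrite -eu -GV2 sqrtr_sqr in hp; rewrite -eu in e2.
have [E1 E2 E3] := ev u.
have : p.1 ^+ 2 = (G1 u * V u / 2) ^+ 2.
  by rewrite -(real_normK (num_real p.1)) hp exprMn real_normK ?num_real // -exprMn.
move/eqP; rewrite eqf_sqr => /orP[/eqP h|/eqP h].
  by exists u; rewrite -h -e2; case: (p).
by exists (- u); rewrite E1 E2 E3 mulNr mulNr -h -e2; case: (p).
Qed.

Section spiral.
Variables (a C w e d : R) (K dK : R -> R).
Hypothesis e0 : 0 <= e.
Hypothesis d0 : 0 < d.
Hypothesis ed : e != d.
Hypothesis dK1 : forall r : R, is_derive r 1 K (dK r).
Hypothesis QK : forall r, rad_speed2 a C w r = (r - e) * (d - r) ^+ 2 * K r.
Hypothesis K0 : forall t, 0 <= t < 1 -> 0 < (d - e) * K (e + (d - e) * t).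
Hypothesis Pd : Pquad a C d < 0.

Notation G := (spiralG e d).
Notation G1 := (spiralG1 e d).
Notation V := (spiralV e d K).

Let rollS : rolling a C w G G1 V.
Proof. by apply: spiral_rolling => //; exact: ltW. Qed.

Lemma thN u : th (- u) = - th u :> R.
Proof.
rewrite /th mulrN expRN; have E := @expR_gt0 R (2 * u).
move: (expR (2 * u)) E => z z0.
by field; rewrite !gt_eqF ?addr_gt0.
Qed.

Lemma spiral_even u : [/\ G (- u) = G u, G1 (- u) = - G1 u & V (- u) = V u].
Proof.
have h : G (- u) = G u by rewrite /spiralG thN sqrrN.
split => //; first by rewrite /spiralG1 thN sqrrN; ring.
by rewrite /spiralV h.
Qed.

Lemma spiral_surj t : 0 <= t < 1 -> exists u, G u = e + (d - e) * t.
Proof.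
move=> /andP[t0 t1]; have [|u hu] := @th_surj R (Num.sqrt t).
  rewrite (@lt_le_trans _ _ 0) ?oppr_lt0 ?sqrtr_ge0 //= -[ltRHS]sqrtr1 ltr_sqrt //.
by exists u; rewrite /spiralG hu sqr_sqrtr.
Qed.

Lemma spiral_between u : exists2 t, 0 <= t < 1 & G u = e + (d - e) * t.
Proof. by exists (th u ^+ 2) => //; rewrite sqr_ge0 th_sq. Qed.

Lemma spiral_sled_below al : e < d -> rolls a C w G G1 V al -> sled_param a C w `[e, d[ al.
Proof.
move=> lt ro; apply: (sled_of_rolls rollS ro); last exact: spiral_even.
- move=> u; have [t /andP[t0 t1] ->] := spiral_between u; rewrite in_itv /=.
  by apply/andP; split; nra.
- move=> r; rewrite in_itv /= => /andP[r0 r1].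
  have [|u hu] := @spiral_surj ((r - e) / (d - e)).
    by rewrite divr_ge0 ?subr_ge0 ?(ltW lt) //= ltr_pdivrMr ?subr_gt0 // mul1r ltrD2r.
  by exists u; rewrite hu; field; rewrite subr_eq0 gt_eqF.
Qed.

Lemma spiral_sled_above al : d < e -> rolls a C w G G1 V al -> sled_param a C w `]d, e] al.
Proof.
move=> lt ro; apply: (sled_of_rolls rollS ro); last exact: spiral_even.
- move=> u; have [t /andP[t0 t1] ->] := spiral_between u; rewrite in_itv /=.
  by apply/andP; split; nra.
- move=> r; rewrite in_itv /= => /andP[r0 r1].
  have [|u hu] := @spiral_surj ((e - r) / (e - d)).
    by rewrite divr_ge0 ?subr_ge0 ?(ltW lt) //= ltr_pdivrMr ?subr_gt0 // mul1r ltrD2l ltrN2.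
  by exists u; rewrite hu; field; rewrite subr_eq0 gt_eqF.
Qed.

(** From the inequality [1 + x <= exp x]; only a rate tending to [0] matters. *)
Lemma th_lim u : 1 - th u ^+ 2 <= 4 / (1 + 2 * `|u|) :> R.
Proof.
have main x : 0 <= x -> 1 - th x ^+ 2 <= 4 / (1 + 2 * x) :> R.
  move=> x0; have E : 1 + 2 * x <= expR (2 * x) by exact: expR_ge1Dx.
  have x1 : 0 < 1 + 2 * x by rewrite ltr_pwDl // mulr_ge0.
  rewrite /th; move: (expR _) E => z E; have z0 := lt_le_trans x1 E.
  have -> : 1 - (1 - 2 / (z + 1)) ^+ 2 = 4 * z / (z + 1) ^+ 2.
    by field; rewrite gt_eqF // addr_gt0.
  rewrite ler_pdivrMr ?exprn_gt0 ?addr_gt0 // mulrAC ler_pdivlMr //.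
  nra.
have [h|h] := leP 0 u; first by rewrite ger0_norm // main.
by rewrite ltr0_norm // -[th u]opprK -thN sqrrN main // oppr_ge0 ltW.
Qed.

Let QQd : rad_speed2 a C w d = 0. Proof. by rewrite QK subrr expr0n /= mulr0 mul0r. Qed.

Let rho2d : rho2 a C w d = - Num.sqrt d.
Proof.
have := rho2_sq a C w (ltW d0); rewrite QQd => h.
have h2 : rho2 a C w d ^+ 2 = Num.sqrt d ^+ 2 by rewrite sqr_sqrtr ?(ltW d0) //; lra.
have : rho2 a C w d < 0.
  by rewrite /rho2 pmulr_llt0 ?invr_gt0 ?Yq_gt0 // pmulr_llt0 // Sq_gt0 // ltW.
move/eqP: h2; rewrite eqf_sqr => /orP[/eqP ->|/eqP -> //].
by rewrite ltNge sqrtr_ge0.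
Qed.

Let kapd : xi1_speed a C w d = 0.
Proof.
have : 4 * xi1_speed a C w d = ((d - d) ^+ 2 - 2 * (d - e) * (d - d)) * K d
     + (d - e) * (d - d) ^+ 2 * dK d.
  apply: (der_uniq (der_rad_speed2 a C w d)).
  rewrite (_ : rad_speed2 a C w = fun r => (r - e) * (d - r) ^+ 2 * K r); last exact/funext.
  by have d1 := dK1 d; derive; ring.
rewrite subrr expr0n /= !mulr0 subrr !mul0r addr0 => /eqP.
by rewrite mulf_eq0 => /orP[|/eqP //]; rewrite pnatr_eq0.
Qed.

Let turnd : turn a C w d = - (Num.sqrt d)^-1.
Proof.
have := xi1_speed_turn a C w (ltW d0); rewrite kapd rho2d => h.
have s0 : Num.sqrt d != 0 by rewrite gt_eqF // sqrtr_gt0.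
apply: (mulIf s0); rewrite mulNr mulVf //; lra.
Qed.

(** At the double root [rad_speed2] and its derivative [4 xi1_speed] vanish; as
    [Pquad < 0] there, this gives the limits [- sqrt d] of [xi2] and
    [- 1 / sqrt d] of [pth'] along the curve. *)
Lemma spiral_exceptional al : represents a C w al -> rolls a C w G G1 V al ->
  exceptional w al.
Proof.
move=> rep ro; have [S [U [dS SU US dU et]]] := ro.
have radE s : rad al s = G (U s) := rad_at rollS (et s).
have Sinc x y : x < y -> S x < S y.
  move=> xy; have p z : x < z < y -> 0 < (V z)^-1.
    by move=> _; rewrite invr_gt0; have [[_ _ [M h]] _] := rollS; have /andP[] := h z.
  exact: (@der_homo_lt _ S (fun u => (V u)^-1) x y xy (fun z _ => dS z) p).
have Uinc x y : x < y -> U x < U y.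
  move=> xy; rewrite ltNge; apply/negP; rewrite le_eqVlt => /orP[/eqP h|/Sinc].
    by move: xy; rewrite -(US x) -(US y) h ltxx.
  by rewrite !US => /(lt_trans xy); rewrite ltxx.
have s2 : Num.sqrt d ^+ 2 = d by rewrite sqr_sqrtr // ltW.
have U_ends B : at_ends (fun s => B < `|U s|).
  pose b := `|B|; exists (Num.max `|S b| `|S (- b)|) => s; rewrite gt_max => /andP[h1 h2].
  apply: (le_lt_trans (ler_norm B)); rewrite -/b.
  have [s0|s0] := leP 0 s.
    rewrite (ger0_norm s0) in h1 h2; apply: (@lt_le_trans _ _ (U s)); last exact: ler_norm.
    by rewrite -(SU b); apply: Uinc; apply: le_lt_trans h1; exact: ler_norm.
  rewrite (ltr0_norm s0) in h1 h2; rewrite -normrN; apply: (@lt_le_trans _ _ (- U s)); last exact: ler_norm.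
  rewrite ltrNr -(SU (- b)); apply: Uinc; rewrite -ltrN2; apply: le_lt_trans h2.
  by rewrite -normrN; exact: ler_norm.
have rad_lim (m : R) : 0 < m -> at_ends (fun s => `|rad al s - d| < m).
  move=> m0; apply: at_ends_impl (U_ends (4 * `|d - e| / m)) => s h.
  rewrite radE distrC spiralG_d normrM (@ger0_norm _ (1 - _)); last by rewrite subr_ge0 ltW // th_sq.
  have u0 := normr_ge0 (U s).
  have u1 : 0 < 1 + 2 * `|U s| by rewrite ltr_pwDl // mulr_ge0.
  apply: (@le_lt_trans _ _ (`|d - e| * (4 / (1 + 2 * `|U s|)))); first by rewrite ler_wpM2l // th_lim.
  rewrite mulrA ltr_pdivrMr //.
  move: h; rewrite ltr_pdivrMr //; nra.
have comp_lim (f : R -> R) (l : R) : {for d, continuous f} -> f d = l -> forall m, 0 < m ->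
    at_ends (fun s => `|f (rad al s) - l| < m).
  move=> cf fd m m0; have /cvgrPdist_lt/(_ _ m0) := cf.
  move=> /nbhs_ballP[m' /= m'0 hm].
  apply: at_ends_impl (rad_lim _ m'0) => s h; rewrite distrC -fd; apply: hm.
  by rewrite /ball /= distrC.
have crho : {for d, continuous (rho2 a C w)} := der_continuous (der_rho2 a C w (ltW d0)).
have cturn : {for d, continuous (turn a C w)} := turn_continuous (ltW d0).
have /represents_iff rep' := rep.
(* a circle inside the limit circle that is met at most twice: outside the
   range of [r] if the curve spirals inwards, half way otherwise *)
have [r0 [v0 [v1 [r0d two]]]] : exists r0 s1 s2, 0 < r0 < d /\
    forall s, rad al s = r0 -> s = s1 \/ s = s2.
  have [lt|lt] := ltP d e.
    exists (d / 2), 0, 0; split; first by rewrite divr_gt0 //= ltr_pdivrMr // ltr_pMr // ltr1n.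
    move=> s; rewrite radE; have [t /andP[t0 t1] ->] := spiral_between (U s).
    have k : 0 <= (e - d) * (1 - t) by rewrite mulr_ge0 ?subr_ge0 ?ltW.
    rewrite (_ : e + _ = d + (e - d) * (1 - t)); last by ring.
    by move: d0 k; move: ((e - d) * (1 - t)) => z dp z0 h; exfalso; lra.
  have {}lt : e < d by rewrite lt_def eq_sym ed lt.
  have [|u0 hu] := @th_surj R (Num.sqrt 2^-1).
    rewrite (@lt_le_trans _ _ 0) ?oppr_lt0 ?sqrtr_ge0 //= -[ltRHS]sqrtr1 ltr_sqrt //.
    by rewrite invf_lt1 // ltr1n.
  exists ((e + d) / 2), (S u0), (S (- u0)); split; first by move: e0 d0 lt => h1 h2 h3; apply/andP; split; lra.
  move=> s; rewrite radE /spiralG => h.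
  have h2 : th (U s) ^+ 2 = th u0 ^+ 2.
    rewrite hu sqr_sqrtr ?invr_ge0 //; apply: (mulfI (x := d - e)); first by rewrite subr_eq0 gt_eqF.
    by apply: (addrI e); rewrite h; field.
  have th_inj : injective (@th R).
    have inc (x y : R) : x < y -> th x < th y.
      move=> xy; apply: (@der_homo_lt _ (@th R) (fun u => 1 - th u ^+ 2) x y xy (fun z _ => der_th z)).
      by move=> z _; rewrite subr_gt0 th_sq.
    by move=> x y hxy; apply/eqP; case: ltgtP => // /inc; rewrite hxy ltxx.
  move/eqP: h2; rewrite eqf_sqr -thN => /orP[/eqP/th_inj k|/eqP/th_inj k].
    by left; rewrite -k US.
  by right; rewrite -k US.
apply: (@asymptotic_exceptional _ w al (Num.sqrt d) _ _ _ _ _ r0 v0 v1).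
- by rewrite sqrtr_gt0.
- by rewrite s2.
- move=> m m0; have := comp_lim _ _ crho rho2d m m0; apply: at_ends_impl => s.
  by have [-> _] := rep' s; rewrite opprK.
- move=> m m0; have := comp_lim _ _ cturn turnd m m0; apply: at_ends_impl => s.
  by have [_ ->] := rep' s; rewrite opprK.
- move=> s; rewrite s2 radE eq_sym -subr_eq0 spiralG_d mulf_neq0 ?subr_eq0 1?eq_sym //.
  by rewrite lt_eqF // th_sq.
- by rewrite s2.
- exact: two.
Qed.

End spiral.

Lemma circle_exists a C w r : 0 <= r -> rad_speed2 a C w r = 0 -> xi1_speed a C w r = 0 ->
  exists2 al, represents a C w al & forall s, treadmill al s = (0, rho2 a C w r).
Proof.
move=> r0 Q k.
have [||||al rep e] := @profile_of_radial R a C w (fun=> r) (fun=> 0).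
- by move=> s; rewrite mulr0; exact: der_cst.
- by move=> s; rewrite k; exact: der_cst.
- by [].
- by move=> s; have := rho2_sq a C w r0; rewrite Q expr0n /=; lra.
- by exists al.
Qed.

(** The curve turns at the constant speed [1 / rho2], so it is a circle centred
    on the axis, run through periodically. *)
Lemma circle_surface a C w r al : 0 < r -> xi1_speed a C w r = 0 -> rad_speed2 a C w r = 0 ->
  represents a C w al -> (forall s, treadmill al s = (0, rho2 a C w r)) ->
  surface w al = cylinder (Num.sqrt r) /\ properly_immersed w al.
Proof.
move=> r0 k Q /represents_iff rep e.
have x1 s : xi1 al s = 0 by have [] := e s.
have x2 s : xi2 al s = rho2 a C w r by have [] := e s.
have rr : rho2 a C w r ^+ 2 = r by have := rho2_sq a C w (ltW r0); rewrite Q; lra.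
have radE s : rad al s = r by rewrite -xi_rad x1 x2 rr expr0n add0r.
have q0 : rho2 a C w r != 0 by rewrite -sqrf_eq0 rr gt_eqF.
have t1 : turn a C w r = (rho2 a C w r)^-1.
  have := xi1_speed_turn a C w (ltW r0); rewrite k => h; apply: (mulIf q0); rewrite mulVf //; lra.
have [q eq] : exists q, q = rho2 a C w r by eexists.
rewrite -eq in rr q0 t1 x2.
have pthE s : pth al s = pth al 0 + s / q.
  have D (z : R) : is_derive z 1 (fun s => pth al s - s / q) 0.
    have d1 := der_pth al z; have [_ h] := rep z; rewrite h radE t1 in d1.
    by derive; ring.
  have := @is_derive_0_is_cst R _ s 0 D; rewrite mul0r subr0 => <-; ring.
have pxE s : px al s = q * sin (pth al s) by rewrite px_xi x1 x2 mul0r add0r.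
have pyE s : py al s = - q * cos (pth al s) by rewrite py_xi x1 x2 mul0r sub0r mulNr.
split.
  apply/seteqP; split => v /=.
    by move=> [s [t ->]]; rewrite /cylinder /= axis_dist_sqrt radE.
  move=> hv; set X := v 0 (inord 0); set Y := v 0 (inord 1); set z := v 0 (inord 2).
  have XY : X ^+ 2 + Y ^+ 2 = r.
    have := congr1 (fun x => x ^+ 2) hv; rewrite /axis_dist !sqr_sqrtr ?addr_ge0 ?sqr_ge0 ?ltW //.
  have [g [g1 g2]] : exists g, - Y / q = cos g /\ X / q = sin g.
    apply: unit_angle; rewrite !expr_div_n sqrrN -mulrDl addrC XY rr mulfV // gt_eqF //.
  exists (q * (g + w * z - pth al 0)), z.
  have et : pth al (q * (g + w * z - pth al 0)) = g + w * z.
    by rewrite pthE; field.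
  rewrite /phi pxE pyE et cosD sinD.
  have eX : X = q * sin g by rewrite -g2; field.
  have eY : Y = - q * cos g by rewrite -g1; field.
  have := cos2sin2 (w * z); move: (cos (w * z)) (sin (w * z)) => c d h.
  apply: row3P; rewrite !vec3E -/X -/Y -/z ?eX ?eY //; ring: h.
apply: (@proper_of_period _ w al (`|q| * (pi *+ 2))).
  by rewrite mulr_gt0 ?normr_gt0 // pi2_gt0.
move=> u; rewrite /alpha !pxE !pyE.
have [j ej] : exists j : int, pth al (u + `|q| * (pi *+ 2)) = pth al u + j%:~R * (pi *+ 2).
  have [h|h] := leP 0 q.
    by exists 1; rewrite (pthE (_ + _)) (pthE u) ger0_norm //; field.
  by exists (-1); rewrite (pthE (_ + _)) (pthE u) ltr0_norm //; field.
by rewrite ej sinDint cosDint.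
Qed.

End spirals.

(** * The roots of the quartic *)
Section roots.
Context {R : realType}.
Implicit Types (a C r x y z b p c : R).

(** The value of [G] at [(0, x)], and its derivative. *)
Definition Gaxis a x : R := 2 * x + x ^+ 2 - a / 4 * x ^+ 4.
Definition Gaxis' a x : R := 2 + 2 * x - a * x ^+ 3.

Lemma der_Gaxis a (x : R) : is_derive x 1 (Gaxis a) (Gaxis' a x).
Proof. by rewrite /Gaxis /Gaxis'; derive; rewrite /=; field. Qed.

Lemma Gaxis_inc a x y : x < y -> (forall z, x < z < y -> 0 < Gaxis' a z) -> Gaxis a x < Gaxis a y.
Proof. by move=> xy h; exact: (@der_homo_lt _ (Gaxis a) (Gaxis' a) x y xy (fun z _ => der_Gaxis a z) h). Qed.

Lemma Gaxis_dec a x y : x < y -> (forall z, x < z < y -> Gaxis' a z < 0) -> Gaxis a y < Gaxis a x.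
Proof.
move=> xy h; rewrite -ltrN2.
have d (z : R) : is_derive z 1 (fun x => - Gaxis a x) (- Gaxis' a z).
  by have d1 := der_Gaxis a z; derive.
apply: (@der_homo_lt _ (fun x => - Gaxis a x) (fun x => - Gaxis' a x) x y xy (fun z _ => d z)).
by move=> z /h; rewrite oppr_gt0.
Qed.

Lemma Gaxis_ivt a C x y : x <= y -> (Gaxis a x <= C <= Gaxis a y \/ Gaxis a y <= C <= Gaxis a x) ->
  exists2 z, x <= z <= y & Gaxis a z = C.
Proof.
move=> xy h; have [|z] := @IVT R (Gaxis a) x y C xy (cts_within (der_cts (der_Gaxis a))).
  by case: h => /andP[h1 h2]; rewrite ge_min le_max ?h1 ?h2 ?orbT.
by rewrite in_itv /= => zi e; exists z.
Qed.

Lemma Gaxis_large a C : a < 0 -> exists2 M, 1 <= M & forall x, M <= `|x| -> C < Gaxis a x.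
Proof.
move=> a0; exists (1 + `|C| + 8 / - a); first by rewrite -addrA lerDl addr_ge0 // divr_ge0 // oppr_ge0 ltW.
move=> x hx; have na : 0 < - a by rewrite oppr_gt0.
have n0 : 0 <= 8 / - a by rewrite divr_ge0 // ltW.
have C0 := normr_ge0 C.
have x1 : 1 <= `|x| by lra.
have xC : `|C| + 1 <= `|x| by lra.
have xa : 8 / - a <= `|x| by lra.
have e2 : `|x| ^+ 2 = x ^+ 2 by rewrite real_normK ?num_real.
have e : Gaxis a x = 2 * x + `|x| ^+ 2 + (- a) / 4 * (`|x| ^+ 2) ^+ 2.
  by rewrite /Gaxis e2; field.
rewrite e; have k1 : - `|x| <= x by rewrite lerNnormlW.
move: k1 x1 xC xa; move: (`|x|) => y k1 x1 xC xa.
have k2 : 8 <= y * - a by rewrite -ler_pdivrMr.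
have k3 : 2 * y ^+ 3 <= - a / 4 * (y ^+ 2) ^+ 2.
  rewrite (_ : - a / 4 * _ = (y * - a) * y ^+ 3 / 4); last by field.
  rewrite ler_pdivlMr // mulrAC (_ : 2 * 4 = 8); last by ring.
  by rewrite ler_pM2r // exprn_gt0 // (lt_le_trans _ x1).
have k4 : y <= y ^+ 3 by rewrite -{1}(expr1 y) ler_weXn2l.
have k5 : y <= y ^+ 2 by rewrite -{1}(expr1 y) ler_weXn2l.
by have := ler_norm C; lra.
Qed.

Lemma Gaxis_small a C : 0 < a -> exists2 M, 1 <= M & forall x, M <= `|x| -> Gaxis a x < C.
Proof.
move=> a0; exists (1 + `|C| + 24 / a); first by rewrite -addrA lerDl addr_ge0 // divr_ge0 // ltW.
move=> x hx.
have n0 : 0 <= 24 / a by rewrite divr_ge0 // ltW.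
have C0 := normr_ge0 C.
have x1 : 1 <= `|x| by lra.
have xC : `|C| + 1 <= `|x| by lra.
have xa : 24 / a <= `|x| by lra.
have e2 : `|x| ^+ 2 = x ^+ 2 by rewrite real_normK ?num_real.
have e : Gaxis a x = 2 * x + `|x| ^+ 2 - a / 4 * (`|x| ^+ 2) ^+ 2.
  by rewrite /Gaxis e2; field.
rewrite e; have k1 : x <= `|x| by exact: ler_norm.
move: k1 x1 xC xa; move: (`|x|) => y k1 x1 xC xa.
have k2 : 24 <= y * a by rewrite -ler_pdivrMr.
have k3 : 6 * y ^+ 3 <= a / 4 * (y ^+ 2) ^+ 2.
  rewrite (_ : a / 4 * _ = (y * a) * y ^+ 3 / 4); last by field.
  rewrite ler_pdivlMr // mulrAC (_ : 6 * 4 = 24); last by ring.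
  by rewrite ler_pM2r // exprn_gt0 // (lt_le_trans _ x1).
have k4 : y <= y ^+ 3 by rewrite -{1}(expr1 y) ler_weXn2l.
have k5 : y ^+ 2 <= y ^+ 3 by rewrite ler_weXn2l.
have := ler_norm (- C); rewrite normrN; lra.
Qed.

(** Vieta relations of the splitting of [Gaxis a x - C] into
    [- (a / 4) * (x ^ 2 - b x + p) * (x ^ 2 + b x + c)]. *)
Definition vieta a C b p c : Prop :=
  [/\ a * (b ^+ 2 - c - p) = 4, a * b * (c - p) = 8 & a * p * c = 4 * C].

(** A splitting of [Gaxis a x - C] into two quadratics in [x] yields one of
    the quartic in [r], because each of the factors in [r = x ^ 2] is the
    product of a quadratic at [x] and at [- x]. *)
Lemma vieta_q a C b p c r : vieta a C b p c ->
  64 * r - Pquad a C r ^+ 2 = - a ^+ 2 * ((r + p) ^+ 2 - b ^+ 2 * r) * ((r + c) ^+ 2 - b ^+ 2 * r).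
Proof.
move=> [e1 e2 e3].
have -> : Pquad a C r = a * p * c - a * (b ^+ 2 - c - p) * r + a * r ^+ 2 by rewrite e1 e3 /Pquad; ring.
have -> : 64 * r = (a * b * (c - p)) ^+ 2 * r by rewrite e2; ring.
ring.
Qed.

Lemma vieta_Gaxis a C b p c x : vieta a C b p c ->
  Gaxis a x - C = - (a / 4) * (x ^+ 2 - b * x + p) * (x ^+ 2 + b * x + c).
Proof.
move=> [e1 e2 e3]; transitivity (a * b * (c - p) * x / 4
    + a * (b ^+ 2 - c - p) * x ^+ 2 / 4 - a / 4 * x ^+ 4 - a * p * c / 4).
  by rewrite e1 e2 e3 /Gaxis; field.
by field.
Qed.

(** Two roots [x1], [x2] determine the other quadratic: as there is no cubic
    term, its linear coefficient is [x1 + x2]. *)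
Lemma vieta_roots a C x1 x2 : a != 0 -> x1 != x2 -> Gaxis a x1 = C -> Gaxis a x2 = C ->
  vieta a C (x1 + x2) (x1 * x2) ((x1 + x2) ^+ 2 - x1 * x2 - 4 / a).
Proof.
move=> a0 x12 g1 g2.
have E : 8 + 4 * (x1 + x2) - a * (x1 + x2) * (x1 ^+ 2 + x2 ^+ 2) = 0.
  apply: (mulfI (x := x1 - x2)); first by rewrite subr_eq0.
  rewrite mulr0; transitivity (4 * (Gaxis a x1 - Gaxis a x2)); first by rewrite /Gaxis; field.
  by rewrite g1 g2 subrr mulr0.
split; first by field.
  transitivity (8 - (8 + 4 * (x1 + x2) - a * (x1 + x2) * (x1 ^+ 2 + x2 ^+ 2))); first by field.
  by rewrite E subr0.
rewrite -g1 /Gaxis.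
transitivity (4 * (2 * x1 + x1 ^+ 2 - a / 4 * x1 ^+ 4)
   - x1 * (8 + 4 * (x1 + x2) - a * (x1 + x2) * (x1 ^+ 2 + x2 ^+ 2))); first by field.
by rewrite E mulr0 subr0.
Qed.

Lemma vieta_double a x : a != 0 -> Gaxis' a x = 0 ->
  vieta a (Gaxis a x) (2 * x) (x ^+ 2) (3 * x ^+ 2 - 4 / a).
Proof.
move=> a0; rewrite /Gaxis' => E; split; first by field.
  transitivity (8 - 4 * (2 + 2 * x - a * x ^+ 3)); first by field.
  by rewrite E mulr0 subr0.
rewrite /Gaxis; transitivity (4 * (2 * x + x ^+ 2 - a / 4 * x ^+ 4)
   - 4 * x * (2 + 2 * x - a * x ^+ 3)); first by field.
by rewrite E mulr0 subr0.
Qed.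

Lemma quad_sq_gt0 b c r : 0 <= r -> (forall x, 0 < x ^+ 2 + b * x + c) ->
  0 < (r + c) ^+ 2 - b ^+ 2 * r.
Proof.
move=> r0 h; rewrite -(sqr_sqrtr r0); set t := Num.sqrt r.
rewrite (_ : _ - _ = (t ^+ 2 + b * t + c) * ((- t) ^+ 2 + b * (- t) + c)); last by ring.
by rewrite mulr_gt0.
Qed.

Definition two_simple a C : Prop := exists r1 r2 (k dk : R -> R),
  [/\ 0 <= r1 < r2, forall r : R, is_derive r 1 k (dk r),
      forall r, 64 * r - Pquad a C r ^+ 2 = (r - r1) * (r2 - r) * k r
    & forall r, 0 <= r -> 0 < k r].

Lemma two_simple_of_roots a C x1 x2 : a != 0 -> x1 != x2 -> Gaxis a x1 = C -> Gaxis a x2 = C ->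
  (forall x, 0 < x ^+ 2 + (x1 + x2) * x + ((x1 + x2) ^+ 2 - x1 * x2 - 4 / a)) ->
  two_simple a C.
Proof.
move=> a0 x12 g1 g2; have V := vieta_roots a0 x12 g1 g2.
have Q r := vieta_q r V; have [_ V2 _] := V.
move: V2 Q; set b := x1 + x2; set c := b ^+ 2 - x1 * x2 - 4 / a => V2 Q qp.
have b0 : b != 0 by apply/eqP => h; move: V2; rewrite h mulr0 mul0r => /esym/eqP; rewrite pnatr_eq0.
pose k r := a ^+ 2 * ((r + c) ^+ 2 - b ^+ 2 * r).
have kp r : 0 <= r -> 0 < k r.
  move=> r0; rewrite /k; apply: mulr_gt0; first by rewrite exprn_even_gt0.
  exact: quad_sq_gt0.
have dk (r : R) : is_derive r 1 k (a ^+ 2 * (2 * (r + c) - b ^+ 2)).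
  by rewrite /k; derive; ring.
have sq r : (r + x1 * x2) ^+ 2 - b ^+ 2 * r = (r - x1 ^+ 2) * (r - x2 ^+ 2) by rewrite /b; ring.
have [h|h|h] := ltgtP (x1 ^+ 2) (x2 ^+ 2).
- exists (x1 ^+ 2), (x2 ^+ 2), k, (fun r => a ^+ 2 * (2 * (r + c) - b ^+ 2)).
  split => //; first by rewrite sqr_ge0.
  by move=> r; rewrite Q sq /k; ring.
- exists (x2 ^+ 2), (x1 ^+ 2), k, (fun r => a ^+ 2 * (2 * (r + c) - b ^+ 2)).
  split => //; first by rewrite sqr_ge0.
  by move=> r; rewrite Q sq /k; ring.
- exfalso; move/eqP: h; rewrite -subr_eq0 subr_sqr mulf_eq0 subr_eq0 (negbTE x12) /=.
  by rewrite -/b (negbTE b0).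
Qed.

(** For [a < 0] the complementary quadratic has a negative discriminant. *)
Lemma two_simple_neg a C x0 : a < 0 -> Gaxis a x0 < C -> two_simple a C.
Proof.
move=> a0 h; have [M M1 hM] := Gaxis_large C a0.
have an : a != 0 by rewrite lt_eqF.
have x0M : `|x0| < M by rewrite ltNge; apply/negP => /hM /(lt_trans h); rewrite ltxx.
move: x0M; rewrite ltr_norml => /andP[m1 m2].
have [|x1 /andP[_ x1x] g1] := @Gaxis_ivt a C (- M) x0 (ltW m1).
  by right; rewrite (ltW h) /= ltW // hM // normrN ger0_norm // (le_trans ler01).
have [|x2 /andP[xx2 _] g2] := @Gaxis_ivt a C x0 M (ltW m2).
  by left; rewrite (ltW h) /= ltW // hM // ger0_norm // (le_trans ler01).
have n1 : x1 != x0 by apply/eqP => e; move: h; rewrite -g1 e ltxx.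
have n2 : x2 != x0 by apply/eqP => e; move: h; rewrite -g2 e ltxx.
have x12 : x1 < x2 by rewrite (@lt_le_trans _ _ x0) // lt_def x1x eq_sym n1.
apply: (@two_simple_of_roots a C x1 x2) => //; first by rewrite lt_eqF.
move=> x; have na : 0 < - (4 / a) by rewrite oppr_gt0 pmulr_rlt0 // invr_lt0.
move: (4 / a) na => u na.
rewrite (_ : _ + _ = (x + (x1 + x2) / 2) ^+ 2 + (2 * (x1 + x2) ^+ 2 + (x1 - x2) ^+ 2) / 4 - u); last by field.
apply: ltr_wpDl => //.
have := sqr_ge0 (x1 + x2); have := sqr_ge0 (x1 - x2).
by move=> k1 k2; rewrite addr_ge0 ?sqr_ge0 //; lra.
Qed.

(** At a solution [x] of [Gaxis a x = C] the quartic [64 r - Pquad ^ 2] vanishes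
    for [r = x ^ 2]. *)
Lemma Pquad_Gaxis a x : Pquad a (Gaxis a x) (x ^+ 2) = 8 * x.
Proof. by rewrite /Pquad /Gaxis; field. Qed.

Lemma Gaxis_crit a x : a * x ^+ 3 = 2 + 2 * x -> Gaxis a x = x * (x + 3) / 2.
Proof.
move=> h; rewrite /Gaxis (_ : a / 4 * x ^+ 4 = (a * x ^+ 3) * x / 4); last by field.
by rewrite h; field.
Qed.

(** A root of the complementary quadratic is a root of [Gaxis a x = C], hence
    [x1] or [x2] by uniqueness on each side of [c]; it would be a double root,
    against the hypotheses on the derivative. *)
Lemma two_simple_pos a C c : 0 < a -> C < Gaxis a c -> (forall z, c < z -> Gaxis' a z < 0) ->
  (forall z z', z < c -> z' < c -> Gaxis a z = C -> Gaxis a z' = C -> z = z') ->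
  (forall z, z < c -> Gaxis a z = C -> Gaxis' a z != 0) -> two_simple a C.
Proof.
move=> a0 h dec uni sim; have [M M1 hM] := Gaxis_small C a0.
have an : a != 0 by rewrite gt_eqF.
have cM : `|c| < M by rewrite ltNge; apply/negP => /hM /(lt_trans h); rewrite ltxx.
move: cM; rewrite ltr_norml => /andP[m1 m2].
have [|x1 /andP[_ x1c] g1] := @Gaxis_ivt a C (- M) c (ltW m1).
  by left; rewrite (ltW h) andbT ltW // hM // normrN ger0_norm // (le_trans ler01).
have [|x2 /andP[cx2 _] g2] := @Gaxis_ivt a C c M (ltW m2).
  by right; rewrite (ltW h) andbT ltW // hM // ger0_norm // (le_trans ler01).
have n1 : x1 < c by rewrite lt_def x1c andbT; apply/eqP => e; move: h; rewrite -g1 -e ltxx.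
have n2 : c < x2 by rewrite lt_def cx2 andbT; apply/eqP => e; move: h; rewrite -g2 -e ltxx.
have x12 : x1 < x2 by exact: lt_trans n2.
have x12n : x1 != x2 by rewrite lt_eqF.
have uniR z z' : c < z -> c < z' -> Gaxis a z = C -> Gaxis a z' = C -> z = z'.
  move=> cz cz' gz gz'; apply/eqP; case: ltgtP => // zz; exfalso.
    have : Gaxis a z' < Gaxis a z by apply: Gaxis_dec => // y /andP[y1 _]; apply: dec; exact: lt_trans y1.
    by rewrite gz gz' ltxx.
  have : Gaxis a z < Gaxis a z' by apply: Gaxis_dec => // y /andP[y1 _]; apply: dec; exact: lt_trans y1.
  by rewrite gz gz' ltxx.
have V := vieta_roots an x12n g1 g2.
apply: (@two_simple_of_roots a C x1 x2) => // x; move: V.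
set b := x1 + x2; set d := b ^+ 2 - x1 * x2 - 4 / a => V.
rewrite ltNge; apply/negP => qx.
have disc : 0 <= b ^+ 2 / 4 - d.
  have := sqr_ge0 (x + b / 2); rewrite -subr_ge0 in qx.
  rewrite (_ : b ^+ 2 / 4 - d = (x + b / 2) ^+ 2 + (0 - (x ^+ 2 + b * x + d))); last by field.
  by move=> k; rewrite addr_ge0.
pose y := - (b / 2) + Num.sqrt (b ^+ 2 / 4 - d).
have qy : y ^+ 2 + b * y + d = 0.
  rewrite /y; have := sqr_sqrtr disc; move: (Num.sqrt _) => s es.
  rewrite (_ : _ + d = s ^+ 2 - (b ^+ 2 / 4 - d)); last by field.
  by rewrite es subrr.
have gy : Gaxis a y = C by apply/eqP; rewrite -subr_eq0 (vieta_Gaxis y V) qy mulr0.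
have gp0 : y ^+ 2 - b * y + x1 * x2 = 0 -> Gaxis' a y = 0.
  move=> py; apply: (der_uniq (der_Gaxis a y)).
  rewrite (_ : Gaxis a = fun x => - (a / 4) * (x ^+ 2 - b * x + x1 * x2) * (x ^+ 2 + b * x + d) + C).
    by derive; rewrite /= qy py !(mulr0, mul0r, addr0).
  by apply/funext => z; rewrite -(vieta_Gaxis z V) subrK.
have yc : y != c by apply/eqP => e; move: h; rewrite -e gy ltxx.
have [yc'|yc'] := ltP y c.
  have e : y = x1 by exact: uni.
  by have := sim y yc' gy; rewrite gp0 ?eqxx // e /b; ring.
have {}yc' : c < y by rewrite lt_def yc.
have e : y = x2 by exact: uniR.
by have := dec y yc'; rewrite gp0 ?ltxx // e /b; ring.
Qed.

(** The quartic is nonpositive and vanishes at [x ^ 2] only, so the level set is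
    a single point. *)
Definition one_double a C : Prop := exists x (k dk : R -> R),
  [/\ x != 0, C = Gaxis a x, forall r : R, is_derive r 1 k (dk r),
      forall r, 64 * r - Pquad a C r ^+ 2 = - (r - x ^+ 2) ^+ 2 * k r
    & forall r, 0 <= r -> 0 < k r].

Lemma one_double_of_crit a x : a != 0 -> x != 0 -> Gaxis' a x = 0 -> 4 / a < 2 * x ^+ 2 ->
  one_double a (Gaxis a x).
Proof.
move=> a0 x0 gx h; have V := vieta_double a0 gx.
pose c := 3 * x ^+ 2 - 4 / a.
exists x, (fun r => a ^+ 2 * ((r + c) ^+ 2 - (2 * x) ^+ 2 * r)),
   (fun r => a ^+ 2 * (2 * (r + c) - (2 * x) ^+ 2)); split => //.
- by move=> r; derive; ring.
- by move=> r; rewrite (vieta_q r V) -/c; ring.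
- move=> r r0; apply: mulr_gt0; first by rewrite exprn_even_gt0.
  apply: quad_sq_gt0 => // y; rewrite /c.
  rewrite (_ : _ + _ = (y + x) ^+ 2 + (2 * x ^+ 2 - 4 / a)); last by ring.
  by rewrite ltr_wpDl ?sqr_ge0 // subr_gt0.
Qed.

Definition four_simple a C : Prop := exists r1 r2 r3 r4 : R,
  [/\ 0 <= r1, r1 < r2, r2 < r3, r3 < r4 & forall r,
   64 * r - Pquad a C r ^+ 2 = - a ^+ 2 * ((r - r1) * (r - r2) * (r - r3) * (r - r4))].

(** The four roots [x1 < x2 < x3 < x4] in [x] have sum zero, and the signs of the
    sums of two of them order their squares: [x3 ^ 2 < x2 ^ 2 < x1 ^ 2 < x4 ^ 2]. *)
Lemma four_simple_of_values a C u v c : 0 < a -> u < v -> v < c ->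
  Gaxis a v < C -> C < Gaxis a u -> C < Gaxis a c -> four_simple a C.
Proof.
move=> a0 uv vc gv gu gc; have [M M1 hM] := Gaxis_small C a0.
have an : a != 0 by rewrite gt_eqF.
have bd z : C < Gaxis a z -> - M < z < M.
  move=> gz; rewrite -ltr_norml ltNge; apply/negP => /hM /(lt_trans gz); by rewrite ltxx.
have /andP[m1 _] := bd _ gu; have /andP[_ m2] := bd _ gc.
have lo : Gaxis a (- M) < C by apply: hM; rewrite normrN ger0_norm // (le_trans ler01).
have hi : Gaxis a M < C by apply: hM; rewrite ger0_norm // (le_trans ler01).
have [|x1 /andP[_ x1u] g1] := @Gaxis_ivt a C (- M) u (ltW m1); first by left; rewrite !ltW.
have [|x2 /andP[ux2 x2v] g2] := @Gaxis_ivt a C u v (ltW uv); first by right; rewrite !ltW.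
have [|x3 /andP[vx3 x3c] g3] := @Gaxis_ivt a C v c (ltW vc); first by left; rewrite !ltW.
have [|x4 /andP[cx4 _] g4] := @Gaxis_ivt a C c M (ltW m2); first by right; rewrite !ltW.
have ne z z' : Gaxis a z = C -> Gaxis a z' != C -> z' != z by move=> <-; apply: contra => /eqP ->.
have gu' : Gaxis a u != C by rewrite gt_eqF.
have gv' : Gaxis a v != C by rewrite lt_eqF.
have gc' : Gaxis a c != C by rewrite gt_eqF.
have x12 : x1 < x2 by rewrite (@lt_le_trans _ _ u) // lt_def x1u (ne _ _ g1 gu').
have x23 : x2 < x3 by rewrite (@lt_le_trans _ _ v) // lt_def x2v (ne _ _ g2 gv').
have x34 : x3 < x4 by rewrite (@lt_le_trans _ _ c) // lt_def x3c (ne _ _ g3 gc').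
have x14 : x1 < x4 by rewrite (lt_trans x12) // (lt_trans x23).
have x14n : x1 != x4 by rewrite lt_eqF.
have V := vieta_roots an x14n g1 g4.
move: V; set b := x1 + x4; set d := b ^+ 2 - x1 * x4 - 4 / a => V.
have quad0 y : Gaxis a y = C -> x1 < y < x4 -> y ^+ 2 + b * y + d = 0.
  move=> gy /andP[y1 y4]; have /eqP := vieta_Gaxis y V.
  rewrite gy subrr eq_sym !mulf_eq0 oppr_eq0 mulf_eq0 (negbTE an) invr_eq0 pnatr_eq0 /=.
  rewrite (_ : y ^+ 2 - b * y + x1 * x4 = (y - x1) * (y - x4)); last by rewrite /b; ring.
  by rewrite mulf_eq0 !subr_eq0 (gt_eqF y1) (lt_eqF y4) /= => /eqP.
have q2 := quad0 x2 g2 _; have q3 := quad0 x3 g3 _.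
have {}q2 : x2 ^+ 2 + b * x2 + d = 0 by apply: q2; rewrite x12 (lt_trans x23).
have {}q3 : x3 ^+ 2 + b * x3 + d = 0 by apply: q3; rewrite x34 (lt_trans x12).
have eb : b = - (x2 + x3).
  apply: (mulfI (x := x2 - x3)); first by rewrite subr_eq0 lt_eqF.
  have : (x2 ^+ 2 + b * x2 + d) - (x3 ^+ 2 + b * x3 + d) = 0 by rewrite q2 q3 subrr.
  move=> k; apply/eqP; rewrite -subr_eq0 -k; apply/eqP; ring.
have ed : d = x2 * x3.
  move: q2; rewrite eb => /eqP; rewrite addr_eq0 => /eqP k.
  by apply: oppr_inj; rewrite -k; ring.
have [_ V2 _] := V.
have s12 : x1 + x2 < 0 by rewrite /b in eb; lra.
have s13 : x1 + x3 < 0 by rewrite /b in eb; lra.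
have s14 : 0 < x1 + x4.
  have e : a * ((x1 + x4) * ((x1 + x2) * (x1 + x3))) = 8.
    rewrite -V2 ed -/b (_ : (x1 + x2) * (x1 + x3) = x2 * x3 - x1 * x4); first by ring.
    have -> : x4 = - (x1 + x2 + x3) by rewrite /b in eb; lra.
    ring.
  have : 0 < a * ((x1 + x4) * ((x1 + x2) * (x1 + x3))) by rewrite e.
  by rewrite pmulr_rgt0 // pmulr_lgt0 // nmulr_rgt0.
have s23 : x2 + x3 < 0 by rewrite /b in eb; lra.
exists (x3 ^+ 2), (x2 ^+ 2), (x1 ^+ 2), (x4 ^+ 2); split.
- exact: sqr_ge0.
- nra.
- nra.
- nra.
- move=> r; rewrite (vieta_q r V) ed eb.
  rewrite (_ : (r + x1 * x4) ^+ 2 - (- (x2 + x3)) ^+ 2 * r = (r - x1 ^+ 2) * (r - x4 ^+ 2)); first by ring.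
  by rewrite -eb /b; ring.
Qed.

(** At the critical point [- rho] of [Gaxis a] the other two roots are
    [rho + s] and [rho - s]. *)
Lemma double_split a rho : 1 < rho -> a * rho ^+ 3 = 2 * (rho - 1) ->
  exists s, [/\ 0 < s, s ^+ 2 * (rho - 1) = 2 * rho ^+ 2,
   Pquad a (Gaxis a (- rho)) (rho ^+ 2) = - (8 * rho) &
   forall r, 64 * r - Pquad a (Gaxis a (- rho)) r ^+ 2 =
     - a ^+ 2 * (r - rho ^+ 2) ^+ 2 * ((r - (rho - s) ^+ 2) * (r - (rho + s) ^+ 2))].
Proof.
move=> rho1 h; have rho0 : 0 < rho by exact: lt_trans rho1.
have r10 : 0 < rho - 1 by rewrite subr_gt0.
have a0 : 0 < a by rewrite -(pmulr_lgt0 _ (exprn_gt0 3 rho0)) h mulr_gt0.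
have an : a != 0 by rewrite gt_eqF.
have gx : Gaxis' a (- rho) = 0.
  rewrite /Gaxis' (_ : a * (- rho) ^+ 3 = - (a * rho ^+ 3)); last by ring.
  by rewrite h; ring.
have V := vieta_double an gx.
have pos : 0 < 2 * rho ^+ 2 / (rho - 1) by rewrite divr_gt0 // mulr_gt0 // exprn_gt0.
exists (Num.sqrt (2 * rho ^+ 2 / (rho - 1))).
have := sqr_sqrtr (ltW pos); have : 0 < Num.sqrt (2 * rho ^+ 2 / (rho - 1)) by rewrite sqrtr_gt0.
move: (Num.sqrt _) => s s0 es; split => //.
- by rewrite es divfK // gt_eqF.
- by rewrite -[rho ^+ 2]sqrrN Pquad_Gaxis mulrN.
- move=> r; rewrite (vieta_q r V).
  have -> : 4 / a = s ^+ 2 + 2 * rho ^+ 2.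
    rewrite es; have -> : a = 2 * (rho - 1) / rho ^+ 3 by rewrite -h mulfK // expf_neq0 // gt_eqF.
    by field; rewrite !gt_eqF.
  by ring.
Qed.

End roots.

(** * The critical values *)
Section params.
Context {R : realType}.
Implicit Types (a C w x y z : R).

Lemma hfunE a x : x != 0 -> (hfun x = a) <-> (a * x ^+ 3 = 2 * (x - 1)).
Proof.
move=> x0; have x3 : x ^+ 3 != 0 by rewrite expf_neq0.
by rewrite /hfun; split => [<-|<-]; [rewrite divfK|rewrite mulfK].
Qed.

Lemma cubic_ivt a x y : x <= y ->
  (a * x ^+ 3 - 2 * (x - 1)) * (a * y ^+ 3 - 2 * (y - 1)) <= 0 ->
  exists2 z, x <= z <= y & a * z ^+ 3 = 2 * (z - 1).
Proof.
move=> xy h; pose p z := a * z ^+ 3 - 2 * (z - 1).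
have cp : continuous p.
  by apply: (@der_cts _ _ (fun z => 3 * a * z ^+ 2 - 2)) => z; rewrite /p; derive; rewrite /=; ring.
have [|z] := @IVT R p x y 0 xy (cts_within cp).
  rewrite ge_min le_max; move: h; rewrite -/(p x) -/(p y); move: (p x) (p y) => u v h.
  apply/andP; split; apply/orP.
    have [|u0] := leP u 0; first by left.
    right; rewrite leNgt; apply/negP => v0.
    by have := mulr_gt0 u0 v0; rewrite ltNge h.
  have [|u0] := leP 0 u; first by left.
  right; rewrite leNgt; apply/negP => v0.
  have : 0 < u * v by rewrite nmulr_rgt0.
  by rewrite ltNge h.
by rewrite in_itv /= => zi pz; exists z => //; apply/eqP; rewrite -subr_eq0; apply/eqP.
Qed.

Lemma R1_spec a : a != 0 -> [/\ R1 a != 0, R1 a < 1 & a * R1 a ^+ 3 = 2 * (R1 a - 1)].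
Proof.
move=> a0; suff [x [x0 x1 e]] : exists x, [/\ x != 0, x < 1 & a * x ^+ 3 = 2 * (x - 1)].
  have : [set x | [/\ x != 0, x < 1 & hfun x = a]] x by split => //; apply/hfunE.
  by move/(@xgetI _ 0); rewrite -/(R1 a) => -[h1 h2 /hfunE h3]; split => //; exact: h3.
have nz z : a * z ^+ 3 = 2 * (z - 1) -> z != 0.
  by move=> e; apply/eqP => z0; move: e; rewrite z0 expr0n /= mulr0; lra.
have [an|an] := ltP a 0.
  have [|z /andP[z0 z1] e] := @cubic_ivt a 0 1 ler01.
    by rewrite expr0n expr1n /= subrr !mulr0 mulr1 subr0; lra.
  exists z; split; [exact: nz| |by []].
  rewrite lt_def z1 andbT; apply/eqP => z1'; move: e; rewrite -z1' expr1n subrr mulr0 mulr1 => e.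
  by rewrite e eqxx in a0.
have ap : 0 < a by rewrite lt_def a0.
pose M := 1 + 4 / a.
have M1 : 1 <= M by rewrite lerDl divr_ge0.
have aM : 4 <= a * M by rewrite /M mulrDr mulr1 mulrC divfK // lerDr.
have M0 : 0 < M by exact: lt_le_trans M1.
have aM3 : 4 * M <= a * M ^+ 3.
  rewrite (_ : a * M ^+ 3 = (a * M) * M ^+ 2); last by ring.
  have M2 : M <= M ^+ 2 by rewrite -{1}(expr1 M) ler_weXn2l.
  by rewrite ler_pM // ltW.
have [||z /andP[z0 z1] e] := @cubic_ivt a (- M) 0.
- by rewrite oppr_le0 ltW.
- rewrite (_ : (- M) ^+ 3 = - M ^+ 3); last by ring.
  rewrite expr0n /= mulr0 sub0r !sub0r mulrN1 opprK mulr_le0_ge0 //.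
  by rewrite mulrN; lra.
- exists z; split; [exact: nz| |by []].
  exact: le_lt_trans z1 ltr01.
Qed.

Lemma R2_spec a : 0 < a < 8 / 27 -> [/\ 1 < R2 a, R2 a < 3 / 2 & a * R2 a ^+ 3 = 2 * (R2 a - 1)].
Proof.
move=> /andP[a0 a1]; suff [x [x0 x1 e]] : exists x, [/\ 1 < x, x < 3 / 2 & a * x ^+ 3 = 2 * (x - 1)].
  have xn : x != 0 by rewrite gt_eqF // (lt_trans _ x0).
  have : [set x | 1 < x < 3 / 2 /\ hfun x = a] x by split; [apply/andP|apply/hfunE].
  move/(@xgetI _ 0); rewrite -/(R2 a) => -[/andP[h1 h2] h3]; split => //.
  by apply/hfunE; rewrite // gt_eqF // (lt_trans _ h1).
have [||z /andP[z0 z1] e] := @cubic_ivt a 1 (3 / 2); first lra.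
  rewrite expr1n mulr1 subrr mulr0 subr0 pmulr_rle0 //.
  by rewrite (_ : (3 / 2) ^+ 3 = 27 / 8); [lra|field].
exists z; split => //.
  by rewrite lt_def z0 andbT; apply/eqP => h; move: e; rewrite h expr1n; lra.
rewrite lt_def z1 andbT; apply/eqP => h; move: e; rewrite -h (_ : (3 / 2) ^+ 3 = 27 / 8); [lra|field].
by [].
Qed.

Lemma R3_spec a : 0 < a < 8 / 27 -> 3 / 2 < R3 a /\ a * R3 a ^+ 3 = 2 * (R3 a - 1).
Proof.
move=> /andP[a0 a1]; suff [x [x0 e]] : exists x, 3 / 2 < x /\ a * x ^+ 3 = 2 * (x - 1).
  have xn : x != 0 by rewrite gt_eqF // (lt_trans _ x0).
  have : [set x | 3 / 2 < x /\ hfun x = a] x by split; [|apply/hfunE].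
  move/(@xgetI _ 0); rewrite -/(R3 a) => -[h1 h2]; split => //.
  by apply/hfunE; rewrite // gt_eqF // (lt_trans _ h1).
pose M := 2 + 4 / a.
have M1 : 2 <= M by rewrite lerDl divr_ge0 // ltW.
have aM : 4 <= a * M by rewrite /M mulrDr [a * (4 / a)]mulrC divfK ?gt_eqF // lerDr mulr_ge0 // ltW.
have M0 : 0 < M by exact: lt_le_trans M1.
have M2 : M <= M ^+ 2 by rewrite -{1}(expr1 M) ler_weXn2l //; lra.
have aM3 : 4 * M <= a * M ^+ 3.
  rewrite (_ : a * M ^+ 3 = (a * M) * M ^+ 2); last by ring.
  by rewrite ler_pM // ltW.
have e32 : (3 / 2 : R) ^+ 3 = 27 / 8 by field.
have [||z /andP[z0 z1] e] := @cubic_ivt a (3 / 2) M; first lra.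
  by rewrite e32 nmulr_rle0; lra.
exists z; split => //.
by rewrite lt_def z0 andbT; apply/eqP => h; move: e; rewrite h e32; lra.
Qed.

(** [C1], [C2], [C3] are the critical values of [Gaxis a]: the equation
    [hfun x = a] says that [- x] is a critical point. *)
Lemma Cval_Gaxis a x : x != 0 -> a * x ^+ 3 = 2 * (x - 1) -> Cval a (x ^+ 2) = Gaxis a (- x) /\
  Gaxis a (- x) = x * (x - 3) / 2.
Proof.
move=> x0 e; have e' : a * (- x) ^+ 3 = 2 + 2 * - x.
  by rewrite (_ : (- x) ^+ 3 = - x ^+ 3); [rewrite mulrN e; ring|ring].
rewrite (Gaxis_crit e'); have -> : a = 2 * (x - 1) / x ^+ 3 by rewrite -e mulfK // expf_neq0.
split; last by field.
rewrite /Cval (_ : - 2 + 2 * (x - 1) / x ^+ 3 * x ^+ 2 = - 2 / x); last by field.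
by field.
Qed.

Lemma C1_spec a : a != 0 -> C1 a = Gaxis a (- R1 a) /\ Gaxis a (- R1 a) = R1 a * (R1 a - 3) / 2.
Proof. by move=> /R1_spec[h1 h2 h3]; exact: Cval_Gaxis. Qed.

Lemma C2_spec a : 0 < a < 8 / 27 -> C2 a = Gaxis a (- R2 a) /\ Gaxis a (- R2 a) = R2 a * (R2 a - 3) / 2.
Proof. by move=> /R2_spec[h1 h2 h3]; apply: Cval_Gaxis => //; rewrite gt_eqF // (lt_trans _ h1). Qed.

Lemma C3_spec a : 0 < a < 8 / 27 -> C3 a = Gaxis a (- R3 a) /\ Gaxis a (- R3 a) = R3 a * (R3 a - 3) / 2.
Proof. by move=> /R3_spec[h1 h2]; apply: Cval_Gaxis => //; rewrite gt_eqF // (lt_trans _ h1). Qed.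

Lemma Gaxis'_R1 a : a != 0 -> Gaxis' a (- R1 a) = 0.
Proof.
move=> /R1_spec[h1 h2 h3]; rewrite /Gaxis' (_ : a * (- R1 a) ^+ 3 = - (a * R1 a ^+ 3)); last by ring.
by rewrite h3; ring.
Qed.

Lemma R1_neg a : 0 < a -> R1 a < 0 /\ 2 < a * R1 a ^+ 2.
Proof.
move=> a0; have [h1 h2 h3] := R1_spec (lt0r_neq0 a0).
have r0 : R1 a < 0.
  rewrite ltNge; apply/negP => r0; have : 0 <= a * R1 a ^+ 3 by rewrite mulr_ge0 ?exprn_ge0 // ltW.
  by rewrite h3; lra.
split => //; rewrite -subr_gt0 -(nmulr_rlt0 _ r0).
by rewrite (_ : R1 a * (_ - _) = a * R1 a ^+ 3 - 2 * R1 a); [rewrite h3; lra|ring].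
Qed.

Lemma R1_quad a : a != 0 -> 4 / a < 2 * R1 a ^+ 2.
Proof.
move=> a0; have [an|ap] := ltP a 0.
  apply: (@lt_le_trans _ _ 0); first by rewrite pmulr_rlt0 // invr_lt0.
  by rewrite mulr_ge0 // sqr_ge0.
have {}ap : 0 < a by rewrite lt_def a0.
have [_ h] := R1_neg ap; rewrite ltr_pdivrMr //; lra.
Qed.

Lemma one_double_C1 a : a != 0 -> one_double a (C1 a).
Proof.
move=> a0; have [-> _] := C1_spec a0; have [h1 _ _] := R1_spec a0.
apply: one_double_of_crit => //; [by rewrite oppr_eq0|exact: Gaxis'_R1|].
by rewrite sqrrN; exact: R1_quad.
Qed.

(** [- R1 a] is the point where [Gaxis a] has its global extremum, a maximum or
    a minimum according to the sign of [a]. *)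
Lemma Gaxis_extremal a x : a != 0 -> exists2 k, 0 <= k & Gaxis a x - C1 a = - a * k.
Proof.
move=> a0; have V := vieta_double a0 (Gaxis'_R1 a0); have [-> _] := C1_spec a0.
exists ((x + R1 a) ^+ 2 * ((x - R1 a) ^+ 2 + (2 * R1 a ^+ 2 - 4 / a)) / 4).
  have h := R1_quad a0.
  by rewrite divr_ge0 // mulr_ge0 ?sqr_ge0 // addr_ge0 ?sqr_ge0 // subr_ge0 ltW.
by rewrite (vieta_Gaxis x V); move: (4 / a) => u; field.
Qed.

Lemma C1_min a x : a < 0 -> C1 a <= Gaxis a x.
Proof.
move=> a0; have [k k0 e] := Gaxis_extremal x (ltr0_neq0 a0).
by rewrite -subr_ge0 e mulr_ge0 // oppr_ge0 ltW.
Qed.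

Lemma C1_max a x : 0 < a -> Gaxis a x <= C1 a.
Proof.
move=> a0; have [k k0 e] := Gaxis_extremal x (lt0r_neq0 a0).
by rewrite -subr_le0 e mulNr oppr_le0 mulr_ge0 // ltW.
Qed.

(** The cubic [Gaxis' a] has no quadratic term. *)
Lemma R_sum a : 0 < a < 8 / 27 -> - R1 a = R2 a + R3 a.
Proof.
move=> ai; have /andP[a0 a1] := ai; have an := lt0r_neq0 a0.
have [h1 h2 h3] := R1_spec an; have [rn _] := R1_neg a0.
have [k1 k2 k3] := R2_spec ai; have [l1 l2] := R3_spec ai.
have n23 : R2 a - R3 a != 0 by rewrite subr_eq0 lt_eqF // (lt_trans k2).
have s : a * (R2 a ^+ 2 + R2 a * R3 a + R3 a ^+ 2) = 2.
  apply: (mulfI n23); transitivity (a * R2 a ^+ 3 - a * R3 a ^+ 3); first by ring.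
  by rewrite k3 l2; ring.
have : a * ((R1 a - R2 a) * ((R1 a - R3 a) * (R1 a + (R2 a + R3 a)))) = 0.
  transitivity (a * R1 a ^+ 3 - a * R2 a ^+ 3
    - a * (R2 a ^+ 2 + R2 a * R3 a + R3 a ^+ 2) * (R1 a - R2 a)); first by ring.
  by rewrite h3 k3 s; ring.
move/eqP; rewrite !mulf_eq0 (negbTE an) /= => /or3P[|/eqP|/eqP]; rewrite ?subr_eq0; try (move/eqP); lra.
Qed.

Lemma Gaxis'_factor a z : 0 < a < 8 / 27 ->
  Gaxis' a z = - a * ((z + R1 a) * ((z + R2 a) * (z + R3 a))).
Proof.
move=> ai; have s := R_sum ai.
have [k1 k2 k3] := R2_spec ai; have [l1 l2] := R3_spec ai.
have n23 : R2 a - R3 a != 0 by rewrite subr_eq0 lt_eqF // (lt_trans k2).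
have e : a * (R2 a ^+ 2 + R2 a * R3 a + R3 a ^+ 2) = 2.
  apply: (mulfI n23); transitivity (a * R2 a ^+ 3 - a * R3 a ^+ 3); first by ring.
  by rewrite k3 l2; ring.
have -> : R1 a = - (R2 a + R3 a) by rewrite -s opprK.
have e2 : 2 = a * R2 a * R3 a * (R2 a + R3 a).
  transitivity (a * (R2 a ^+ 2 + R2 a * R3 a + R3 a ^+ 2) * R2 a - a * R2 a ^+ 3); last by ring.
  by rewrite e k3; ring.
rewrite /Gaxis'.
transitivity (a * R2 a * R3 a * (R2 a + R3 a)
   + a * (R2 a ^+ 2 + R2 a * R3 a + R3 a ^+ 2) * z - a * z ^+ 3); last by ring.
by rewrite e -e2.
Qed.

Lemma Gaxis'_signs a z : 0 < a < 8 / 27 ->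
  [/\ z < - R3 a -> 0 < Gaxis' a z, - R3 a < z < - R2 a -> Gaxis' a z < 0,
      - R2 a < z < - R1 a -> 0 < Gaxis' a z & - R1 a < z -> Gaxis' a z < 0].
Proof.
move=> ai; rewrite Gaxis'_factor //; have s := R_sum ai; have /andP[a0 _] := ai.
have [k1 k2 k3] := R2_spec ai; have [l1 l2] := R3_spec ai.
have na : - a < 0 by rewrite oppr_lt0.
split=> h.
- by rewrite nmulr_rgt0 // nmulr_rlt0 ?nmulr_rgt0; lra.
- have /andP[h1 h2] := h; by rewrite nmulr_rlt0 // nmulr_rgt0 ?nmulr_rlt0; lra.
- have /andP[h1 h2] := h; by rewrite nmulr_rgt0 // nmulr_rlt0 ?pmulr_rgt0; lra.
- by rewrite nmulr_rlt0 // pmulr_rgt0 ?pmulr_rgt0; lra.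
Qed.

Lemma Gaxis'_right a z : 0 < a -> - R1 a < z -> Gaxis' a z < 0.
Proof.
move=> a0 h; have [r0 q] := R1_neg a0; have [_ _ e] := R1_spec (lt0r_neq0 a0).
have -> : Gaxis' a z = - (z + R1 a) * (a * (z ^+ 2 - R1 a * z + R1 a ^+ 2) - 2).
  rewrite /Gaxis'; transitivity (2 + 2 * z - a * z ^+ 3 - (a * R1 a ^+ 3 - 2 * (R1 a - 1))); last by ring.
  by rewrite e; ring.
rewrite nmulr_rlt0; last lra.
rewrite subr_gt0 (lt_trans q) // ltr_pM2l // ltrDr.
rewrite (_ : _ - _ = z * (z - R1 a)); last by ring.
by rewrite mulr_gt0; lra.
Qed.

Lemma C_order a : 0 < a < 8 / 27 -> [/\ C2 a < C3 a, C3 a < C1 a & - (9 / 8) < C2 a].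
Proof.
move=> ai; have s := R_sum ai; have /andP[a0 _] := ai.
have [k1 k2 k3] := R2_spec ai; have [l1 l2] := R3_spec ai.
have [-> e2] := C2_spec ai; have [-> e3] := C3_spec ai; have [-> e1] := C1_spec (lt0r_neq0 a0).
split.
- by apply: Gaxis_dec; [lra|move=> z zi; have [_ h _ _] := Gaxis'_signs z ai; exact: h].
- by rewrite e1 e3; nra.
- by rewrite e2; nra.
Qed.

Lemma four_simple_Omega2 a C : 0 < a < 8 / 27 -> C2 a < C < C3 a -> four_simple a C.
Proof.
move=> ai /andP[h2 h3]; have s := R_sum ai; have /andP[a0 _] := ai.
have [_ h31 _] := C_order ai.
have [k1 k2 k3] := R2_spec ai; have [l1 l2] := R3_spec ai.
have [e2 _] := C2_spec ai; have [e3 _] := C3_spec ai; have [e1 _] := C1_spec (lt0r_neq0 a0).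
apply: (@four_simple_of_values _ a C (- R3 a) (- R2 a) (- R1 a)); rewrite -?e1 -?e2 -?e3 //; try lra.
Qed.

(** On the left of its maximum at [- R1 a], the function [Gaxis a] takes the
    value [C] at most once, with a nonzero derivative: for [a < 8 / 27] because [C] is not between the two other
    critical values, otherwise by monotonicity. *)
Lemma two_simple_regular a C : 0 < a -> C < C1 a ->
  (a < 8 / 27 -> C < C2 a \/ C3 a < C) -> (a = 8 / 27 -> C != - (9 / 8)) -> two_simple a C.
Proof.
move=> a0 C1C h1 h2; have an := lt0r_neq0 a0.
have [e1 _] := C1_spec an; have [r0 rq] := R1_neg a0; have [_ _ re] := R1_spec an.
rewrite e1 in C1C.
have fac z : Gaxis' a z = - (z + R1 a) * (a * (z ^+ 2 - R1 a * z + R1 a ^+ 2) - 2).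
  rewrite /Gaxis'; transitivity (2 + 2 * z - a * z ^+ 3 - (a * R1 a ^+ 3 - 2 * (R1 a - 1))); last by ring.
  by rewrite re; ring.
have inj (P : R -> Prop) z z' : (forall x y, P x -> P y -> x < y -> Gaxis a x < Gaxis a y) ->
    P z -> P z' -> Gaxis a z = C -> Gaxis a z' = C -> z = z'.
  move=> mono pz pz' gz gz'; apply/eqP; case: ltgtP => // zz; exfalso.
    by have := mono _ _ pz pz' zz; rewrite gz gz' ltxx.
  by have := mono _ _ pz' pz zz; rewrite gz gz' ltxx.
have [lt|lt|eq] := ltgtP a (8 / 27).
- have ai : 0 < a < 8 / 27 by rewrite a0.
  have s := R_sum ai; have [k1 k2 k3] := R2_spec ai; have [l1 l2] := R3_spec ai.
  have [e2 _] := C2_spec ai; have [e3 _] := C3_spec ai.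
  case: (h1 lt) => hC.
    have loc z : z < - R1 a -> Gaxis a z = C -> z < - R3 a.
      move=> zc gz; rewrite ltNge; apply/negP => z3.
      have : Gaxis a (- R2 a) <= Gaxis a z.
        have [z2|z2|->//] := ltgtP z (- R2 a).
          apply/ltW/Gaxis_dec => // y /andP[y1 y2]; have [_ h _ _] := Gaxis'_signs y ai; apply: h.
          by rewrite y2 andbT (le_lt_trans z3).
        apply/ltW/Gaxis_inc => // y /andP[y1 y2]; have [_ _ h _] := Gaxis'_signs y ai; apply: h.
        by rewrite y1 (lt_trans y2).
      by rewrite gz -e2 leNgt hC.
    apply: (@two_simple_pos _ a C (- R1 a)) => //.
    + by move=> z; exact: Gaxis'_right.
    + move=> z z' zc zc' gz gz'; apply: (inj (fun z => z < - R3 a)) => //; try exact: loc.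
      move=> x y x3 y3 xy; apply: Gaxis_inc => // u /andP[_ u2].
      by have [h _ _ _] := Gaxis'_signs u ai; apply: h; exact: lt_trans u2 y3.
    + by move=> z zc gz; rewrite gt_eqF //; have [h _ _ _] := Gaxis'_signs z ai; apply: h; exact: loc.
  have loc z : z < - R1 a -> Gaxis a z = C -> - R2 a < z.
    move=> zc gz; rewrite ltNge; apply/negP => z2.
    have : Gaxis a z <= Gaxis a (- R3 a).
      have [z3|z3|->//] := ltgtP z (- R3 a).
        apply/ltW/Gaxis_inc => // y /andP[y1 y2]; have [h _ _ _] := Gaxis'_signs y ai; exact: h.
      apply/ltW/Gaxis_dec => // y /andP[y1 y2]; have [_ h _ _] := Gaxis'_signs y ai; apply: h.
      by rewrite y1 (lt_le_trans y2).
    by rewrite gz -e3 leNgt hC.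
  apply: (@two_simple_pos _ a C (- R1 a)) => //.
  + by move=> z; exact: Gaxis'_right.
  + move=> z z' zc zc' gz gz'; apply: (inj (fun z => - R2 a < z < - R1 a)) => //.
    * move=> x y /andP[x2 _] /andP[_ y1] xy; apply: Gaxis_inc => // u /andP[u1 u2].
      by have [_ _ h _] := Gaxis'_signs u ai; apply: h; rewrite (lt_trans x2) //= (lt_trans u2).
    * by rewrite zc loc.
    * by rewrite zc' loc.
  + move=> z zc gz; rewrite gt_eqF //; have [_ _ h _] := Gaxis'_signs z ai; apply: h.
    by rewrite zc loc.
- have c3 : - R1 a < 3.
    rewrite ltNge; apply/negP => c3.
    have q : 2 * (R1 a - 1) < 8 / 27 * R1 a ^+ 3.
      rewrite -re -subr_gt0 -mulrBl nmulr_rgt0 ?subr_lt0 //.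
      by rewrite (_ : R1 a ^+ 3 = R1 a * R1 a ^+ 2); [rewrite pmulr_llt0 // exprn_even_gt0 //= lt_eqF|ring].
    by move: q c3; move: (R1 a) => x q c3; nra.
  have pos z : z < - R1 a -> 0 < Gaxis' a z.
    move=> zc; rewrite fac pmulr_rgt0; last lra.
    have e : a * R1 a ^+ 2 - 2 = - 2 / R1 a.
      apply: (mulIf (x := R1 a)); first by rewrite lt_eqF.
      rewrite divfK ?lt_eqF //; transitivity (a * R1 a ^+ 3 - 2 * R1 a); first by ring.
      by rewrite re; ring.
    have e3 : 2 / 3 < - 2 / R1 a.
      rewrite (_ : - 2 / R1 a = 2 / - R1 a); last by rewrite invrN mulrN mulNr.
      by rewrite ltr_pdivlMr ?oppr_gt0 //; lra.
    have := mulr_ge0 (ltW a0) (sqr_ge0 (z - R1 a / 2)).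
    rewrite (_ : a * (z ^+ 2 - R1 a * z + R1 a ^+ 2) - 2 =
       a * (z - R1 a / 2) ^+ 2 + (3 / 4 * (a * R1 a ^+ 2 - 2) - 1 / 2)); last by field.
    by rewrite e; lra.
  apply: (@two_simple_pos _ a C (- R1 a)) => //.
  + by move=> z; exact: Gaxis'_right.
  + move=> z z' zc zc' gz gz'; apply: (inj (fun z => z < - R1 a)) => //.
    by move=> x y x3 y3 xy; apply: Gaxis_inc => // u /andP[_ u2]; apply: pos; exact: lt_trans u2 y3.
  + by move=> z zc gz; rewrite gt_eqF // pos.
- have {}h2 := h2 eq.
  have c3 : R1 a = - 3.
    have : (R1 a + 3) * (2 * R1 a - 3) ^+ 2 = 0.
      transitivity (27 / 2 * (8 / 27 * R1 a ^+ 3 - 2 * (R1 a - 1))); first by field.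
      by rewrite -eq re subrr mulr0.
    by move/eqP; rewrite mulf_eq0 sqrf_eq0 => /orP[/eqP|/eqP]; lra.
  have ff z : Gaxis' a z = - (8 / 27) * ((z - 3) * (z + 3 / 2) ^+ 2) by rewrite /Gaxis' eq; field.
  have pos z : z < 3 -> z != - (3 / 2) -> 0 < Gaxis' a z.
    move=> z3 zn; rewrite ff nmulr_rgt0; last lra.
    by rewrite nmulr_rlt0 ?subr_lt0 // exprn_even_gt0 //= -[3 / 2]opprK subr_eq0.
  have gh : Gaxis a (- (3 / 2)) = - (9 / 8) by rewrite /Gaxis eq; field.
  apply: (@two_simple_pos _ a C (- R1 a)) => //.
  + by move=> z; exact: Gaxis'_right.
  + move=> z z' zc zc' gz gz'; apply: (inj (fun z => z < - R1 a)) => //.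
    rewrite c3 opprK => x y x3 y3 xy.
    have [hx|hx] := ltP x (- (3 / 2)); last first.
      apply: Gaxis_inc => // u /andP[u1 u2]; apply: pos; first exact: lt_trans u2 y3.
      by rewrite gt_eqF // (le_lt_trans hx).
    have [hy|hy] := ltP (- (3 / 2)) y; last first.
      apply: Gaxis_inc => // u /andP[u1 u2]; apply: pos; first exact: lt_trans u2 y3.
      by rewrite lt_eqF // (lt_le_trans u2).
    apply: (@lt_trans _ _ (Gaxis a (- (3 / 2)))).
      apply: Gaxis_inc => // u /andP[u1 u2]; apply: pos; first lra.
      by rewrite lt_eqF.
    apply: Gaxis_inc => // u /andP[u1 u2]; apply: pos; first exact: lt_trans u2 y3.
    by rewrite gt_eqF.
  + move=> z zc gz; rewrite gt_eqF // pos //; first by rewrite c3 opprK in zc.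
    by apply: contra h2 => /eqP zz; rewrite -gz zz gh.
Qed.

End params.

(** * The interior of Omega *)
Section interior_Omega.
Context {R : realType}.
Implicit Types (a C w x y z : R).

(** An explicit description of the parameters in the interior of [Omega]; the last
    two conditions exclude the closure of [Omega2]. *)
Definition regular a C : Prop :=
  (a < 0 /\ C1 a < C) \/
  [/\ 0 < a, C < C1 a, a < 8 / 27 -> C < C2 a \/ C3 a < C
    & a = 8 / 27 -> C != - (9 / 8)].

Lemma two_simple_of_regular a C : regular a C -> two_simple a C.
Proof.
case=> [[a0 h]|[]]; last exact: two_simple_regular.
have [e _] := C1_spec (ltr0_neq0 a0).
by apply: (@two_simple_neg _ a C (- R1 a)) => //; rewrite -e.
Qed.

Lemma interior_ball a C w : Omega° (a, C, w) -> exists2 e, 0 < e &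
  forall a' C', `|a - a'| < e -> `|C - C'| < e -> Omega (a', C', w).
Proof.
move=> /nbhs_ballP[e /= e0 h]; exists e => // a' C' ha hC.
by apply: h; split; [split|exact: ballxx].
Qed.

(** The curves [C2] and [C3] meet at the cusp; for [a'] just below [8 / 27] with
    [R3 a' = 3 / 2 + d], the value [C3 a'] is [- 9 / 8 + d ^ 2 / 2]. *)
Lemma cusp_approx e : 0 < e -> exists a' C' : R,
  [/\ `|8 / 27 - a'| < e, `|- (9 / 8) - C'| < e, 0 < a' < 8 / 27 & C2 a' < C' < C3 a'].
Proof.
move=> e0; pose d := Num.min (1 / 8) (e / 8).
have d0 : 0 < d by rewrite lt_min !divr_gt0.
have d1 : d <= 1 / 8 by rewrite ge_min lexx.
have de : d <= e / 8 by rewrite ge_min lexx orbT.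
pose r := 3 / 2 + d; pose a' := 2 * (r - 1) / r ^+ 3.
have r1 : 3 / 2 < r by rewrite ltrDl.
have r0 : 0 < r by rewrite (lt_trans _ r1).
have r3 : 0 < r ^+ 3 by rewrite exprn_gt0.
have ea : a' * r ^+ 3 = 2 * (r - 1) by rewrite /a' divfK // gt_eqF.
have diff : 8 / 27 - a' = (2 * d) ^+ 2 * (2 * r + 6) / (27 * r ^+ 3).
  rewrite /a' (_ : d = r - 3 / 2); last by rewrite /r; ring.
  by field; rewrite gt_eqF.
have d2 : 0 < 8 / 27 - a'.
  rewrite diff divr_gt0 ?mulr_gt0 ?exprn_gt0 ?mulr_gt0 //; lra.
have a'0 : 0 < a' by rewrite divr_gt0 // mulr_gt0 // subr_gt0; lra.
have ai : 0 < a' < 8 / 27 by rewrite a'0 -subr_gt0.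
have [c23 _ c2] := C_order ai.
have [k1 k2] := R3_spec ai.
have er : R3 a' = r.
  have [l1 l2 l3] := R2_spec ai; have [rn _] := R1_neg a'0.
  have g0 : Gaxis' a' (- r) = 0.
    rewrite /Gaxis' (_ : a' * (- r) ^+ 3 = - (a' * r ^+ 3)); last by ring.
    by rewrite ea; ring.
  have := Gaxis'_factor (- r) ai; rewrite g0 => /esym/eqP.
  rewrite !mulf_eq0 oppr_eq0 (gt_eqF a'0) /= => /or3P[|/eqP|/eqP]; try (move/eqP); lra.
have e3 : C3 a' = - (9 / 8) + d ^+ 2 / 2.
  by have [-> ->] := C3_spec ai; rewrite er /r; field.
exists a', ((C2 a' + C3 a') / 2); split => //.
- rewrite ger0_norm ?ltW // diff ltr_pdivrMr ?mulr_gt0 //.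
  have r3' : 1 <= r ^+ 3 by rewrite exprn_ege1 //; lra.
  have q1 : 2 * r + 6 <= 10 by rewrite /r; lra.
  have q2 : (2 * d) ^+ 2 <= e / 16 by rewrite (_ : (2 * d) ^+ 2 = 4 * (d * d)); [nra|ring].
  apply: (@le_lt_trans _ _ (e / 16 * 10)); first by rewrite ler_pM ?sqr_ge0 //; lra.
  nra.
- rewrite ler0_norm; nra.
- by apply/andP; split; lra.
Qed.

(** The sets [beta2], [beta3] and the cusp lie in [Omega], but they are limits of
    points of [Omega2]. *)
Lemma regular_of_interior a C w : Omega° (a, C, w) -> regular a C /\ 0 < w.
Proof.
move=> int; have [e e0 h] := interior_ball int.
have self : Omega (a, C, w) by apply: h; rewrite subrr normr0.
have w0 : 0 < w by case: self => -[] [].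
split => //; case: self => [[[h1 h2 _]|[h1 h2 _]] no]; first by left.
right; split => //.
- move=> lt; have ai : 0 < a < 8 / 27 by rewrite h2.
  have [c23 _ _] := C_order ai.
  have [c2|c2] := ltP C (C2 a); first by left.
  have [c3|c3] := ltP (C3 a) C; first by right.
  exfalso; have [eq2|ne2] := eqVneq C (C2 a).
    pose C' := C + Num.min e (C3 a - C) / 2.
    have m0 : 0 < Num.min e (C3 a - C) by rewrite lt_min e0 subr_gt0 eq2.
    have m1 : Num.min e (C3 a - C) <= e by rewrite ge_min lexx.
    have m2 : Num.min e (C3 a - C) <= C3 a - C by rewrite ge_min lexx orbT.
    have [||_ k] := h a C'; first by rewrite subrr normr0.
      by rewrite /C' opprD addNKr normrN ger0_norm; lra.
    by apply: k; split => //; apply/andP; split; rewrite /C'; lra.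
  have [eq3|ne3] := eqVneq C (C3 a).
    pose C' := C - Num.min e (C - C2 a) / 2.
    have m0 : 0 < Num.min e (C - C2 a) by rewrite lt_min e0 subr_gt0 eq3.
    have m1 : Num.min e (C - C2 a) <= e by rewrite ge_min lexx.
    have m2 : Num.min e (C - C2 a) <= C - C2 a by rewrite ge_min lexx orbT.
    have [||_ k] := h a C'; first by rewrite subrr normr0.
      by rewrite /C' opprB addrCA subrr addr0 ger0_norm; lra.
    by apply: k; split => //; apply/andP; split; rewrite /C'; lra.
  by apply: no; split => //; rewrite lt_def ne2 c2 /= lt_def eq_sym ne3 c3.
- move=> ea; apply/eqP => eC.
  have [a' [C' [h3 h4 h5 h6]]] := cusp_approx e0.
  have [_ k] : Omega (a', C', w) by apply: h; rewrite ?ea ?eC.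
  by apply: k; split.
Qed.

Lemma nbhs3 (A B W : set R) a C w : nbhs a A -> nbhs C B -> nbhs w W ->
  (forall a' C' w', A a' -> B C' -> W w' -> Omega (a', C', w')) -> Omega° (a, C, w).
Proof.
move=> nA nB nW h; exists (A `*` B, W) => /=.
  by split => //=; exists (A, B).
by move=> [[a' C'] w'] /= [[hA hB] hW]; exact: h.
Qed.

Lemma hfun_incr x y : 1 < x -> x < y -> y < 3 / 2 ->
  forall a b, a * x ^+ 3 = 2 * (x - 1) -> b * y ^+ 3 = 2 * (y - 1) -> a < b.
Proof.
move=> x1 xy y3 a b ea eb.
have x0 : 0 < x ^+ 3 by rewrite exprn_gt0 // (lt_trans _ x1).
have y0 : 0 < y ^+ 3 by rewrite exprn_gt0 // (lt_trans _ (lt_trans x1 xy)).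
rewrite -subr_gt0 -(pmulr_lgt0 _ x0) -(pmulr_lgt0 _ y0).
rewrite (_ : (b - a) * _ * _ = b * y ^+ 3 * x ^+ 3 - a * x ^+ 3 * y ^+ 3); last by ring.
rewrite ea eb (_ : _ - _ = 2 * ((y - x) * (x ^+ 2 + x * y + y ^+ 2 - x * y * (x + y)))); last by ring.
rewrite !mulr_gt0 ?subr_gt0 //.
have h1 : x < 3 / 2 by exact: lt_trans y3.
have p1 : 0 < (x - 1) * (3 / 2 - x) by rewrite mulr_gt0 ?subr_gt0.
have := mulr_gt0 (mulr_gt0 (lt_trans ltr01 x1) (lt_trans ltr01 (lt_trans x1 xy))) ltr01.
nra.
Qed.

Lemma hfun_decr x y : 3 / 2 <= x -> x < y ->
  forall a b, a * x ^+ 3 = 2 * (x - 1) -> b * y ^+ 3 = 2 * (y - 1) -> b < a.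
Proof.
move=> x1 xy a b ea eb.
have x0' : 0 < x by rewrite (lt_le_trans _ x1).
have y0' : 0 < y by exact: lt_trans xy.
have x0 : 0 < x ^+ 3 by rewrite exprn_gt0.
have y0 : 0 < y ^+ 3 by rewrite exprn_gt0.
rewrite -subr_gt0 -(pmulr_lgt0 _ x0) -(pmulr_lgt0 _ y0).
rewrite (_ : (a - b) * _ * _ = a * x ^+ 3 * y ^+ 3 - b * y ^+ 3 * x ^+ 3); last by ring.
rewrite ea eb (_ : _ - _ = 2 * ((y - x) * (x * y * (x + y) - (x ^+ 2 + x * y + y ^+ 2)))); last by ring.
rewrite !mulr_gt0 ?subr_gt0 //.
have : 0 <= x * y * (x - 3 / 2) by rewrite !mulr_ge0 ?subr_ge0 ?(ltW x0') ?(ltW y0').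
have : 0 < x * y * (y - 3 / 2) by rewrite !mulr_gt0 ?subr_gt0 // (le_lt_trans x1).
nra.
Qed.

End interior_Omega.

Section near_boundary.
Context {R : realType}.
Implicit Types (a C w x y z : R).

Lemma Gaxis_cts_coef x : continuous (fun a : R => Gaxis a x).
Proof.
by apply: (@der_cts _ _ (fun=> - (x ^+ 4) / 4)) => a; rewrite /Gaxis; derive; rewrite /=; field.
Qed.

(** [C1] is semicontinuous, being an extremum over [x] of functions that are
    continuous in [a]. *)
Lemma C1_near_neg a m : a < 0 -> C1 a < m -> \forall a' \near a, C1 a' < m.
Proof.
move=> a0 h; have [e _] := C1_spec (ltr0_neq0 a0); rewrite e in h.
near=> a'; apply: (@le_lt_trans _ _ (Gaxis a' (- R1 a))).
  by apply: C1_min; near: a'; exact: lt_nbhsl.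
by near: a'; exact: (cvgr_lt _ (Gaxis_cts_coef (x := - R1 a) (x0 := a))).
Unshelve. all: by end_near. Qed.

Lemma C1_near_pos a m : 0 < a -> m < C1 a -> \forall a' \near a, m < C1 a'.
Proof.
move=> a0 h; have [e _] := C1_spec (lt0r_neq0 a0); rewrite e in h.
near=> a'; apply: (@lt_le_trans _ _ (Gaxis a' (- R1 a))).
  by near: a'; exact: (cvgr_gt _ (Gaxis_cts_coef (x := - R1 a) (x0 := a))).
by apply: C1_max; near: a'; exact: lt_nbhsr.
Unshelve. all: by end_near. Qed.

Lemma C2_gt a x : 0 < a < 8 / 27 -> 1 < x < 3 / 2 -> a < hfun x -> x * (x - 3) / 2 < C2 a.
Proof.
move=> ai /andP[x1 x3] ax; have [k1 k2 k3] := R2_spec ai; have [-> ->] := C2_spec ai.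
have ex : hfun x * x ^+ 3 = 2 * (x - 1) by apply/hfunE; rewrite // gt_eqF // (lt_trans _ x1).
have lt : R2 a < x.
  rewrite ltNge le_eqVlt; apply/negP => /orP[/eqP ee|lt].
    move: ax; rewrite -(_ : a = hfun x) ?ltxx // ee.
    by apply/esym/hfunE; rewrite // gt_eqF // (lt_trans _ k1).
  have := hfun_incr x1 lt k2 ex k3; lra.
nra.
Qed.

Lemma C3_lt a x : 0 < a < 8 / 27 -> 3 / 2 < x -> hfun x < a -> C3 a < x * (x - 3) / 2.
Proof.
move=> ai x1 ax; have [k1 k2] := R3_spec ai; have [-> ->] := C3_spec ai.
have x0 : 0 < x by rewrite (lt_trans _ x1).
have ex : hfun x * x ^+ 3 = 2 * (x - 1) by apply/hfunE; rewrite // gt_eqF.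
have lt : R3 a < x.
  rewrite ltNge le_eqVlt; apply/negP => /orP[/eqP ee|lt].
    move: ax; rewrite -(_ : a = hfun x) ?ltxx // ee.
    by apply/esym/hfunE; rewrite // -ee gt_eqF.
  have := hfun_decr (ltW x1) lt ex k2; lra.
nra.
Qed.

(** [R2] increases with [a] and [C2 a] is a decreasing function of [R2 a]; so a
    strict inequality can be transferred to an explicit radius [x] slightly
    larger than [R2 a], and then holds for the neighbouring [a']. *)
Lemma C2_near a C : 0 < a < 8 / 27 -> C < C2 a ->
  \forall a' \near a & C' \near C, 0 < a' < 8 / 27 -> C' < C2 a'.
Proof.
move=> ai; have [k1 k2 k3] := R2_spec ai; have [-> ->] := C2_spec ai => h.
set r := R2 a in k1 k2 k3 h *.
pose d := Num.min ((3 / 2 - r) / 2) (r * (r - 3) / 2 - C).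
have d0 : 0 < d by rewrite lt_min !subr_gt0 h andbT divr_gt0 // subr_gt0.
have d1 : d <= (3 / 2 - r) / 2 by rewrite ge_min lexx.
have d2 : d <= r * (r - 3) / 2 - C by rewrite ge_min lexx orbT.
pose x := r + d.
have xi : 1 < x < 3 / 2 by rewrite /x; apply/andP; split; lra.
have ex : hfun x * x ^+ 3 = 2 * (x - 1).
  by apply/hfunE; rewrite // gt_eqF // /x; lra.
have ax : a < hfun x by apply: (hfun_incr k1 _ _ k3 ex); rewrite /x; lra.
have Cx : C < x * (x - 3) / 2 by rewrite /x; nra.
exists ([set a' | a' < hfun x], [set C' | C' < x * (x - 3) / 2]) => /=.
  by split; exact: lt_nbhsl.
by move=> [a' C'] /= [h1 h2] a'i; apply: (lt_trans h2); exact: C2_gt.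
Qed.

(** As for [C2], with the opposite monotonicity.  The radius [r] need not be
    [R3 a], so as to include [a = 8 / 27], where [r = 3 / 2]. *)
Lemma C3_near a C r : 3 / 2 <= r -> a * r ^+ 3 = 2 * (r - 1) -> r * (r - 3) / 2 < C ->
  \forall a' \near a & C' \near C, 0 < a' < 8 / 27 -> C3 a' < C'.
Proof.
move=> k1 k2 h; have r0 : 0 < r by rewrite (lt_le_trans _ k1).
pose d := Num.min 1 ((C - r * (r - 3) / 2) / r).
have d0 : 0 < d by rewrite lt_min ltr01 divr_gt0 // subr_gt0.
have d1 : d <= 1 by rewrite ge_min lexx.
have d2 : d * r <= C - r * (r - 3) / 2.
  by rewrite -ler_pdivlMr // ge_min lexx orbT.
pose x := r + d.
have xi : 3 / 2 < x by rewrite /x; lra.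
have ex : hfun x * x ^+ 3 = 2 * (x - 1).
  by apply/hfunE; rewrite // gt_eqF // /x; lra.
have ax : hfun x < a by apply: (hfun_decr k1 _ k2 ex); rewrite /x; lra.
have Cx : x * (x - 3) / 2 < C by rewrite /x; nra.
exists ([set a' | hfun x < a'], [set C' | x * (x - 3) / 2 < C']) => /=.
  by split; exact: lt_nbhsr.
by move=> [a' C'] /= [h1 h2] a'i; apply: lt_trans h2; exact: C3_lt.
Qed.

Lemma near_Omega2 a C : 0 < a -> (a < 8 / 27 -> C < C2 a \/ C3 a < C) ->
  (a = 8 / 27 -> C != - (9 / 8)) ->
  \forall a' \near a & C' \near C, 0 < a' < 8 / 27 -> ~ (C2 a' < C' < C3 a').
Proof.
move=> a0 h1 h2; have [lt|] := ltP a (8 / 27).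
  have ai : 0 < a < 8 / 27 by rewrite a0.
  have [h|h] := h1 lt.
    apply: filterS (C2_near ai h) => -[a' C'] /= k /k {}k /andP[k' _].
    by move: (lt_trans k k'); rewrite ltxx.
  have [k1 k2] := R3_spec ai; have [e1 e2] := C3_spec ai; rewrite e1 e2 in h.
  apply: filterS (C3_near (ltW k1) k2 h) => -[a' C'] /= k /k {}k /andP[_ k'].
  by move: (lt_trans k k'); rewrite ltxx.
rewrite le_eqVlt => /orP[/eqP ea|lt]; last first.
  exists ([set a' | 8 / 27 < a'], setT) => /=.
    by split; [exact: lt_nbhsr|exact: filterT].
  by move=> [a' C'] /= [k1 _] /andP[_ /(lt_trans k1)]; rewrite ltxx.
have ea' := esym ea; have := h2 ea'; rewrite neq_lt => /orP[lt|gt].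
  exists (setT, [set C' | C' < - (9 / 8)]) => /=.
    by split; [exact: filterT|exact: lt_nbhsl].
  move=> [a' C'] /= [_ k1] a'i /andP[k _]; have [_ _ k'] := C_order a'i.
  by move: (lt_trans k' (lt_trans k k1)); rewrite ltxx.
have h3 : a * (3 / 2) ^+ 3 = 2 * (3 / 2 - 1) by rewrite ea'; field.
have h4 : 3 / 2 * (3 / 2 - 3) / 2 < C by lra.
apply: filterS (C3_near (lexx _) h3 h4) => -[a' C'] /= k /k {}k /andP[_ k'].
by move: (lt_trans k k'); rewrite ltxx.
Qed.

Lemma interior_of_regular a C w : regular a C -> 0 < w -> Omega° (a, C, w).
Proof.
move=> reg w0; have nW : nbhs w [set w' | 0 < w'] by exact: lt_nbhsr.
case: reg => [[a0 h]|[a0 h h1 h2]].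
  have [m1 m2] : C1 a < (C1 a + C) / 2 /\ (C1 a + C) / 2 < C by lra.
  apply: (@nbhs3 _ [set a' | C1 a' < (C1 a + C) / 2 /\ a' < 0]
            [set C' | (C1 a + C) / 2 < C'] [set w' | 0 < w']) => //.
  - by apply: filterI; [exact: C1_near_neg|exact: lt_nbhsl].
  - exact: lt_nbhsr.
  move=> a' C' w' [/= k1 k2] k3 k4; split.
    by left; split => //; exact: lt_trans k3.
  by case=> _ /andP[/(lt_trans k2)]; rewrite ltxx.
have [m1 m2] : C < (C1 a + C) / 2 /\ (C1 a + C) / 2 < C1 a by lra.
have [[A B] [nA nB] AB] := near_Omega2 a0 h1 h2.
apply: (@nbhs3 _ [set a' | [/\ (C1 a + C) / 2 < C1 a', 0 < a' & A a']]
          [set C' | C' < (C1 a + C) / 2 /\ B C'] [set w' | 0 < w']) => //.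
- apply: filterS3 nA (C1_near_pos a0 m2) (lt_nbhsr a0).
  by move=> a' k1 k2 k3; split.
- by apply: filterI => //; exact: lt_nbhsl.
move=> a' C' w' [/= k1 k2 k5] [k3 k6] k4; split.
  by right; split => //; exact: lt_trans k1.
by case=> k7 k8 _; exact: (AB (a', C') (conj k5 k6) k8 k7).
Qed.

End near_boundary.

(** * Families of drops *)
Section families.
Context {R : realType}.
Implicit Types (a C w r s e d : R) (al be : profile R).

Lemma der_Yq2 a C w (r : R) : is_derive r 1 (fun r : R => 64 + w ^+ 2 * Pquad a C r ^+ 2)
   (2 * (w ^+ 2 * (Pquad a C r * (2 * a * r - 4)))).
Proof. by have d5 := der_Pquad a C r; derive; ring. Qed.

(** A factorization of the quartic [64 r - Pquad ^ 2] gives one of [rad_speed2],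
    with a cofactor of the same sign. *)
Lemma cofactor a C w (k dk : R -> R) : (forall r : R, is_derive r 1 k (dk r)) ->
  exists K dK, [/\ forall r : R, is_derive r 1 K (dK r),
    forall r p, 64 * r - Pquad a C r ^+ 2 = p * k r -> rad_speed2 a C w r = p * K r
  & forall r c, 0 < c * k r -> 0 < c * K r].
Proof.
move=> dk1; exists (fun r => 4 * k r / (64 + w ^+ 2 * Pquad a C r ^+ 2)).
eexists; split.
- move=> r; have d1 := dk1 r; have Y := Y2_gt0 a C w r.
  have d2 : is_derive r 1 (fun r : R => 4 * k r) (4 * dk r) by derive; ring.
  have d4 := der_Yq2 a C w r.
  have d3 := @der_inv R _ r _ (lt0r_neq0 Y) d4.
  exact: (der_mul d2 d3).
- by move=> r p fac; rewrite /rad_speed2 fac; field; rewrite exprMn gt_eqF // Y2_gt0.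
- move=> r c ck; rewrite mulrA mulrCA divr_gt0 ?Y2_gt0 //.
  by rewrite mulr_gt0.
Qed.

Lemma simple_of_factor a C w r1 r2 (k dk : R -> R) : 0 <= r1 < r2 ->
  (forall r : R, is_derive r 1 k (dk r)) ->
  (forall r, 64 * r - Pquad a C r ^+ 2 = (r - r1) * (r2 - r) * k r) ->
  (forall r, r1 <= r <= r2 -> 0 < k r) ->
  exists K dK, simple_interval a C w r1 r2 K dK.
Proof.
move=> r12 dk1 fac k0; have [K [dK [h1 h2 h3]]] := cofactor a C w dk1.
exists K, dK; split => // r; first exact/h2/fac.
by move=> ri; have := h3 r 1; rewrite !mul1r; apply; exact: k0.
Qed.

Lemma rad_treadmill a C w al s r : represents a C w al -> rad al s = r -> rad_speed2 a C w r = 0 ->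
  treadmill al s = (0, rho2 a C w r).
Proof.
move=> [_ lev] er Q; have lp : Glevel a C w (treadmill al s) by apply: lev; exists s.
have [_] := level_rad_speed2 lp; have /Glevel_iff := lp; rewrite /= xi_rad er Q sqrtr0 mul0r => h2 /eqP.
by rewrite normr_eq0 => /eqP h1; rewrite /treadmill h1 h2.
Qed.

Lemma not_congruent w al be s : 0 < w -> (forall s', rad al s' < rad be s) ->
  ~ congruent w al be.
Proof.
move=> w0 h /congruent_sym cg.
have [s' hs'] := congruent_rad w0 (fun s' => ltW (h s')) cg s.
by move: (h s'); rewrite ltNge hs'.
Qed.

Lemma circular_rad w al : 0 < w -> circular w al -> forall s s', rad al s = rad al s'.
Proof.
move=> w0 [R0 R00 e]; suff h s : rad al s = R0 ^+ 2 by move=> s s'; rewrite !h.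
have : surface w al (phi w al s 0) by exists s, 0.
by rewrite e /cylinder /= => <-; rewrite axis_distE.
Qed.

Definition swinging a C w r1 r2 al : Prop :=
  [/\ represents a C w al, finite_fundamental_piece a C w al,
      root_interval a C r1 r2 /\ sled_param a C w `[r1, r2] al,
      [/\ forall s, r1 <= rad al s <= r2, exists s, rad al s = r1 & exists s, rad al s = r2]
    & (rational (angle_variation a C w r1 r2 / pi) -> properly_immersed w al) /\
      (irrational (angle_variation a C w r1 r2 / pi) ->
        dense_between w al (Num.sqrt r1) (Num.sqrt r2))].

(** Besides existence, this and the next two families contain completeness: a
    drop of the same level set whose radius starts in the interval belongs to the
    family, since [level_hit] finds its starting point on the TreadmillSled of
    the explicit motion. *)
Lemma swinging_drops a C w r1 r2 (K dK : R -> R) : a != 0 -> 0 < w ->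
  simple_interval a C w r1 r2 K dK ->
  exists2 al, swinging a C w r1 r2 al &
    forall be, represents a C w be -> r1 <= rad be 0 <= r2 ->
      congruent w al be /\ swinging a C w r1 r2 be.
Proof.
move=> a0 w0 SI; have roS := simple_rolling SI; have [/andP[_ r12] _ _ _] := SI.
have key be : represents a C w be ->
    rolls a C w (ovalG r1 r2) (ovalG1 r1 r2) (ovalV r1 r2 K) be -> swinging a C w r1 r2 be.
  move=> rep ro; have comp := oval_component SI rep ro.
  have [S [U [dS SU US dU et]]] := ro.
  have radE s : rad be s = ovalG r1 r2 (U s) := rad_at roS (et s).
  have rb s : r1 <= rad be s <= r2 by rewrite radE; exact: ovalG_itv (ltW r12).
  split => //; last exact: (oval_dichotomy SI).
  - split.
      have [x [y [inj exy]]] := oval_piece_exists SI rep ro.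
      exists `[x, y[%classic; split => //; [|exact: interval_is_interval|by rewrite comp].
      rewrite comp; split.
      + by exists (treadmill be 0); [apply: (proj2 rep); exists 0|rewrite comp].
      + rewrite (_ : range _ = treadmill be @` `[x, y]%classic); last first.
          apply/seteqP; split; last by move=> p [s _ <-]; exists s.
          rewrite -exy => p [s si <-]; exists s => //.
          by apply: subset_itvl si; rewrite bnd_simp.
        apply: continuous_compact; last exact: segment_compact.
        by apply: continuous_subspaceT; exact: treadmill_cts.
      + move=> p [s _ <-]; apply: (oval_regular SI); first by apply: (proj2 rep); exists s.
        by rewrite /= xi_rad.
    move=> I [_ iI inj _]; exact: (oval_piece_finite SI ro).
  - by split; [exact: oval_root_interval SI|exact: (oval_sled SI ro)].
  - split => //.
      by exists (S 0); rewrite radE SU /ovalG cos0; by field.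
    by exists (S pi); rewrite radE SU /ovalG cospi; by field.
have [al rep ro] := rolling_exists roS.
exists al; first exact: key.
move=> be rbe rb; have lb : Glevel a C w (treadmill be 0) by apply: (proj2 rbe); exists 0.
have [u _ hu] := ovalG_surj SI rb.
have [|u0 e0] := level_hit roS (@ovalG_even _ r1 r2 K) lb (u := u).
  by rewrite hu /= xi_rad.
have [cg ro'] := rolls_unique a0 w0 rep ro rbe e0.
by split => //; exact: key.
Qed.

Definition winding a C w (i : interval R) al : Prop :=
  [/\ represents a C w al, sled_param a C w i al, exceptional w al
    & forall s, rad al s \in i].

(** The spiral starts at the simple root [e] and tends to [d] from either side. *)
Definition spiral_interval e d : interval R := if e < d then `[e, d[ else `]d, e].

Lemma spiral_intervalP e d r : e != d ->
  (r \in spiral_interval e d) <-> (exists2 t, 0 <= t < 1 & r = e + (d - e) * t).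
Proof.
move=> ed; have ed' : d - e != 0 by rewrite subr_eq0 eq_sym.
rewrite /spiral_interval; case: ltP => h; rewrite in_itv /=.
  have de : 0 < d - e by rewrite subr_gt0.
  split=> [/andP[r1 r2]|[t /andP[t0 t1] ->]]; last by apply/andP; split; nra.
  exists ((r - e) / (d - e)); last by field.
  by rewrite divr_ge0 ?subr_ge0 ?(ltW h) //= ltr_pdivrMr // mul1r ltrD2r.
have {}h : d < e by rewrite lt_def ed.
split=> [/andP[r1 r2]|[t /andP[t0 t1] ->]]; last by apply/andP; split; nra.
have de : 0 < e - d by rewrite subr_gt0.
exists ((e - r) / (e - d)); last by field; rewrite gt_eqF.
by rewrite divr_ge0 ?subr_ge0 ?(ltW h) //= ltr_pdivrMr // mul1r ltrD2l ltrN2.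
Qed.

Lemma winding_drops a C w e d (k dk : R -> R) : a != 0 -> 0 < w ->
  0 <= e -> 0 < d -> e != d -> (forall r : R, is_derive r 1 k (dk r)) ->
  (forall r, 64 * r - Pquad a C r ^+ 2 = (r - e) * (d - r) ^+ 2 * k r) ->
  (forall r, r \in spiral_interval e d -> 0 < (d - e) * k r) -> Pquad a C d < 0 ->
  exists2 al, winding a C w (spiral_interval e d) al &
    forall be, represents a C w be -> rad be 0 \in spiral_interval e d ->
      congruent w al be /\ winding a C w (spiral_interval e d) be.
Proof.
move=> a0 w0 e0 d0 ed dk1 fac k0 Pd; have [K [dK [dK1 h2 h3]]] := cofactor a C w dk1.
have QK r := h2 r _ (fac r).
have K0 t : 0 <= t < 1 -> 0 < (d - e) * K (e + (d - e) * t).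
  by move=> ti; apply/h3/k0/spiral_intervalP => //; exists t.
have roS := spiral_rolling e0 (ltW d0) ed dK1 QK K0.
have key be : represents a C w be ->
    rolls a C w (spiralG e d) (spiralG1 e d) (spiralV e d K) be ->
    winding a C w (spiral_interval e d) be.
  move=> rep ro; split => //.
  - rewrite /spiral_interval; case: ltP => h.
      exact: (spiral_sled_below e0 d0 ed dK1 QK K0).
    by apply: (spiral_sled_above e0 d0 ed dK1 QK K0) => //; rewrite lt_def ed.
  - exact: (spiral_exceptional e0 d0 ed dK1 QK K0).
  - have [U eU] := rolls_rad roS ro => s; apply/spiral_intervalP => //.
    by rewrite eU; exact: spiral_between.
have [al rep ro] := rolling_exists roS.
exists al; first exact: key.
move=> be rbe /(spiral_intervalP _ ed)[t ti er].
have lb : Glevel a C w (treadmill be 0) by apply: (proj2 rbe); exists 0.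
have [u hu] := spiral_surj e d ti.
have [|u0 e0'] := level_hit roS (@spiral_even _ e d K) lb (u := u).
  by rewrite hu /= xi_rad.
have [cg ro'] := rolls_unique a0 w0 rep ro rbe e0'.
by split => //; exact: key.
Qed.

Definition circling a C w d al : Prop :=
  [/\ represents a C w al, forall s, rad al s = d, surface w al = cylinder (Num.sqrt d)
    & circular w al /\ properly_immersed w al].

Lemma circling_drops a C w d (k dk : R -> R) : a != 0 -> 0 < w -> 0 < d ->
  (forall r : R, is_derive r 1 k (dk r)) ->
  (forall r, 64 * r - Pquad a C r ^+ 2 = (r - d) ^+ 2 * k r) ->
  exists2 al, circling a C w d al &
    forall be, represents a C w be -> rad be 0 = d ->
      congruent w al be /\ circling a C w d be.
Proof.
move=> a0 w0 d0 dk1 fac; have [K [dK [dK1 h2 _]]] := cofactor a C w dk1.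
have QK r := h2 r _ (fac r).
have Q : rad_speed2 a C w d = 0 by rewrite QK subrr expr0n /= mul0r.
have kd : xi1_speed a C w d = 0.
  have : 4 * xi1_speed a C w d = 2 * (d - d) * K d + (d - d) ^+ 2 * dK d.
    apply: (der_uniq (der_rad_speed2 a C w d)).
    rewrite (_ : rad_speed2 a C w = fun r => (r - d) ^+ 2 * K r); last exact/funext.
    by have d1 := dK1 d; derive; ring.
  by rewrite subrr expr0n /= mulr0 !mul0r addr0 => /eqP; rewrite mulf_eq0 pnatr_eq0 => /eqP.
have key be : represents a C w be -> (forall s, rad be s = d) -> circling a C w d be.
  move=> rep er.
  have [e pr] := circle_surface d0 kd Q rep (fun s => rad_treadmill rep (er s) Q).
  by split => //; split => //; exists (Num.sqrt d); rewrite ?sqrtr_gt0.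
have [al rep et] := circle_exists (ltW d0) Q kd.
have rr : rho2 a C w d ^+ 2 = d by have := rho2_sq a C w (ltW d0); rewrite Q; lra.
exists al; first by apply: key => // s; rewrite -xi_rad; have [-> ->] := et s; rewrite rr expr0n add0r.
move=> be rbe er; have e0 := rad_treadmill rbe er Q.
have [c mv] := @represents_unique _ _ _ _ al be 0 a0 rep rbe (etrans e0 (esym (et 0))).
split; first exact: moved_congruent mv.
apply: key => // s; have [_ /esym] := mv s; rewrite et => -[k1 k2].
by rewrite -xi_rad -k1 -k2 rr expr0n add0r.
Qed.

End families.

Section cases.
Context {R : realType}.
Implicit Types (a C w r s e d : R) (al be : profile R).

Lemma poly_ext (p q : {poly R}) : (forall x, p.[x] = q.[x]) -> p = q.
Proof.
move=> h; apply/eqP; rewrite -subr_eq0; apply/eqP.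
pose n := size (p - q).
apply: (@roots_geq_poly_eq0 _ _ [seq i%:R | i <- iota 0 n]).
- by apply/allP => _ /mapP[i _ ->]; rewrite rootE hornerD hornerN h subrr.
- by rewrite map_inj_uniq ?iota_uniq // => i j /eqP; rewrite eqr_nat => /eqP.
- by rewrite size_map size_iota.
Qed.

Lemma root_qdrop a C r : root (qdrop a C) r = (64 * r - Pquad a C r ^+ 2 == 0).
Proof. by rewrite rootE qdropE. Qed.

Lemma root_ge0 a C r : 64 * r - Pquad a C r ^+ 2 = 0 -> 0 <= r.
Proof. by move=> h; have := sqr_ge0 (Pquad a C r); lra. Qed.

(** Restricts the radius of a drop to the intervals where the quartic is
    nonnegative. *)
Lemma rad_factor a C w al s : represents a C w al ->
  0 <= 64 * rad al s - Pquad a C (rad al s) ^+ 2.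
Proof. by move=> rep; rewrite subr_ge0; exact: rad_Pquad rep. Qed.

Lemma swinging_congruent a C w r1 r2 al be : 0 < w -> swinging a C w r1 r2 al ->
  (exists s, r2 < rad be s) -> ~ congruent w al be.
Proof.
move=> w0 [_ _ _ [h _ _] _] [s hs]; apply: (@not_congruent _ _ _ _ s w0) => s'.
by have /andP[_ /le_lt_trans] := h s'; exact.
Qed.

Lemma two_simple_drops a C w : a != 0 -> 0 < w -> two_simple a C ->
  exists al r1 r2, [/\ swinging a C w r1 r2 al, distinct_roots a C [:: r1; r2]
    & forall be, represents a C w be -> congruent w al be /\ swinging a C w r1 r2 be].
Proof.
move=> a0 w0 [r1 [r2 [k [dk [r12 dk1 fac k0]]]]]; have /andP[r10 r12'] := r12.
have [|K [dK SI]] := simple_of_factor w r12 dk1 fac.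
  by move=> r /andP[h _]; apply: k0; exact: le_trans h.
have [al sw compl] := swinging_drops a0 w0 SI.
exists al, r1, r2; split => //.
- split; first by rewrite /= r12'.
  move=> r; rewrite root_qdrop !inE; apply/idP/idP => [/eqP h|/orP[] /eqP ->].
  + have r0 := root_ge0 h; move/eqP: h; rewrite fac mulf_eq0 (gt_eqF (k0 r r0)) orbF.
    by rewrite mulf_eq0 !subr_eq0 [r2 == r]eq_sym.
  + by rewrite fac subrr !mul0r.
  + by rewrite fac subrr mulr0 mul0r.
- move=> be rep; apply: compl => //.
  have := rad_factor 0 rep; rewrite fac pmulr_lge0 ?k0 ?rad_ge0 // => h.
  by apply/andP; split; rewrite leNgt; apply/negP => h'; nra.
Qed.

Lemma four_simple_drops a C w : a != 0 -> 0 < w -> four_simple a C ->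
  exists al1 al2 r1 r2 r3 r4,
  [/\ [/\ swinging a C w r1 r2 al1, swinging a C w r3 r4 al2 & ~ congruent w al1 al2],
    distinct_roots a C [:: r1; r2; r3; r4]
    & forall be, represents a C w be ->
       (congruent w al1 be /\ swinging a C w r1 r2 be) \/
       (congruent w al2 be /\ swinging a C w r3 r4 be)].
Proof.
move=> a0 w0 [r1 [r2 [r3 [r4 [r10 r12 r23 r34 fac]]]]].
have a2 : 0 < a ^+ 2 by rewrite exprn_even_gt0.
have d1 (x y : R) r : is_derive r 1 (fun r : R => a ^+ 2 * ((r - x) * (r - y))) (a ^+ 2 * (2 * r - x - y)).
  by derive; ring.
have [i12 i34] : 0 <= r1 < r2 /\ 0 <= r3 < r4 by split; apply/andP; split => //; lra.
have [||K [dK SI]] := simple_of_factor w i12 (d1 r3 r4) (C := C) (a := a).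
- by move=> r; rewrite fac; ring.
- by move=> r /andP[h1 h2]; rewrite mulr_gt0 // nmulr_rgt0 subr_lt0; lra.
have [||K' [dK' SI']] := simple_of_factor w i34 (d1 r1 r2) (C := C) (a := a).
- by move=> r; rewrite fac; ring.
- by move=> r /andP[h1 h2]; rewrite mulr_gt0 // mulr_gt0 // subr_gt0; lra.
have [al sw compl] := swinging_drops a0 w0 SI.
have [al' sw' compl'] := swinging_drops a0 w0 SI'.
exists al, al', r1, r2, r3, r4; split.
- split => //; apply: swinging_congruent sw _ => //.
  by have [_ _ _ [h _ _] _] := sw'; exists 0; have /andP[/(lt_le_trans r23)] := h 0.
- split; first by rewrite /= r12 r23 r34.
  move=> r; rewrite root_qdrop fac !inE mulNr oppr_eq0 mulf_eq0 (gt_eqF a2) /=.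
  by rewrite !mulf_eq0 !subr_eq0 -!orbA.
- move=> be rep; have := rad_factor 0 rep; rewrite fac; set r := rad be 0 => h.
  have {}h : (r - r1) * (r - r2) * ((r - r3) * (r - r4)) <= 0.
    by move: h; rewrite mulNr oppr_ge0 pmulr_rle0 // -mulrA.
  have below x y : r < x -> r < y -> 0 < (r - x) * (r - y).
    by move=> h1 h2; rewrite nmulr_rgt0 subr_lt0.
  have above x y : x < r -> y < r -> 0 < (r - x) * (r - y).
    by move=> h1 h2; rewrite mulr_gt0 // subr_gt0.
  have no : ~ (0 < (r - r1) * (r - r2) /\ 0 < (r - r3) * (r - r4)).
    by case=> h1 h2; move: h; rewrite leNgt mulr_gt0.
  have [h1|h1] := ltP r r1; first by exfalso; apply: no; split; apply: below; lra.
  have [h2|h2] := leP r r2; first by left; apply: compl => //; apply/andP.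
  have [h3|h3] := ltP r r3.
    by exfalso; apply: no; split; [apply: above|apply: below]; lra.
  have [h4|h4] := leP r r4; first by right; apply: compl' => //; apply/andP.
  by exfalso; apply: no; split; apply: above; lra.
Qed.

Lemma one_double_drops a C : a != 0 -> one_double a C -> exists2 d, 0 < d &
  forall w, 0 < w -> exists2 al, circling a C w d al &
  forall be, represents a C w be -> congruent w al be /\ circling a C w d be.
Proof.
move=> a0 [x [k [dk [x0 _ dk1 fac k0]]]]; exists (x ^+ 2); first by rewrite exprn_even_gt0.
move=> w w0; have x2 : 0 < x ^+ 2 by rewrite exprn_even_gt0.
have dk2 (r : R) : is_derive r 1 (fun r => - k r) (- dk r) by have d1 := dk1 r; derive.
have [|al ci compl] := circling_drops a0 w0 x2 dk2 (C := C).
  by move=> r; rewrite fac; ring.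
exists al => // be rep; apply: compl => //.
have := rad_factor 0 rep; rewrite fac mulNr oppr_ge0 pmulr_lle0 ?k0 ?rad_ge0 // => h.
by apply/eqP; rewrite -subr_eq0 -sqrf_eq0 eq_le h sqr_ge0.
Qed.

Section double.
Variables (a rho s w : R).
Hypotheses (a0 : a != 0) (w0 : 0 < w) (rho1 : 1 < rho) (s0 : 0 < s).
Let C := Gaxis a (- rho).
Let d := rho ^+ 2.
Let e1 := (rho - s) ^+ 2.
Let e2 := (rho + s) ^+ 2.
Hypothesis Pd : Pquad a C d = - (8 * rho).
Hypothesis fac : forall r, 64 * r - Pquad a C r ^+ 2 = - a ^+ 2 * (r - d) ^+ 2 * ((r - e1) * (r - e2)).

Let a2 : 0 < a ^+ 2. Proof. by rewrite exprn_even_gt0. Qed.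
Let d0 : 0 < d. Proof. by rewrite exprn_gt0 // (lt_trans _ rho1). Qed.
Let de2 : d < e2.
Proof. by rewrite -subr_gt0 (_ : _ - _ = s * (s + 2 * rho)) /e2 /d; [rewrite mulr_gt0 //; move: s0 rho1; lra|ring]. Qed.
Let e10 : 0 <= e1. Proof. exact: sqr_ge0. Qed.
Let P0 : Pquad a C d < 0. Proof. by rewrite Pd oppr_lt0 mulr_gt0 // (lt_trans _ rho1). Qed.

Let dlin (c x : R) (r : R) : is_derive r 1 (fun r => c * (r - x)) c.
Proof. by derive; ring. Qed.

Lemma double_circling : exists2 al, circling a C w d al &
  forall be, represents a C w be -> rad be 0 = d ->
  congruent w al be /\ circling a C w d be.
Proof.
have dk (r : R) : is_derive r 1 (fun r => - a ^+ 2 * ((r - e1) * (r - e2))) (- a ^+ 2 * (2 * r - e1 - e2)).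
  by derive; ring.
by apply: circling_drops dk _ => // r; rewrite fac; ring.
Qed.

Lemma double_swinging : d < e1 -> exists2 al, swinging a C w e1 e2 al &
  forall be, represents a C w be -> e1 <= rad be 0 <= e2 ->
  congruent w al be /\ swinging a C w e1 e2 be.
Proof.
move=> de1.
have e12 : 0 <= e1 < e2.
  have s2 : 0 < s * rho by rewrite mulr_gt0 // (lt_trans _ rho1).
  rewrite e10 -subr_gt0 (_ : _ - _ = 4 * (s * rho)) /e2 /e1; [lra|ring].
have dk (r : R) : is_derive r 1 (fun r => a ^+ 2 * (r - d) ^+ 2) (a ^+ 2 * (2 * (r - d))).
  by derive; ring.
have [|r /andP[h1 h2]|K [dK SI]] := simple_of_factor w e12 dk (C := C) (a := a).
- by move=> r; rewrite fac; ring.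
- by rewrite mulr_gt0 // exprn_gt0 // subr_gt0 (lt_le_trans de1).
exact: swinging_drops a0 w0 SI.
Qed.

Lemma double_winding_below : e1 < d -> exists2 al, winding a C w `[e1, d[ al &
  forall be, represents a C w be -> rad be 0 \in `[e1, d[ ->
  congruent w al be /\ winding a C w `[e1, d[ be.
Proof.
move=> ed; have -> : `[e1, d[ = spiral_interval e1 d by rewrite /spiral_interval ed.
apply: (winding_drops a0 w0 e10 d0 _ (dlin (- a ^+ 2) e2)) => //.
- by rewrite lt_eqF.
- by move=> r; rewrite fac; ring.
move=> r; rewrite /spiral_interval ed in_itv /= => /andP[h1 h2].
rewrite mulr_gt0 ?subr_gt0 // mulNr oppr_gt0 pmulr_rlt0 // subr_lt0.
exact: lt_trans de2.
Qed.

Lemma double_winding_above : e1 <= d -> exists2 al, winding a C w `]d, e2] al &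
  forall be, represents a C w be -> rad be 0 \in `]d, e2] ->
  congruent w al be /\ winding a C w `]d, e2] be.
Proof.
move=> ed; have ei : spiral_interval e2 d = `]d, e2].
  by rewrite /spiral_interval ltNge (ltW de2).
rewrite -ei; apply: (winding_drops a0 w0 _ d0 _ (dlin (- a ^+ 2) e1)) => //.
- exact: sqr_ge0.
- by rewrite gt_eqF.
- by move=> r; rewrite fac; ring.
move=> r; rewrite ei in_itv /= => /andP[h1 h2].
rewrite nmulr_rgt0 ?subr_lt0 // mulNr oppr_lt0 mulr_gt0 // subr_gt0; lra.
Qed.

Lemma double_rad be : represents a C w be -> rad be 0 = d \/ e1 <= rad be 0 <= e2.
Proof.
move=> rep; have := rad_factor 0 rep; rewrite fac; set r := rad be 0 => h.
have [->|rd] := eqVneq r d; [by left|right].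
have {}h : (r - e1) * (r - e2) <= 0.
  move: h; rewrite !mulNr oppr_ge0 pmulr_rle0 //.
  by rewrite mulr_gt0 // exprn_even_gt0 // subr_eq0.
have e12 : e1 < e2.
  have s2 : 0 < s * rho by rewrite mulr_gt0 // (lt_trans _ rho1).
  rewrite -subr_gt0 (_ : _ - _ = 4 * (s * rho)) /e2 /e1; [lra|ring].
by apply/andP; split; rewrite leNgt; apply/negP => h'; nra.
Qed.

(** The multiplicity is read off from the factorization of [qdrop] as a
    polynomial, obtained from that of its values. *)
Lemma double_roots : e1 < d -> distinct_roots a C [:: e1; d; e2] /\ mup d (qdrop a C) = 2.
Proof.
move=> ed; have aa : - a ^+ 2 != 0 by rewrite oppr_eq0 expf_neq0.
split.
  split; first by rewrite /= ed de2.
  move=> r; rewrite root_qdrop fac !inE mulf_eq0 mulf_eq0 (negbTE aa) expf_eq0 /=.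
  by rewrite mulf_eq0 !subr_eq0 orbCA.
have -> : qdrop a C = ('X - d%:P) ^+ 2 * ((- a ^+ 2) *: (('X - e1%:P) * ('X - e2%:P))).
  apply: poly_ext => r; rewrite qdropE fac !hornerE /=; ring.
rewrite mupMl; first by rewrite mup_XsubCX eqxx.
rewrite rootE hornerZ hornerM !hornerXsubC mulf_eq0 (negbTE aa) /= mulf_eq0 !subr_eq0.
by rewrite (gt_eqF ed) (lt_eqF de2).
Qed.

Lemma double_root_intervals : e1 < d -> root_interval a C e1 d /\ root_interval a C d e2.
Proof.
move=> ed; have [[_ rt] _] := double_roots ed.
have mem : {in [:: e1; d; e2], forall r, root (qdrop a C) r} by move=> r; rewrite -rt.
have pos r : (r - e1) * (r - e2) < 0 -> r != d -> 0 < (qdrop a C).[r].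
  move=> h rd; rewrite qdropE fac nmulr_lgt0 // mulNr oppr_lt0 mulr_gt0 //.
  by rewrite exprn_even_gt0 //= subr_eq0.
have d2 := de2; split; split; rewrite ?mem ?inE ?eqxx ?orbT //.
- by rewrite e10.
- move=> r /andP[h1 h2]; apply: pos; last by rewrite lt_eqF.
  by rewrite pmulr_rlt0 ?subr_gt0 // subr_lt0; exact: lt_trans h2 _.
- by rewrite (ltW d0).
- move=> r /andP[h1 h2]; apply: pos; last by rewrite gt_eqF.
  by rewrite pmulr_rlt0 ?subr_lt0 // subr_gt0; exact: lt_trans ed _.
Qed.

End double.
End cases.

(** * Classification *)
Section classification.
Context {R : realType}.
Implicit Types (a C w r s e d rho : R) (al be : profile R).

(** With [t = sqrt r], the inequality [Pquad ^ 2 <= 64 r] says that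
    [Gaxis a (- t) <= C <= Gaxis a t]; hence [C] is on the right side of the
    extremal value [C1 a]. *)
Lemma classify a C w al : a != 0 -> 0 < w -> represents a C w al ->
  (Omega° `|` Omega2 `|` beta1 `|` beta2 `|` beta3 `|` cusp) (a, C, w).
Proof.
move=> a0 w0 rep; set r := rad al 0; have [t te] : exists t, t = Num.sqrt r by exists (Num.sqrt r).
have r0 : 0 <= r by exact: rad_ge0.
have t2 : t ^+ 2 = r by rewrite te sqr_sqrtr.
have t0 : 0 <= t by rewrite te sqrtr_ge0.
have Pt : `|Pquad a C r| <= 8 * t.
  rewrite -ler_sqr ?nnegrE ?mulr_ge0 // real_normK ?num_real //.
  by rewrite exprMn t2 (_ : 8 ^+ 2 = 64); [exact: rad_Pquad rep|ring].
have eC : C = t ^+ 2 - a / 4 * t ^+ 4 + Pquad a C r / 4.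
  by rewrite /Pquad (exprM t 2 2) t2; field.
move: Pt; rewrite ler_norml => /andP[P1 P2].
have [lo hi] : Gaxis a (- t) <= C /\ C <= Gaxis a t.
  move: (Pquad a C r) P1 P2 eC => p P1 P2 ->; rewrite /Gaxis; clear te t2 t0.
  have -> : (- t) ^+ 2 = t ^+ 2 by ring.
  have -> : (- t) ^+ 4 = t ^+ 4 by ring.
  move: (t ^+ 2) (a / 4 * t ^+ 4) => u v; split; lra.
have [an|ap] := ltP a 0.
  have := le_trans (C1_min (- t) an) lo.
  rewrite le_eqVlt => /orP[/eqP e|lt].
    by do 3 left; right; split.
  by do 5 left; apply: interior_of_regular => //; left.
have {}ap : 0 < a by rewrite lt_def a0.
have := le_trans hi (C1_max t ap).
rewrite le_eqVlt => /orP[/eqP e|lt]; first by do 3 left; right; split.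
have [h1|h1] := ltP a (8 / 27).
  have ai : 0 < a < 8 / 27 by rewrite ap.
  have reg : C < C2 a \/ C3 a < C -> regular a C.
    move=> h; right; split => //.
    by move=> e; move: h1; rewrite e ltxx.
  have [c2|c2] := ltP C (C2 a).
    by do 5 left; apply: interior_of_regular => //; apply: reg; left.
  have [c3|c3] := ltP (C3 a) C.
    by do 5 left; apply: interior_of_regular => //; apply: reg; right.
  have [e2|n2] := eqVneq C (C2 a); first by do 2 left; right; split.
  have [e3|n3] := eqVneq C (C3 a); first by left; right; split.
  by do 4 left; right; split => //; rewrite lt_def n2 c2 lt_def eq_sym n3 c3.
have [/andP[/eqP e1 /eqP e2]|no] := boolP ((a == 8 / 27) && (C == - (9 / 8))).
  by right.
do 5 left; apply: interior_of_regular => //; right; split => //.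
  by move=> h; move: h1; rewrite leNgt h.
by move=> e; move: no; rewrite e eqxx.
Qed.

(** The position of the smallest other root relatively to the double root
    [rho ^ 2] depends on the sign of [rho - 3 / 2] only; it changes at the
    cusp. *)
Lemma double_sqrt rho s : 1 < rho -> 0 < s -> s ^+ 2 * (rho - 1) = 2 * rho ^+ 2 ->
  [/\ rho < 3 / 2 -> rho ^+ 2 < (rho - s) ^+ 2, rho = 3 / 2 -> (rho - s) ^+ 2 = rho ^+ 2
    & 3 / 2 < rho -> (rho - s) ^+ 2 < rho ^+ 2].
Proof.
move=> r1 s0 e; have r0 : 0 < rho by exact: lt_trans r1.
have q : (s - 2 * rho) * ((s + 2 * rho) * (rho - 1)) = 4 * rho ^+ 2 * (3 / 2 - rho).
  rewrite (_ : _ * _ = s ^+ 2 * (rho - 1) - 4 * rho ^+ 2 * (rho - 1)); last by ring.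
  by rewrite e; field.
have p : 0 < (s + 2 * rho) * (rho - 1) by rewrite mulr_gt0 ?subr_gt0 //; lra.
have p2 : 0 < 4 * rho ^+ 2 by rewrite mulr_gt0 // exprn_gt0.
have df : (rho - s) ^+ 2 - rho ^+ 2 = s * (s - 2 * rho) by ring.
split=> h.
- rewrite -subr_gt0 df mulr_gt0 // -(pmulr_lgt0 _ p) q mulr_gt0 // subr_gt0.
  by [].
- apply/eqP; rewrite -subr_eq0 df mulf_eq0; apply/orP; right.
  by move/eqP: q; rewrite h subrr mulr0 mulf_eq0 -h (gt_eqF p) orbF.
- rewrite -subr_lt0 df pmulr_rlt0 // -(pmulr_llt0 _ p) q pmulr_rlt0 // subr_lt0.
  by [].
Qed.

Lemma circling_congruent a C w d al be : 0 < w -> circling a C w d al ->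
  (exists s, d < rad be s) -> ~ congruent w al be.
Proof.
move=> w0 [_ h _ _] [s hs]; apply: (@not_congruent _ _ _ _ s w0) => s'.
by rewrite h.
Qed.

Lemma inner_double_drops a rho : a != 0 -> 1 < rho -> rho < 3 / 2 ->
  a * rho ^+ 3 = 2 * (rho - 1) -> forall w, 0 < w -> let C := Gaxis a (- rho) in
  exists al1 al2 r1 r2, [/\ circling a C w (rho ^+ 2) al1, swinging a C w r1 r2 al2,
    ~ congruent w al1 al2
  & forall be, represents a C w be ->
      (congruent w al1 be /\ circling a C w (rho ^+ 2) be) \/
      (congruent w al2 be /\ swinging a C w r1 r2 be)].
Proof.
move=> a0 r1 r3 e w w0 C; have [s [s0 es Pd fac]] := double_split r1 e.
have [/(_ r3) h _ _] := double_sqrt r1 s0 es.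
have [al ci compl] := double_circling a0 w0 r1 fac.
have [al' sw compl'] := double_swinging a0 w0 r1 s0 fac h.
exists al, al', ((rho - s) ^+ 2), ((rho + s) ^+ 2); split => //.
- apply: circling_congruent ci _ => //; have [_ _ _ [k _ _] _] := sw; exists 0.
  by have /andP[/(lt_le_trans h)] := k 0.
- move=> be rep; have [er|er] := double_rad a0 r1 s0 fac rep.
    by left; exact: compl.
  by right; exact: compl'.
Qed.

Lemma outer_double_drops a rho : a != 0 -> 3 / 2 < rho ->
  a * rho ^+ 3 = 2 * (rho - 1) -> forall w, 0 < w -> let C := Gaxis a (- rho) in
  exists al1 al2 al3 r1 r3, let r2 := rho ^+ 2 in
  [/\ [/\ circling a C w r2 al1, winding a C w `[r1, r2[ al2 & winding a C w `]r2, r3] al3],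
    [/\ ~ congruent w al1 al2, ~ congruent w al1 al3 & ~ congruent w al2 al3],
    distinct_roots a C [:: r1; r2; r3] /\ mup r2 (qdrop a C) = 2,
    root_interval a C r1 r2 /\ root_interval a C r2 r3
  & forall be, represents a C w be ->
      [\/ congruent w al1 be /\ circling a C w r2 be,
          congruent w al2 be /\ winding a C w `[r1, r2[ be
        | congruent w al3 be /\ winding a C w `]r2, r3] be]].
Proof.
move=> a0 r3 e w w0 C; have r1 : 1 < rho by lra.
have [s [s0 es Pd fac]] := double_split r1 e.
have [_ _ /(_ r3) h] := double_sqrt r1 s0 es.
have [al ci compl] := double_circling a0 w0 r1 fac.
have [al2 wi2 compl2] := double_winding_below a0 w0 r1 s0 Pd fac h.
have [al3 wi3 compl3] := double_winding_above a0 w0 r1 s0 Pd fac (ltW h).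
exists al, al2, al3, ((rho - s) ^+ 2), ((rho + s) ^+ 2) => r2; split => //.
- have [_ k _ _] := ci; have [_ _ _ k2] := wi2; have [_ _ _ k3] := wi3.
  have k2' s' : rad al2 s' < r2 by have := k2 s'; rewrite in_itv /= => /andP[].
  have k3' s' : r2 < rad al3 s' by have := k3 s'; rewrite in_itv /= => /andP[].
  split.
  + by move=> /congruent_sym; apply: (@not_congruent _ _ _ _ 0 w0) => s'; rewrite k.
  + by apply: (@not_congruent _ _ _ _ 0 w0) => s'; rewrite k.
  + by apply: (@not_congruent _ _ _ _ 0 w0) => s'; exact: lt_trans (k2' s') (k3' 0).
- exact: double_roots.
- exact: double_root_intervals.
- move=> be rep; have [er|/andP[h1 h2]] := double_rad a0 r1 s0 fac rep.
    by apply: Or31; exact: compl.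
  have [lt|gt|er] := ltgtP (rad be 0) (rho ^+ 2).
  + by apply: Or32; apply: compl2; rewrite // in_itv /= h1.
  + by apply: Or33; apply: compl3; rewrite // in_itv /= gt.
  + by apply: Or31; exact: compl.
Qed.

Lemma triple_drops a : a = 8 / 27 -> forall w, 0 < w -> let C := - (9 / 8) in
  exists al1 al2 i, [/\ circling a C w (9 / 4) al1, winding a C w i al2,
    ~ congruent w al1 al2
  & forall be, represents a C w be ->
      (congruent w al1 be /\ circling a C w (9 / 4) be) \/
      (congruent w al2 be /\ winding a C w i be)].
Proof.
move=> ea w w0 C; have a0 : a != 0 by rewrite ea gt_eqF // divr_gt0.
pose rho : R := 3 / 2; have r1 : 1 < rho by rewrite /rho; lra.
have e : a * rho ^+ 3 = 2 * (rho - 1) by rewrite ea /rho; field.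
have eC : C = Gaxis a (- rho) by rewrite /C /Gaxis ea /rho; field.
have er2 : 9 / 4 = rho ^+ 2 by rewrite /rho; field.
have [s [s0 es Pd fac]] := double_split r1 e.
have [_ /(_ erefl) h _] := double_sqrt r1 s0 es.
have [al ci compl] := double_circling a0 w0 r1 fac.
have h' : (rho - s) ^+ 2 <= rho ^+ 2 by rewrite h.
have [al3 wi3 compl3] := double_winding_above a0 w0 r1 s0 Pd fac h'.
rewrite eC er2; exists al, al3, `]rho ^+ 2, (rho + s) ^+ 2]; split => //.
- apply: circling_congruent ci _ => //; have [_ _ _ k] := wi3; exists 0.
  by have := k 0; rewrite in_itv /= => /andP[].
- move=> be rep; have [er|/andP[h1 h2]] := double_rad a0 r1 s0 fac rep.
    by left; exact: compl.
  move: h1; rewrite h le_eqVlt => /orP[/eqP/esym er|gt]; first by left; exact: compl.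
  by right; apply: compl3; rewrite // in_itv /= gt.
Qed.

Lemma drop_kinds a C w be : a != 0 -> 0 < w -> represents a C w be ->
  [\/ circular w be /\ properly_immersed w be, exceptional w be
    | exists r1 r2, swinging a C w r1 r2 be].
Proof.
move=> a0 w0 rep; case: (classify a0 w0 rep) => [[[[[h|h]|h]|h]|h]|h].
- have [/two_simple_of_regular ts _] := regular_of_interior h.
  have [al [r1 [r2 [_ _ /(_ be rep)[_ k]]]]] := two_simple_drops a0 w0 ts.
  by apply: Or33; exists r1, r2.
- have [hC ai _] := h.
  have [al1 [al2 [r1 [r2 [r3 [r4 [_ _ /(_ be rep)]]]]]]] :=
    four_simple_drops a0 w0 (four_simple_Omega2 ai hC).
  by case=> -[_ k]; apply: Or33; eexists; eexists; exact: k.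
- have [hC _ _] := h; rewrite hC in rep.
  have [d d0 /(_ w w0)[al _ /(_ be rep)[_ [_ _ _ k]]]] := one_double_drops a0 (one_double_C1 a0).
  exact: Or31.
- have [hC ai _] := h; have [k1 k2 k3] := R2_spec ai; have [e _] := C2_spec ai.
  rewrite hC e in rep *.
  have [al1 [al2 [r1 [r2 [_ _ _ /(_ be rep)]]]]] := inner_double_drops a0 k1 k2 k3 w0.
  case=> -[_ k]; first by have [_ _ _ k'] := k; exact: Or31.
  by apply: Or33; eexists; eexists; exact: k.
- have [hC ai _] := h; have [k1 k2] := R3_spec ai; have [e _] := C3_spec ai.
  rewrite hC e in rep *.
  have [al1 [al2 [al3 [r1 [r3 [_ _ _ _ /(_ be rep)]]]]]] := outer_double_drops a0 k1 k2 w0.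
  by case=> -[_ [_ k1' k2' k3']]; [exact: Or31|exact: Or32|exact: Or32].
- have [ea hC _] := h; rewrite hC in rep *.
  have [al1 [al2 [i [_ _ _ /(_ be rep)]]]] := triple_drops ea w0.
  by case=> -[_ [_ k1' k2' k3']]; [exact: Or31|exact: Or32].
Qed.

End classification.

Section exactly.
Context {R : realType}.
Implicit Types (a C w : R) (al be : profile R).

Lemma exactly1 a C w al : represents a C w al ->
  (forall be, represents a C w be -> congruent w al be) -> represents_exactly a C w [:: al].
Proof.
move=> rep compl; split.
- by move=> be [<-|[]].
- by do ?constructor.
- by move=> be /compl cg; exists al => //; left.
Qed.

Lemma exactly2 a C w al1 al2 : represents a C w al1 -> represents a C w al2 ->
  ~ congruent w al1 al2 ->
  (forall be, represents a C w be -> congruent w al1 be \/ congruent w al2 be) ->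
  represents_exactly a C w [:: al1; al2].
Proof.
move=> rep1 rep2 nc compl; split.
- by move=> be [<-|[<-|[]]].
- by do ?constructor.
- move=> be /compl[cg|cg]; [exists al1|exists al2] => //; first by left.
  by right; left.
Qed.

Lemma exactly3 a C w al1 al2 al3 :
  [/\ represents a C w al1, represents a C w al2 & represents a C w al3] ->
  [/\ ~ congruent w al1 al2, ~ congruent w al1 al3 & ~ congruent w al2 al3] ->
  (forall be, represents a C w be ->
     [\/ congruent w al1 be, congruent w al2 be | congruent w al3 be]) ->
  represents_exactly a C w [:: al1; al2; al3].
Proof.
move=> [rep1 rep2 rep3] [n12 n13 n23] compl; split.
- by move=> be [<-|[<-|[<-|[]]]].
- by do ?constructor.
- move=> be /compl[]cg; [exists al1|exists al2|exists al3] => //; first by left.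
    by right; left.
  by right; right; left.
Qed.

End exactly.

Theorem theorem2p11 (R : realType) :
  (* (i) *)
  (forall a C w : R, Omega° (a, C, w) ->
     exists (al : profile R) (r1 r2 : R),
       [/\ represents_exactly a C w [:: al],
           finite_fundamental_piece a C w al,
           distinct_roots a C [:: r1; r2],
           root_interval a C r1 r2
         & sled_param a C w `[r1, r2] al]) /\
  (* (ii) *)
  (forall a C w : R, Omega2 (a, C, w) ->
     exists (al1 al2 : profile R) (r1 r2 r3 r4 : R),
       [/\ represents_exactly a C w [:: al1; al2],
           finite_fundamental_piece a C w al1 /\
             finite_fundamental_piece a C w al2,
           distinct_roots a C [:: r1; r2; r3; r4],
           root_interval a C r1 r2 /\ sled_param a C w `[r1, r2] al1
         & root_interval a C r3 r4 /\ sled_param a C w `[r3, r4] al2]) /\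
  (* (iii): the radius does not depend on w *)
  (forall a C : R, exists2 R0 : R, 0 < R0 &
     forall w : R, beta1 (a, C, w) ->
       exists al : profile R,
         represents_exactly a C w [:: al] /\ surface w al = cylinder R0) /\
  (* (iv) *)
  (forall a C : R, exists2 R0 : R, 0 < R0 &
     forall w : R, beta2 (a, C, w) ->
       exists al1 al2 : profile R,
         [/\ represents_exactly a C w [:: al1; al2],
             surface w al1 = cylinder R0,
             ~ circular w al2
           & finite_fundamental_piece a C w al2]) /\
  (* (v): the sleds in `[r1, r2[ and `]r2, r3] approach rho(r2) without
     reaching it *)
  (forall a C : R, exists2 R0 : R, 0 < R0 &
     forall w : R, beta3 (a, C, w) ->
       exists (al1 al2 al3 : profile R) (r1 r2 r3 : R),
         [/\ represents_exactly a C w [:: al1; al2; al3],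
             surface w al1 = cylinder R0,
             distinct_roots a C [:: r1; r2; r3] /\ mup r2 (qdrop a C) = 2%N,
             [/\ root_interval a C r1 r2, sled_param a C w `[r1, r2[ al2
               & exceptional w al2]
           & [/\ root_interval a C r2 r3, sled_param a C w `]r2, r3] al3
               & exceptional w al3]]) /\
  (* (vi) *)
  (forall a C : R, exists2 R0 : R, 0 < R0 &
     forall w : R, cusp (a, C, w) ->
       exists al1 al2 : profile R,
         [/\ represents_exactly a C w [:: al1; al2],
             surface w al1 = cylinder R0
           & exceptional w al2]) /\
  (* (vii): by [represents_exactly], the drop is then congruent to one of those
     described in (i)-(vi) *)
  (forall (a w : R) (al : profile R), a != 0 -> 0 < w -> rotating_drop a w al ->
     exists2 C : R, represents a C w al &
       (Omega° `|` Omega2 `|` beta1 `|` beta2 `|` beta3 `|` cusp) (a, C, w)) /\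
  (* (viii) *)
  (forall (a w : R) (al : profile R), a != 0 -> 0 < w -> rotating_drop a w al ->
     ~ exceptional w al ->
     (circular w al /\ properly_immersed w al) \/
     exists C r1 r2 : R,
       [/\ represents a C w al,
           root_interval a C r1 r2,
           sled_param a C w `[r1, r2] al,
           rational (angle_variation a C w r1 r2 / pi) ->
             properly_immersed w al
         & irrational (angle_variation a C w r1 r2 / pi) ->
             dense_between w al (Num.sqrt r1) (Num.sqrt r2)]).
Proof.
split=> [a C w h|].
  have [reg w0] := regular_of_interior h.
  have a0 : a != 0 by case: reg => [[/ltr0_neq0]|[/lt0r_neq0]].
  have [al [r1 [r2 [sw dr compl]]]] := two_simple_drops a0 w0 (two_simple_of_regular reg).
  have [rep fin [ri sl] _ _] := sw; exists al, r1, r2; split => //.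
  by apply: exactly1 => // be /compl[].
split=> [a C w [hC ai w0]|].
  have a0 : a != 0 by have /andP[/gt_eqF ->] := ai.
  have [al1 [al2 [r1 [r2 [r3 [r4 [[sw1 sw2 nc] dr compl]]]]]]] :=
    four_simple_drops a0 w0 (four_simple_Omega2 ai hC).
  have [rep1 fin1 [ri1 sl1] _ _] := sw1; have [rep2 fin2 [ri2 sl2] _ _] := sw2.
  exists al1, al2, r1, r2, r3, r4; split => //.
  by apply: exactly2 => // be /compl[] []; [left|right].
split=> [a C|].
  have [[hC a0]|no] := pselect (C = C1 a /\ a != 0); last first.
    by exists 1 => // w [hC a0 _]; exfalso; exact: no.
  have [d d0 h] := one_double_drops a0 (one_double_C1 a0); rewrite -hC in h.
  exists (Num.sqrt d); first by rewrite sqrtr_gt0.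
  move=> w [_ _ w0]; have [al [rep _ sf _] compl] := h w w0.
  by exists al; split => //; apply: exactly1 => // be /compl[].
split=> [a C|].
  have [[hC ai]|no] := pselect (C = C2 a /\ 0 < a < 8 / 27); last first.
    by exists 1 => // w [hC ai _]; exfalso; exact: no.
  have a0 : a != 0 by have /andP[/gt_eqF ->] := ai.
  have [k1 k2 k3] := R2_spec ai; have [e _] := C2_spec ai.
  have r0 : 0 < R2 a by exact: lt_trans k1.
  exists (R2 a) => // w [_ _ w0]; rewrite hC e.
  have [al1 [al2 [r1 [r2 [ci sw nc compl]]]]] := inner_double_drops a0 k1 k2 k3 w0.
  have [rep1 _ sf1 _] := ci; have [rep2 fin2 [[/andP[_ r12] _ _ _] _] [_ [s e1] [s' e2]] _] := sw.
  exists al1, al2; split => //.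
  - by apply: exactly2 => // be /compl[] []; [left|right].
  - by rewrite sf1 sqrtr_sqr gtr0_norm.
  - by move=> /(circular_rad w0) /(_ s s'); rewrite e1 e2 => er; move: r12; rewrite er ltxx.
split=> [a C|].
  have [[hC ai]|no] := pselect (C = C3 a /\ 0 < a < 8 / 27); last first.
    by exists 1 => // w [hC ai _]; exfalso; exact: no.
  have a0 : a != 0 by have /andP[/gt_eqF ->] := ai.
  have [k1 k2] := R3_spec ai; have [e _] := C3_spec ai.
  have r0 : 0 < R3 a by rewrite (lt_trans _ k1).
  exists (R3 a) => // w [_ _ w0]; rewrite hC e.
  have [al1 [al2 [al3 [r1 [r3 [[ci wi2 wi3] nc dr [ri1 ri2] compl]]]]]] :=
    outer_double_drops a0 k1 k2 w0.
  have [rep1 _ sf1 _] := ci; have [rep2 sl2 ex2 _] := wi2; have [rep3 sl3 ex3 _] := wi3.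
  exists al1, al2, al3, r1, (R3 a ^+ 2), r3; split => //.
  - apply: exactly3 => // be /compl[] -[cg _]; [exact: Or31|exact: Or32|exact: Or33].
  - by rewrite sf1 sqrtr_sqr gtr0_norm.
split=> [a C|].
  have [[ea hC]|no] := pselect (a = 8 / 27 /\ C = - (9 / 8)); last first.
    by exists 1 => // w [ea hC _]; exfalso; exact: no.
  exists (Num.sqrt (9 / 4)); first by rewrite sqrtr_gt0 divr_gt0.
  move=> w [_ _ w0]; rewrite hC.
  have [al1 [al2 [i [ci wi nc compl]]]] := triple_drops ea w0.
  have [rep1 _ sf1 _] := ci; have [rep2 sl2 ex2 _] := wi.
  exists al1, al2; split => //.
  by apply: exactly2 => // be /compl[] []; [left|right].
split=> a w al a0 w0 rd; have [C rep] := Gfun_cst rd.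
  by exists C => //; exact: classify rep.
move=> nex; have [k|//|[r1 [r2 [_ _ [ri sl] _ [h1 h2]]]]] := drop_kinds a0 w0 rep; first by left.
by right; exists C, r1, r2; split.
Qed.
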